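(* Let $\mathrm{B}$ be a GBS satisfying Assumption (A) which is a realization of $y$. Then $\mathrm{B}$ is a minimal realization of $y$ if and only if $R_{\mathrm{B}}$ is a minimal representation (of $\Psi_y$). If $\mathrm{B}_1$ and $\mathrm{B}_2$ are both minimal realizations of $y$ satisfying Assumption (A), then $R_{\mathrm{B}_1}$ and $R_{\mathrm{B}_2}$ are isomorphic.
   Context: Setting (RC framework). All random variables on one probability space. $\Sigma$ finite alphabet, $\Sigma^*$ finite words ($\epsilon$ empty), $\Sigma^+=\Sigma^*\setminus\{\epsilon\}$, $|w|$ length. Fix $p_\sigma>0$; $p_\epsilon=1$, $p_{\sigma_1\cdots\sigma_k}=\prod_i p_{\sigma_i}$. For matrices $A_\sigma$, $A_w=A_{\sigma_k}\cdots A_{\sigma_1}$, $A_\epsilon=I$. Inputs: scalar processes $u_\sigma(t)$ with $\sum_\sigma\alpha_\sigma u_\sigma(t)=1$ for constants $\alpha_\sigma$, all first/second moments of $u_w(t)$ finite, $u_w(t)=u_{\sigma_1}(t-k+1)u_{\sigma_2}(t-k+2)\cdots u_{\sigma_k}(t)$. $z^r_w(t)=r(t-|w|)u_w(t-1)/\sqrt{p_w}$. Admissible set $L\subseteq\Sigma^+$: $\Sigma\subseteq L$; $u_w=0$ a.s. for $w\notin L$; for some $S\subseteq\Sigma\times\Sigma$ a word of length $>1$ is in $L$ iff all consecutive letter pairs are in $S$. RC process $r$: (1) $E[r(t)]=0$, $E[z^r_w(t)]=0$, $E[r(t)z^r_w(t)^T]$, $E[z^r_w(t)z^r_{w'}(t)^T]$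 finite and $t$-independent; $T^r_{w,w'}:=E[z^r_wz^{rT}_{w'}]$, $\Lambda^r_w:=E[r(t)z^r_w(t)^T]$; (2) $T^r_{\sigma,\sigma'}=0$ ($\sigma\ne\sigma'$); $T^r_{w\sigma,w'\sigma'}=0$ ($\sigma\ne\sigma'$), $T^r_{w\sigma,w'\sigma}=T^r_{w,w'}$ if $w\sigma\in L$ or $w'\sigma\in L$; $T^r_{w\sigma,\sigma'}=0$ ($\sigma\ne\sigma'$), $T^r_{w\sigma,\sigma}=(\Lambda^r_w)^T$; (3) $T^r_{w,w'}=0$ if $w\notin L$ or $w'\notin L$; if $w\sigma\in L$, $w'\sigma\notin L$ then $T^r_{w',w}=T^r_{w,w'}=0$. Hilbert space generated by random vectors = mean-square closure of span of their coordinates. GBS: $A_\sigma\in\mathbb{R}^{n\times n}$, $K_\sigma\in\mathbb{R}^{n\times m}$, $C\in\mathbb{R}^{p\times n}$, $D\in\mathbb{R}^{p\times m}$, processes $x,v,y$ with $x(t+1)=\sum_\sigma(A_\sigma x(t)+K_\sigma v(t))u_\sigma(t)$, $y(t)=Cx(t)+Dv(t)$; dimension $n$; realization of $y$ if output equals $y$. Assumption (A): (A1) $v$ RC; (A2) $E[z^v_wz^{vT}_{w'}]=0$ for $w\ne w'$; (A3) $x(t)$ in Hilbert space generated by $\{z^v_w(t)\mid w\in\Sigma^+\}$; (A4) eigenvalues of $\sum_\sigma p_\sigma A_\sigma^T\otimes A_\sigma^T$ of modulus $<1$; (A5) if $\sigma_1\sigma_2\notin L$ then $A_{\sigma_2}A_{\sigma_1}=0$,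 $A_{\sigma_2}K_{\sigma_1}T^v_{\sigma_1,\sigma_1}=0$. A GBS is a minimal realization of $y$ if it satisfies (A), realizes $y$, and has minimal dimension among all GBS realizations of $y$ satisfying (A). Formal power series family $\Psi=\{S_j:\Sigma^*\to\mathbb{R}^p\}_{j\in J}$; representation $(\mathbb{R}^n,\{F_\sigma\},\{G_j\},H)$ with $S_j(w)=HF_wG_j$; minimal if of smallest dimension; two representations of the same dimension $(\mathbb{R}^n,\{F_\sigma\},\{G_j\},H)$, $(\mathbb{R}^n,\{\tilde F_\sigma\},\{\tilde G_j\},\tilde H)$ are isomorphic if there is invertible $T$ with $T\tilde F_\sigma=F_\sigma T$, $T\tilde G_j=G_j$, $\tilde H=HT$. $\Psi_y=\{S_{(j,\sigma)}\}$ with $S_{(j,\sigma)}(w)$ = $j$-th column of $E[y(t)z^y_{\sigma w}(t)^T]$. Representation associated with $\mathrm{B}$: with $Q_\sigma=E[v(t)v(t)^Tu_\sigma(t)^2]$ and $\{P_\sigma\}$ the unique solution of $P_\sigma=p_\sigma\sum_{\sigma_1:\sigma_1\sigma\in L}(A_{\sigma_1}P_{\sigma_1}A_{\sigma_1}^T+K_{\sigma_1}Q_{\sigma_1}K_{\sigma_1}^T)$, set $B_\sigma=p_\sigma^{-1/2}(A_\sigma P_\sigma C^T+K_\sigma Q_\sigma D^T)$ and $R_{\mathrm{B}}=(\mathbb{R}^n,\{\sqrt{p_\sigma}A_\sigma\},\{B_{\sigma,j}\}_{(j,\sigma)},C)$, $B_{\sigma,j}$ the $j$-th column of $B_\sigma$.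 *)

(* Defs.v *)
From HB Require Import structures.
From mathcomp Require Import all_boot all_order all_algebra.
From mathcomp Require Import all_classical all_reals all_analysis.
From mathcomp.real_closed Require Import complex mxtens.
Set Implicit Arguments. Unset Strict Implicit. Unset Printing Implicit Defensive.
Import Order.TTheory GRing.Theory Num.Theory.
Local Open Scope ring_scope.

Section GBS.
Context {R : realType} {d : measure_display} {Omega : measurableType d}
        (P : probability Omega R) (S : finType).

(* E[f] for a real random variable (meaningful when f is integrable) *)
Definition Ex (f : Omega -> R) : R := fine (\int[P]_w (f w)%:E).
Definition Emx {a b : nat} (X : Omega -> 'M[R]_(a, b)) : 'M[R]_(a, b) :=
  \matrix_(i, j) Ex (fun w => X w i j).
Definition Ecross {a b : nat} (X : Omega -> 'cV[R]_a) (Y : Omega -> 'cV[R]_b)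
  : 'M[R]_(a, b) := Emx (fun w => X w *m (Y w)^T).
Definition fin_mean {a : nat} (X : Omega -> 'cV[R]_a) : Prop :=
  forall i, P.-integrable setT (fun w => (X w i 0)%:E).
Definition fin_cross {a b : nat} (X : Omega -> 'cV[R]_a) (Y : Omega -> 'cV[R]_b)
  : Prop :=
  forall i j, P.-integrable setT (fun w => (X w i 0 * Y w j 0)%:E).
Definition sq_int (f : Omega -> R) : Prop :=
  measurable_fun setT f /\ P.-integrable setT (fun w => (f w ^+ 2)%:E).

Definition pw (p : S -> R) (w : seq S) : R := \prod_(s <- w) p s.
Definition mxw {n : nat} (A : S -> 'M[R]_n) (w : seq S) : 'M[R]_n :=
  foldl (fun M s => A s *m M) 1%:M w.
Definition uw (u : S -> int -> Omega -> R) (w : seq S) (t : int) : Omega -> R :=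
  fun om => \prod_(i < size w)
     u (tnth (in_tuple w) i)
       (t - (size w)%:Z + 1 + (i : nat)%:Z) om.
Definition zw (p : S -> R) (u : S -> int -> Omega -> R) {m : nat}
  (r : int -> Omega -> 'cV[R]_m) (w : seq S) (t : int) : Omega -> 'cV[R]_m :=
  fun om => (uw u w (t - 1) om / Num.sqrt (pw p w)) *: r (t - (size w)%:Z) om.

Definition input_hyp (u : S -> int -> Omega -> R) : Prop :=
  (exists alpha : S -> R, forall t,
      {ae P, forall om, \sum_(s : S) alpha s * u s t om = 1}) /\
  (forall w t, w != [::] -> sq_int (uw u w t)).

Definition admissible (u : S -> int -> Omega -> R) (L : pred (seq S)) : Prop :=
  (forall s : S, L [:: s]) /\
  (forall w t, w != [::] -> ~~ L w -> {ae P, forall om, uw u w t om = 0}) /\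
  (exists Srel : rel S, forall w : seq S, (1 < size w)%N ->
      (L w <-> all (fun x => Srel x.1 x.2) (zip w (behead w)))).

Section RC.
Variables (p : S -> R) (u : S -> int -> Omega -> R) (L : pred (seq S)).

(* T^r_{w,w'} and Lambda^r_w (evaluated at t = 0; t-independence is part of RC) *)
Definition Tr {m : nat} (r : int -> Omega -> 'cV[R]_m) (w w' : seq S) : 'M[R]_m :=
  Ecross (zw p u r w 0) (zw p u r w' 0).
Definition Lam {m : nat} (r : int -> Omega -> 'cV[R]_m) (w : seq S) : 'M[R]_m :=
  Ecross (r 0) (zw p u r w 0).

Definition RC {m : nat} (r : int -> Omega -> 'cV[R]_m) : Prop :=
  (forall t, fin_mean (r t) /\ Emx (r t) = 0) /\
  (forall t w, w != [::] -> fin_mean (zw p u r w t) /\ Emx (zw p u r w t) = 0) /\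
  (forall t w, w != [::] -> fin_cross (r t) (zw p u r w t)) /\
  (forall t w w', w != [::] -> w' != [::] ->
      fin_cross (zw p u r w t) (zw p u r w' t)) /\
  (forall t t' w, w != [::] ->
      Ecross (r t) (zw p u r w t) = Ecross (r t') (zw p u r w t')) /\
  (forall t t' w w', w != [::] -> w' != [::] ->
      Ecross (zw p u r w t) (zw p u r w' t) =
      Ecross (zw p u r w t') (zw p u r w' t')) /\
  (forall s s' : S, s != s' -> Tr r [:: s] [:: s'] = 0) /\
  (forall (w w' : seq S) (s s' : S), w != [::] -> w' != [::] -> s != s' ->
      Tr r (rcons w s) (rcons w' s') = 0) /\
  (forall (w w' : seq S) (s : S), w != [::] -> w' != [::] ->
      L (rcons w s) || L (rcons w' s) ->
      Tr r (rcons w s) (rcons w' s) = Tr r w w') /\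
  (forall (w : seq S) (s s' : S), w != [::] -> s != s' ->
      Tr r (rcons w s) [:: s'] = 0) /\
  (forall (w : seq S) (s : S), w != [::] ->
      Tr r (rcons w s) [:: s] = (Lam r w)^T) /\
  (forall w w' : seq S, w != [::] -> w' != [::] -> ~~ L w || ~~ L w' ->
      Tr r w w' = 0) /\
  (forall (w w' : seq S) (s : S), w != [::] -> w' != [::] ->
      L (rcons w s) -> ~~ L (rcons w' s) ->
      Tr r w' w = 0 /\ Tr r w w' = 0).

Definition in_hilbert {m : nat} (f : Omega -> R) (t : int)
  (v : int -> Omega -> 'cV[R]_m) : Prop :=
  sq_int f /\
  forall eps : R, 0 < eps ->
    exists c : seq (seq S * 'I_m * R),
      all (fun x => x.1.1 != [::]) c /\
      (\int[P]_om ((f om - \sum_(x <- c) x.2 * zw p u v x.1.1 t om x.1.2 0) ^+ 2)%:E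
         < eps%:E)%E.

Record gbs (n m q : nat) := GBS {
  gA : S -> 'M[R]_n;
  gK : S -> 'M[R]_(n, m);
  gC : 'M[R]_(q, n);
  gD : 'M[R]_(q, m);
  gx : int -> Omega -> 'cV[R]_n;
  gv : int -> Omega -> 'cV[R]_m }.

Definition is_gbs {n m q : nat} (B : gbs n m q) : Prop :=
  forall t, {ae P, forall om, gx B (t + 1) om =
     \sum_(s : S) (u s t om *: (gA B s *m gx B t om + gK B s *m gv B t om))}.

Definition realizes {n m q : nat} (B : gbs n m q) (y : int -> Omega -> 'cV[R]_q)
  : Prop :=
  forall t, {ae P, forall om, y t om = gC B *m gx B t om + gD B *m gv B t om}.

Definition assumptionA {n m q : nat} (B : gbs n m q) : Prop :=
  (* A1 *) RC (gv B) /\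
  (* A2 *) (forall t w w', w != [::] -> w' != [::] -> w != w' ->
      Ecross (zw p u (gv B) w t) (zw p u (gv B) w' t) = 0) /\
  (* A3 *) (forall t (i : 'I_n), in_hilbert (fun om => gx B t om i 0) t (gv B)) /\
  (* A4 *) (forall lam : R[i],
      eigenvalue (map_mx (fun a => (a%:C)%C)
         (\sum_(s : S) p s *: ((gA B s)^T *t (gA B s)^T))) lam ->
      `|lam| < 1) /\
  (* A5 *) (forall s1 s2 : S, ~~ L [:: s1; s2] ->
      gA B s2 *m gA B s1 = 0 /\
      gA B s2 *m gK B s1 *m Tr (gv B) [:: s1] [:: s1] = 0).

Definition minimal_realization {n m q : nat} (B : gbs n m q)
  (y : int -> Omega -> 'cV[R]_q) : Prop :=
  is_gbs B /\ assumptionA B /\ realizes B y /\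
  forall (n' m' : nat) (B' : gbs n' m' q),
    is_gbs B' -> assumptionA B' -> realizes B' y -> (n <= n')%N.

Record repr (J : finType) (n q : nat) := Repr {
  rF : S -> 'M[R]_n;
  rG : J -> 'cV[R]_n;
  rH : 'M[R]_(q, n) }.

Definition is_repr {J : finType} {n q : nat} (Psi : J -> seq S -> 'cV[R]_q)
  (Rp : repr J n q) : Prop :=
  forall j w, Psi j w = rH Rp *m mxw (rF Rp) w *m rG Rp j.

Definition minimal_repr {J : finType} {n q : nat} (Psi : J -> seq S -> 'cV[R]_q)
  (Rp : repr J n q) : Prop :=
  is_repr Psi Rp /\
  forall (n' : nat) (Rp' : repr J n' q), is_repr Psi Rp' -> (n <= n')%N.

Definition repr_iso {J : finType} {n1 n2 q : nat}
  (R1 : repr J n1 q) (R2 : repr J n2 q) : Prop :=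
  n1 = n2 /\
  exists (Tm : 'M[R]_(n1, n2)) (Ti : 'M[R]_(n2, n1)),
    Tm *m Ti = 1%:M /\ Ti *m Tm = 1%:M /\
    (forall s, Tm *m rF R2 s = rF R1 s *m Tm) /\
    (forall j, Tm *m rG R2 j = rG R1 j) /\
    rH R2 = rH R1 *m Tm.

Definition Psi_y {q : nat} (y : int -> Omega -> 'cV[R]_q) :
  ('I_q * S)%type -> seq S -> 'cV[R]_q :=
  fun js w => col js.1 (Ecross (y 0) (zw p u y (js.2 :: w) 0)).

Definition Qm {n m q : nat} (B : gbs n m q) (s : S) : 'M[R]_m :=
  Emx (fun om => (u s 0 om ^+ 2) *: (gv B 0 om *m (gv B 0 om)^T)).

Definition is_Psol {n m q : nat} (B : gbs n m q) (Pm : S -> 'M[R]_n) : Prop :=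
  forall s, Pm s = p s *: \sum_(s1 : S | L [:: s1; s])
     (gA B s1 *m Pm s1 *m (gA B s1)^T + gK B s1 *m Qm B s1 *m (gK B s1)^T).

(* the (unique, under Assumption (A)) solution {P_s} *)
Definition Psol {n m q : nat} (B : gbs n m q) : S -> 'M[R]_n :=
  xget (fun _ => 0) (is_Psol B).

Definition Bm {n m q : nat} (B : gbs n m q) (s : S) : 'M[R]_(n, q) :=
  (Num.sqrt (p s))^-1 *:
    (gA B s *m Psol B s *m (gC B)^T + gK B s *m Qm B s *m (gD B)^T).

Definition R_B {n m q : nat} (B : gbs n m q) : repr ('I_q * S)%type n q :=
  Repr (fun s => Num.sqrt (p s) *: gA B s)
       (fun js => col js.1 (Bm B js.2))
       (gC B).

End RC.
End GBS.

(* Main.v *)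
Require Import Defs.
From HB Require Import structures.
From mathcomp Require Import all_boot all_order all_algebra.
From mathcomp Require Import all_classical all_reals all_analysis.
From mathcomp Require Import measurable_realfun ring lra zify.
From mathcomp.real_closed Require Import complex mxtens.

(* R_B represents Psi_y for every realization B: conditioning on the last letter
   gives E[x(t) z_{ws}(t)^T] = sqrt(p_s) A_s E[x(t-1) z_w(t-1)^T], and Assumption
   (A5) absorbs the words outside L.  Hence a minimal R_B forces B to be minimal.

   Conversely, a minimal B must have R_B observable and reachable.  If R_B is not
   observable, the quotient of the state by the unobservable subspace is a smaller
   realization driven by the same noise.  If R_B is not reachable, let xh be the
   projection of x on the past of the output and e = y - C xh the innovation.
   Then e is again a white RC noise and xh(t+1) = sum_s (A_s xh + Kh_s e)(t) u_s(t).
   Since E[xh z^T] = E[x z^T] for z in the past of y, xh takes its values in the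
   reachable subspace, so restricting to it gives a smaller realization.  That xh
   lies in the past of e holds because xh minus its projection there satisfies the
   noise-free state equation, so its covariance is a fixed point of
   X |-> sum_s p_s A_s X A_s^T, and 1 is not an eigenvalue of this map.

   All projections are taken in the space of processes approximated by
   combinations of the z_w(t) with coefficients independent of t, which makes the
   projected processes stationary. *)

Set Implicit Arguments. Unset Strict Implicit. Unset Printing Implicit Defensive.
Import Order.TTheory GRing.Theory Num.Theory.
Local Open Scope ring_scope.

(** * Representations of formal power series *)

Section PropSubspace.
Context {F : fieldType} {n : nat}.

(** The reachable subspace of [R_B] is spanned by correlations of the state with the past output.
    The state itself may leave it, because noise components that the output does not see can still
    drive the state. So [x] cannot simply be restricted to that subspace and is filtered beforehand.
    Each reduction yields a system of some dimension [r <= n] together with the implication that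
    [n <= r] forces reachability or observability, so minimality enters only as the inequality
    [n <= r]. Competing realizations may have any noise dimension, which admits the innovation, of
    dimension [q], as a noise. The analytic obstacle is that u_s is unbounded: the product of u_s
    with a square-integrable variable need not be square integrable. On finite combinations of the
    z_w of a white noise, multiplication by u_s / sqrt(p_s) is a contraction, and the resulting
    control passes to the closed span. Estimates for the output and the innovation are borrowed from
    the noise of the given system, whose past contains theirs. *)

Lemma max_rank_witness (Q : 'M[F]_n -> Prop) :
  Q 0 -> exists2 X, Q X & forall Y, Q Y -> (\rank Y <= \rank X)%N.
Proof.
move=> Q0.
have ex : exists k, `[< exists2 X, Q X & \rank X = k >].
  by exists 0%N; apply/asboolP; exists 0; rewrite ?mxrank0.
have ub k : `[< exists2 X, Q X & \rank X = k >] -> (k <= n)%N.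
  by move/asboolP=> [X _ <-]; exact: rank_leq_row.
case: (ex_maxnP ex ub) => k /asboolP[X QX rX] kmax.
by exists X => // Y QY; rewrite rX; apply: kmax; apply/asboolP; exists Y.
Qed.

(** Take [X] of maximal rank among the matrices whose row space lies in [U]. A vector of [U] outside
    that row space could be adjoined and would raise the rank. *)
Lemma prop_subspaceP (U : 'rV[F]_n -> Prop) :
  U 0 -> (forall a x y, U x -> U y -> U (a *: x + y)) ->
  exists X : 'M[F]_n, forall v, U v <-> (v <= X)%MS.
Proof.
move=> U0 Ulin.
pose Q (X : 'M[F]_n) := forall v : 'rV_n, (v <= X)%MS -> U v.
have UD x y : U x -> U y -> U (x + y) by move=> hx hy; rewrite -[x]scale1r; exact: Ulin.
have UZ a x : U x -> U (a *: x) by move=> hx; rewrite -[a *: x]addr0; exact: Ulin.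
have [|X QX Xmax] := @max_rank_witness Q.
  by move=> v; rewrite submx0 => /eqP->.
exists X => v; split; last exact: QX.
move=> Uv.
have QY : Q (X + <<v>>)%MS.
  move=> w /sub_addsmxP[[a b] /= ->]; apply: UD; first by apply: QX; exact: submxMl.
  have /submxP[c ->] : (b *m <<v>> <= v)%MS by rewrite (submx_trans (submxMl _ _)) ?genmxE.
  by rewrite [c]mx11_scalar mul_scalar_mx; exact: UZ.
have := Xmax _ QY; rewrite (geq_leqif (mxrank_leqif_sup (addsmxSl X <<v>>%MS))) => h.
by apply: submx_trans h; rewrite (submx_trans _ (addsmxSr _ _)) ?genmxE.
Qed.

(** The rows of [E] form a basis of [U] and [Em] is a right inverse of [E]. The last clause turns a
    dimension count into the statement that [U] is everything, which is the form in which minimality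
    is exploited. *)
Lemma invariant_factor (I : Type) (M : I -> 'M[F]_n) (U : 'rV[F]_n -> Prop) :
  U 0 -> (forall a x y, U x -> U y -> U (a *: x + y)) ->
  (forall i v, U v -> U (v *m M i)) ->
  exists (r : nat) (E : 'M[F]_(r, n)) (Em : 'M[F]_(n, r)),
    [/\ E *m Em = 1%:M,
        forall i, E *m M i = (E *m M i *m Em) *m E,
        forall k (V : 'M[F]_(k, n)), (forall j, U (row j V)) -> V = V *m Em *m E,
        (r <= n)%N
      & (n <= r)%N -> forall v, U v].
Proof.
move=> U0 Ulin UM; have [X UX] := prop_subspaceP U0 Ulin.
have fE : row_free (row_base X) by exact: row_base_free.
have sub k (V : 'M[F]_(k, n)) : (forall j, U (row j V)) ->
    V = V *m pinvmx (row_base X) *m row_base X.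
  move=> UV; rewrite mulmxKpV // eq_row_base; apply/row_subP => j.
  exact/UX.
exists (\rank X), (row_base X), (pinvmx (row_base X)).
split => //.
- by rewrite mulmxVp.
- move=> i; apply: sub => j; rewrite row_mul; apply: UM; apply/UX.
  by rewrite -(eq_row_base X) row_sub.
- exact: rank_leq_row.
- move=> rn v; apply/UX; apply: submx_full.
  by rewrite /row_full eqn_leq rank_leq_col.
Qed.
End PropSubspace.

Lemma col_mulmx (F : pzRingType) (a b c : nat) (A : 'M[F]_(a, b)) (B : 'M[F]_(b, c)) j :
  col j (A *m B) = A *m col j B.
Proof. by rewrite !colE mulmxA. Qed.

Section Representations.
Context {R : realType} {S : finType}.

Lemma mxw_rcons {n : nat} (A : S -> 'M[R]_n) w s :
  mxw A (rcons w s) = A s *m mxw A w.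
Proof. by rewrite /mxw foldl_rcons. Qed.

Lemma mxw_cons {n : nat} (A : S -> 'M[R]_n) s w :
  mxw A (s :: w) = mxw A w *m A s.
Proof.
elim/last_ind: w => [|w s' IH]; first by rewrite /mxw /= mulmx1 mul1mx.
by rewrite -rcons_cons !mxw_rcons IH mulmxA.
Qed.

Lemma mxw_cat {n : nat} (A : S -> 'M[R]_n) w w' :
  mxw A (w ++ w') = mxw A w' *m mxw A w.
Proof.
elim: w => [|s w IH]; first by rewrite /mxw /= mulmx1.
by rewrite cat_cons !mxw_cons IH mulmxA.
Qed.

Lemma mxw_intertwine {n r : nat} (A : S -> 'M[R]_n) (A' : S -> 'M[R]_r)
    (J : 'M[R]_(n, r)) :
  (forall s, A s *m J = J *m A' s) -> forall w, mxw A w *m J = J *m mxw A' w.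
Proof.
move=> h; elim/last_ind => [|w s IH]; first by rewrite /mxw /= mulmx1 mul1mx.
by rewrite !mxw_rcons -mulmxA IH !mulmxA h.
Qed.

Variables (J : finType) (q : nat).

Definition reachable {n : nat} (X : @Defs.repr R S J n q) : Prop :=
  forall l : 'rV_n, (forall w j, l *m mxw (rF X) w *m rG X j = 0) -> l = 0.

Definition observable {n : nat} (X : @Defs.repr R S J n q) : Prop :=
  forall x : 'cV_n, (forall w, rH X *m mxw (rF X) w *m x = 0) -> x = 0.

Lemma reach_factor {n : nat} (X : @Defs.repr R S J n q) :
  exists (r : nat) (T : 'M[R]_(n, r)) (Tm : 'M[R]_(r, n)),
    [/\ Tm *m T = 1%:M,
        forall s, rF X s *m T = T *m (Tm *m rF X s *m T),
        forall j, rG X j = T *m (Tm *m rG X j),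
        (r <= n)%N
      & (n <= r)%N -> reachable X].
Proof.
(* The span of the vectors F_w G_j is written as a double annihilator, so linearity and invariance
   need no generating family. *)
pose U (v : 'rV_n) := forall l : 'rV_n,
  (forall w j, l *m mxw (rF X) w *m rG X j = 0) -> l *m v^T = 0.
have [||s v|r [E [Em [EEm EM EV rn full]]]] := @invariant_factor _ _ _ (fun s => (rF X s)^T) U.
- by move=> l _; rewrite trmx0 mulmx0.
- move=> a x y Ux Uy l hl; rewrite linearD linearZ /= mulmxDr -scalemxAr.
  by rewrite Ux // Uy // scaler0 addr0.
- move=> Uv l hl; rewrite trmx_mul trmxK mulmxA; apply: Uv => w j.
  by rewrite -!mulmxA (mulmxA (rF X s)) -mxw_rcons !mulmxA hl.
exists r, E^T, Em^T; split => //.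
- by rewrite -trmx_mul EEm trmx1.
- by move=> s; apply: trmx_inj; rewrite !trmx_mul !trmxK EM !mulmxA.
- move=> j; apply: trmx_inj; rewrite !trmx_mul !trmxK.
  apply: EV => i l /(_ [::] j); rewrite /mxw /= mulmx1 => <-.
  by rewrite ord1 row_id trmxK.
- move=> nr l hl; apply: trmx_inj; apply/matrixP => i j.
  have /matrixP/(_ 0 0) := full nr (delta_mx 0 i) l hl.
  by rewrite trmx_delta -colE !mxE ord1.
Qed.

(** Quotient by the unobservable subspace: [U] consists of the row vectors vanishing on it, and [E]
    is the quotient map in coordinates. *)
Lemma obs_factor {n : nat} (X : @Defs.repr R S J n q) :
  exists (r : nat) (E : 'M[R]_(r, n)) (Em : 'M[R]_(n, r)),
    [/\ E *m Em = 1%:M,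
        forall s, E *m rF X s = (E *m rF X s *m Em) *m E,
        rH X = rH X *m Em *m E,
        (r <= n)%N
      & (n <= r)%N -> observable X].
Proof.
pose U (v : 'rV_n) := forall x : 'cV_n,
  (forall w, rH X *m mxw (rF X) w *m x = 0) -> v *m x = 0.
have [||s v|r [E [Em [EEm EM EV rn full]]]] := @invariant_factor _ _ _ (rF X) U.
- by move=> l _; rewrite mul0mx.
- move=> a x y Ux Uy l hl; rewrite mulmxDl -scalemxAl.
  by rewrite Ux // Uy // scaler0 addr0.
- move=> Uv l hl; rewrite -mulmxA; apply: Uv => w.
  by rewrite mulmxA -(mulmxA (rH X)) -mxw_cons hl.
exists r, E, Em; split => //.
- apply: EV => j l /(_ [::]); rewrite /mxw /= mulmx1 => h.
  by rewrite -row_mul h row0.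
- move=> nr l hl; apply/matrixP => i j.
  have /matrixP/(_ 0 0) := full nr (delta_mx 0 i) l hl.
  by rewrite -rowE !mxE ord1.
Qed.

(* On vectors reached by X1, sending F_w G_j of X1 to F_w G_j of X2 is well
   defined because observations only depend on the represented series. *)
Lemma reachable_transfer {n1 n2 : nat} (Psi : J -> seq S -> 'cV[R]_q)
    (X1 : @Defs.repr R S J n1 q) (X2 : @Defs.repr R S J n2 q) :
  is_repr Psi X1 -> is_repr Psi X2 -> reachable X1 ->
  exists T : 'M[R]_(n2, n1), forall w,
    rH X2 *m mxw (rF X2) w *m T = rH X1 *m mxw (rF X1) w.
Proof.
move=> h1 h2 r1.
(* Vectors of [X1] whose observations are reproduced by a vector [c] of [X2]. *)
pose U (v : 'rV[R]_n1) := exists c : 'cV[R]_n2, forall w,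
  rH X2 *m mxw (rF X2) w *m c = rH X1 *m mxw (rF X1) w *m v^T.
have [||M UM] := @prop_subspaceP _ _ U.
- by exists 0 => w; rewrite trmx0 !mulmx0.
- move=> a x y [cx hx] [cy hy]; exists (a *: cx + cy) => w.
  have -> : (a *: x + y)^T = a *: x^T + y^T by rewrite linearD linearZ.
  by rewrite !mulmxDr -!scalemxAr hx hy.
(* [U] contains every F_w G_j of [X1], so each column of [cokermx M] annihilates all of them and
   vanishes by reachability. *)
have fM : row_full M.
  rewrite -cokermx_eq0 -trmx_eq0; apply/eqP/row_matrixP => i; rewrite row0.
  apply: r1 => w j.
  have /UM hD : U (mxw (rF X1) w *m rG X1 j)^T.
    exists (mxw (rF X2) w *m rG X2 j) => w'; rewrite trmxK.
    have E k (X : @Defs.repr R S J k q) : rH X *m mxw (rF X) w' *m (mxw (rF X) w *m rG X j)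
      = rH X *m mxw (rF X) (w ++ w') *m rG X j by rewrite mxw_cat !mulmxA.
    by rewrite !E -h1 -h2.
  have : (mxw (rF X1) w *m rG X1 j)^T *m cokermx M = 0.
    by apply/eqP; rewrite -submxE.
  move/(congr1 trmx); rewrite trmx_mul trmxK trmx0 => h.
  by rewrite -mulmxA -row_mul h row0.
have /fin_all_exists[T hT] : forall i : 'I_n1, exists c : 'cV[R]_n2, forall w,
  rH X2 *m mxw (rF X2) w *m c = rH X1 *m mxw (rF X1) w *m (delta_mx i 0).
  move=> i; have [c hc] : U (delta_mx 0 i).
    by apply/UM/submx_full.
  by exists c => w; rewrite hc trmx_delta.
exists (\matrix_(i, j) T j i 0) => w; apply/matrixP => i j.
have /matrixP/(_ i 0) := hT j w; rewrite -colE [in RHS]mxE => <-.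
by rewrite !mxE; apply: eq_bigr => k _; rewrite !mxE.
Qed.

(** The transfer map into any other representation is injective, since a vector it kills is
    unobservable; hence [n <= n']. *)
Lemma repr_minimal_of_reach_obs {n : nat} (Psi : J -> seq S -> 'cV[R]_q)
    (X : @Defs.repr R S J n q) :
  is_repr Psi X -> reachable X -> observable X -> minimal_repr Psi X.
Proof.
move=> hX rX oX; split=> // n' X' hX'.
have [T hT] := reachable_transfer hX hX' rX.
have : row_full T.
  rewrite -cokermx_eq0; apply/eqP/matrixP => i j.
  have /matrixP/(_ i 0) : col j (cokermx T) = 0.
    by apply: oX => w; rewrite -hT -mulmxA -col_mulmx mulmx_coker col0 mulmx0.
  by rewrite !mxE.
by rewrite /row_full => /eqP <-; exact: rank_leq_row.
Qed.

(** Transfer maps exist both ways. Each identity required of them holds after applying every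
    observation H F_w, and observability cancels the observation. *)
Lemma repr_iso_of_reach_obs {n1 n2 : nat} (Psi : J -> seq S -> 'cV[R]_q)
    (X1 : @Defs.repr R S J n1 q) (X2 : @Defs.repr R S J n2 q) :
  is_repr Psi X1 -> is_repr Psi X2 ->
  reachable X1 -> observable X1 -> reachable X2 -> observable X2 ->
  repr_iso X1 X2.
Proof.
move=> h1 h2 r1 o1 r2 o2.
have obsE n m (X : @Defs.repr R S J n q) (A B : 'M[R]_(n, m)) : observable X ->
    (forall w, rH X *m mxw (rF X) w *m A = rH X *m mxw (rF X) w *m B) -> A = B.
  move=> oX h; apply/eqP; rewrite -subr_eq0; apply/eqP/matrixP => i j.
  have /matrixP/(_ i 0) : col j (A - B) = 0.
    by apply: oX => w; rewrite -col_mulmx mulmxBr h subrr col0.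
  by rewrite !mxE.
have [Ti hTi] := reachable_transfer h1 h2 r1.
have [Tm hTm] := reachable_transfer h2 h1 r2.
split.
  have [_ m1] := repr_minimal_of_reach_obs h1 r1 o1.
  have [_ m2] := repr_minimal_of_reach_obs h2 r2 o2.
  by apply/eqP; rewrite eqn_leq (m1 _ _ h2) (m2 _ _ h1).
exists Tm, Ti; split; last split; last split; last split.
- by apply: (obsE _ _ X1) => // w; rewrite mulmxA hTm hTi mulmx1.
- by apply: (obsE _ _ X2) => // w; rewrite mulmxA hTi hTm mulmx1.
- move=> s; apply: (obsE _ _ X1) => // w.
  have E k (X : @Defs.repr R S J k q) :
    rH X *m mxw (rF X) w *m rF X s = rH X *m mxw (rF X) (s :: w) by rewrite mxw_cons mulmxA.
  by rewrite !mulmxA hTm !E hTm.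
- move=> j; apply: (obsE _ _ X1) => // w.
  by rewrite mulmxA hTm -h1 -h2.
- by have := hTm [::]; rewrite /mxw /= !mulmx1.
Qed.
End Representations.

(** * Kronecker sums and the maps X |-> sum_s p_s A_s X A_s^T *)

Section Kronecker.

(** Eigenvectors are row vectors here; [v] is sent to [v *m X], which stays nonzero because [X] has
    a right inverse. *)
Lemma eigenvalue_intertwine (F : fieldType) (r n : nat) (N : 'M[F]_r) (M : 'M[F]_n)
    (X : 'M[F]_(r, n)) (Xi : 'M[F]_(n, r)) a :
  X *m Xi = 1%:M -> N *m X = X *m M -> eigenvalue N a -> eigenvalue M a.
Proof.
move=> XXi NX /eigenvalueP[v vN v0]; apply/eigenvalueP; exists (v *m X).
  by rewrite -mulmxA -NX mulmxA vN scalemxAl.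
apply: contraNneq v0 => vX0.
by rewrite -[v]mulmx1 -XXi mulmxA vX0 mul0mx.
Qed.

Lemma eigenvalue_tr (F : fieldType) (n : nat) (M : 'M[F]_n) a :
  eigenvalue M^T a = eigenvalue M a.
Proof.
rewrite !eigenvalue_root_char; congr (root _ _).
rewrite /char_poly -det_tr; congr (\det _); apply/matrixP => i j.
by rewrite !mxE eq_sym.
Qed.

Lemma tr_tensmx (F : comPzRingType) m n p q (A : 'M[F]_(m, n)) (B : 'M[F]_(p, q)) :
  (A *t B)^T = A^T *t B^T.
Proof. by apply/matrixP => i j; rewrite !mxE. Qed.

Lemma tensmx11 (F : comPzRingType) m n : (1%:M : 'M[F]_m) *t (1%:M : 'M[F]_n) = 1%:M.
Proof.
apply/matrixP => i j.
case: (mxtens_indexP i)=> i0 i1; case: (mxtens_indexP j)=> j0 j1.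
rewrite tensmxE !mxE (can_eq (@mxtens_indexK _ _)) xpair_eqE.
by case: eqP => _; case: eqP => _; rewrite ?mulr0 ?mul0r ?mulr1.
Qed.

(** Vectorization under which right multiplication by [A^T *t A^T] becomes [E |-> A *m E *m A^T]; a
    row vector fits the left-eigenvector convention of [eigenvalue]. *)
Definition vec_row (F : Type) (n : nat) (E : 'M[F]_n) : 'rV[F]_(n * n) :=
  \row_k E (mxtens_unindex k).1 (mxtens_unindex k).2.

Lemma vec_row_tensmx (F : comPzRingType) (n : nat) (A E : 'M[F]_n) :
  vec_row E *m (A^T *t A^T) = vec_row (A *m E *m A^T).
Proof.
apply/matrixP => i j; case: (mxtens_indexP j)=> k l.
rewrite [RHS]mxE mxtens_indexK /= [RHS]mxE.
transitivity (\sum_b \sum_a A k a * E a b * A l b); last first.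
  by apply: eq_bigr => b _; rewrite !mxE big_distrl.
rewrite exchange_big /= pair_big /= mxE.
rewrite (reindex (@mxtens_index n n)) /=; last first.
  by exists (@mxtens_unindex n n) => x _; rewrite ?mxtens_indexK ?mxtens_unindexK.
apply: eq_bigr => -[a b] _; rewrite tensmxE !mxE mxtens_indexK /=.
by rewrite mulrA [E a b * _]mulrC.
Qed.

Context {R : realType} {S : finType}.

Definition kron_sum (p : S -> R) {n : nat} (A : S -> 'M[R]_n) : 'M[R]_(n * n) :=
  \sum_(s : S) p s *: ((A s)^T *t (A s)^T).

Definition stableA (p : S -> R) {n : nat} (A : S -> 'M[R]_n) : Prop :=
  forall lam : R[i],
    eigenvalue (map_mx (fun a => (a%:C)%C) (kron_sum p A)) lam -> `|lam| < 1.

Lemma stableA_fixpoint (p : S -> R) {n : nat} (A : S -> 'M[R]_n) (E : 'M[R]_n) :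
  stableA p A -> E = \sum_s p s *: (A s *m E *m (A s)^T) -> E = 0.
Proof.
move=> st hE; apply/eqP; apply/negP => /negP E0.
have /st : eigenvalue (map_mx (fun a => (a%:C)%C) (kron_sum p A)) (1%:C)%C.
  rewrite (eigenvalue_map (real_complex R)); apply/eigenvalueP.
  exists (vec_row E).
    rewrite scale1r mulmx_sumr [in RHS]hE.
    under eq_bigr => s _ do rewrite -scalemxAr vec_row_tensmx.
    apply/matrixP => i j; rewrite !mxE !summxE.
    by apply: eq_bigr => s _; rewrite [in RHS]mxE !mxE.
  apply: contra_neq E0 => h; apply/matrixP => i j.
  have /matrixP/(_ 0 (mxtens_index (i, j))) := h.
  by rewrite !mxE mxtens_indexK.
by rewrite normr1 ltxx.
Qed.

(** On the invariant subspace spanned by the columns of [J], the matrix [J^T *t J^T] intertwines the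
    two Kronecker sums, so eigenvalues of the restriction are eigenvalues of the whole. *)
Lemma stableA_restr (p : S -> R) {n r : nat} (A : S -> 'M[R]_n) (A' : S -> 'M[R]_r)
    (J : 'M[R]_(n, r)) (Ji : 'M[R]_(r, n)) :
  Ji *m J = 1%:M -> (forall s, A s *m J = J *m A' s) -> stableA p A -> stableA p A'.
Proof.
move=> JiJ AJ st lam; move=> h; apply: st.
pose f := real_complex R.
apply: (@eigenvalue_intertwine _ _ _ _ _ (map_mx f (J^T *t J^T)) (map_mx f (Ji^T *t Ji^T))) h.
  by rewrite -map_mxM tensmx_mul -!trmx_mul JiJ trmx1 tensmx11 map_mx1.
rewrite -!map_mxM; congr map_mx.
rewrite mulmx_suml mulmx_sumr; apply: eq_bigr => s _.
by rewrite -scalemxAr -scalemxAl !tensmx_mul -!trmx_mul AJ.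
Qed.

(** For a quotient the intertwining relation stands on the other side, hence the passage to
    transposes, which have the same eigenvalues. *)
Lemma stableA_quot (p : S -> R) {n r : nat} (A : S -> 'M[R]_n) (A' : S -> 'M[R]_r)
    (E : 'M[R]_(r, n)) (Ei : 'M[R]_(n, r)) :
  E *m Ei = 1%:M -> (forall s, E *m A s = A' s *m E) -> stableA p A -> stableA p A'.
Proof.
move=> EEi EA st lam; rewrite -eigenvalue_tr => h; apply: st; rewrite -eigenvalue_tr.
pose f := real_complex R.
apply: (@eigenvalue_intertwine _ _ _ _ _ (map_mx f (E *t E)) (map_mx f (Ei *t Ei))) h.
  by rewrite -map_mxM tensmx_mul EEi tensmx11 map_mx1.
have trE (k : nat) (M : 'M[R]_k) : (map_mx f M)^T = map_mx f M^T by apply/matrixP => i j; rewrite !mxE.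
rewrite !trE -!map_mxM; congr map_mx.
rewrite /kron_sum ![(\sum_s _)^T]linear_sum /= mulmx_suml mulmx_sumr; apply: eq_bigr => s _.
by rewrite !linearZ /= -?scalemxAr -?scalemxAl !tr_tensmx !trmxK !tensmx_mul EA.
Qed.
End Kronecker.

(** * Square-integrable random variables *)

Section SquareIntegrable.
Import HBNNSimple.
Context {R : realType} {d : measure_display} {Omega : measurableType d}.
Variable P : probability Omega R.
Implicit Types f g h : Omega -> R.

Definition aeq f g : Prop := {ae P, forall om, f om = g om}.

Definition ip f g : R := Ex P (fun om => f om * g om).

Lemma ExE f : Ex P f = Rintegral P setT f.
Proof. by []. Qed.

Lemma sq_int0 : sq_int P (0 : Omega -> R).
Proof.
split; first exact: measurable_cst.
apply: eq_integrable (integrable0 _ _) => //.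
by move=> om _ /=; rewrite expr0n.
Qed.

Lemma integrable_le (f g : Omega -> R) : measurable_fun setT f ->
  (forall om, `|f om| <= g om) -> P.-integrable setT (EFin \o g) ->
  P.-integrable setT (EFin \o f).
Proof.
move=> mf fg; apply: le_integrable => //; first exact/measurable_EFinP.
by move=> om _ /=; rewrite lee_fin (le_trans (fg om)) // ler_norm.
Qed.

Lemma sq_int_mul f g : sq_int P f -> sq_int P g ->
  P.-integrable setT (EFin \o (fun om => f om * g om)).
Proof.
move=> [mf If] [mg Ig].
apply: (@integrable_le _ (fun om => f om ^+ 2 + g om ^+ 2)).
- exact: measurable_funM.
- move=> om; rewrite normrM -(real_normK (num_real (f om))) -(real_normK (num_real (g om))).
  have := sqr_ge0 (`|f om| - `|g om|).
  have := normr_ge0 (f om); have := normr_ge0 (g om).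
  move: `|f om| `|g om| => a b; nra.
- by apply: eq_integrable (integrableD _ If Ig) => // om _.
Qed.

Lemma sq_intD f g : sq_int P f -> sq_int P g -> sq_int P (f + g).
Proof.
move=> hf hg; split; first by apply: measurable_funD; [exact: hf.1|exact: hg.1].
have If : P.-integrable setT (fun om => 2%:E * (f om ^+ 2)%:E)%E.
  exact: integrableZl hf.2.
have Ig : P.-integrable setT (fun om => 2%:E * (g om ^+ 2)%:E)%E.
  exact: integrableZl hg.2.
apply: (@integrable_le _ (fun om => 2 * f om ^+ 2 + 2 * g om ^+ 2)).
- apply: measurable_funX; apply: measurable_funD; [exact: hf.1|exact: hg.1].
- move=> om; rewrite ger0_norm ?sqr_ge0 //.
  have := sqr_ge0 (f om - g om).
  change ((f + g) om) with (f om + g om); move: (f om) (g om) => a b; nra.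
- by apply: eq_integrable (integrableD _ If Ig) => // om _.
Qed.

Lemma sq_intZ a f : sq_int P f -> sq_int P (a *: f).
Proof.
move=> hf; split; first by apply: measurable_funM; [exact: measurable_cst|exact: hf.1].
have If : P.-integrable setT (fun om => (a ^+ 2)%:E * (f om ^+ 2)%:E)%E.
  exact: integrableZl hf.2.
by apply: eq_integrable If => // om _; rewrite -EFinM -exprMn.
Qed.

Lemma sq_intN f : sq_int P f -> sq_int P (- f).
Proof. by rewrite -scaleN1r; exact: sq_intZ. Qed.

Lemma sq_intB f g : sq_int P f -> sq_int P g -> sq_int P (f - g).
Proof. by move=> hf hg; apply: sq_intD => //; exact: sq_intN. Qed.

Lemma sq_int_sum (I : Type) (r : seq I) (p : pred I) (F : I -> Omega -> R) :
  (forall i, sq_int P (F i)) -> sq_int P (\sum_(i <- r | p i) F i).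
Proof.
move=> hF; elim/big_ind : _ => //; [exact: sq_int0 | exact: sq_intD].
Qed.

Lemma ipC f g : ip f g = ip g f.
Proof. by congr (Ex P _); apply/funext => om; rewrite mulrC. Qed.

Lemma ip_subC f g : ip (f - g) (f - g) = ip (g - f) (g - f).
Proof.
rewrite -[f - g]opprB; congr (Ex P _); apply/funext => om.
by rewrite -[RHS]mulrNN.
Qed.

Lemma ipDl f g h : sq_int P f -> sq_int P g -> sq_int P h ->
  ip (f + g) h = ip f h + ip g h.
Proof.
move=> hf hg hh; rewrite /ip !ExE -RintegralD //; last 2 first.
- exact: sq_int_mul.
- exact: sq_int_mul.
by apply: eq_Rintegral => om _; rewrite -mulrDl.
Qed.

Lemma ipZl a f h : sq_int P f -> sq_int P h -> ip (a *: f) h = a * ip f h.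
Proof.
move=> hf hh; rewrite /ip !ExE -RintegralZl //; last exact: sq_int_mul.
by apply: eq_Rintegral => om _; rewrite mulrA.
Qed.

Lemma ipDr f g h : sq_int P f -> sq_int P g -> sq_int P h ->
  ip h (f + g) = ip h f + ip h g.
Proof. by move=> hf hg hh; rewrite ![ip h _]ipC ipDl. Qed.

Lemma ipZr a f h : sq_int P f -> sq_int P h -> ip h (a *: f) = a * ip h f.
Proof. by move=> hf hh; rewrite ![ip h _]ipC ipZl. Qed.

Lemma ipNl f h : sq_int P f -> sq_int P h -> ip (- f) h = - ip f h.
Proof. by move=> hf hh; rewrite -scaleN1r ipZl // mulN1r. Qed.

Lemma ipBl f g h : sq_int P f -> sq_int P g -> sq_int P h ->
  ip (f - g) h = ip f h - ip g h.
Proof. by move=> hf hg hh; rewrite ipDl ?ipNl //; exact: sq_intN. Qed.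

Lemma ipBr f g h : sq_int P f -> sq_int P g -> sq_int P h ->
  ip h (f - g) = ip h f - ip h g.
Proof. by move=> hf hg hh; rewrite ![ip h _]ipC ipBl. Qed.

Lemma ip0l h : ip 0 h = 0.
Proof.
by rewrite /ip /Ex integral0_eq // => om _; rewrite mul0r.
Qed.

Lemma ip_suml (I : Type) (r : seq I) (p : pred I) (F : I -> Omega -> R) h :
  (forall i, sq_int P (F i)) -> sq_int P h ->
  ip (\sum_(i <- r | p i) F i) h = \sum_(i <- r | p i) ip (F i) h.
Proof.
move=> hF hh; elim: r => [|i r IH]; first by rewrite !big_nil ip0l.
rewrite !big_cons; case: (p i) => //.
by rewrite ipDl ?IH //; exact: sq_int_sum.
Qed.

Lemma ip_sumr (I : Type) (r : seq I) (p : pred I) (F : I -> Omega -> R) h :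
  (forall i, sq_int P (F i)) -> sq_int P h ->
  ip h (\sum_(i <- r | p i) F i) = \sum_(i <- r | p i) ip h (F i).
Proof.
by move=> hF hh; rewrite ipC ip_suml //; apply: eq_bigr => i _; rewrite ipC.
Qed.

Lemma ip_ge0 f : 0 <= ip f f.
Proof. by rewrite /ip ExE; apply: Rintegral_ge0 => om _; rewrite -expr2 sqr_ge0. Qed.

Lemma ip_integral f : sq_int P f -> (\int[P]_om ((f om ^+ 2)%:E) = (ip f f)%:E)%E.
Proof.
move=> [mf If]; rewrite /ip /Ex fineK; first by apply: eq_integral => om _; rewrite expr2.
under eq_integral do rewrite -expr2.
exact: integrable_fin_num.
Qed.

Lemma cauchy_schwarz_ip f g : sq_int P f -> sq_int P g ->
  ip f g ^+ 2 <= ip f f * ip g g.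
Proof.
move=> hf hg.
have key a : 0 <= ip f f + 2 * a * ip f g + a ^+ 2 * ip g g.
  have := ip_ge0 (f + a *: g).
  rewrite ipDl ?ipDr ?ipZl ?ipZr ?[ip g f]ipC //; try exact: sq_intZ.
    lra.
  by apply: sq_intD => //; exact: sq_intZ.
have [g0|g0] := eqVneq (ip g g) 0.
  rewrite g0 mulr0.
  have [->|fg0] := eqVneq (ip f g) 0; first by rewrite expr0n.
  (* With [ip g g = 0] the quadratic of [key] is affine in [a]; this [a] gives it the value -1. *)
  have := key (- (ip f f + 1) / (2 * ip f g)).
  rewrite g0 mulr0 addr0.
  have -> : 2 * (- (ip f f + 1) / (2 * ip f g)) * ip f g = - (ip f f + 1) by field.
  lra.
have gp : 0 < ip g g by rewrite lt_neqAle eq_sym g0 ip_ge0.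
(* The minimizer of the quadratic of [key]. *)
have := key (- ip f g / ip g g).
have -> : ip f f + 2 * (- ip f g / ip g g) * ip f g + (- ip f g / ip g g) ^+ 2 * ip g g
  = (ip f f * ip g g - ip f g ^+ 2) / ip g g by field.
by rewrite pmulr_lge0 ?invr_gt0 // subr_ge0.
Qed.

Lemma ip_eq0 f : sq_int P f -> ip f f = 0 -> aeq f 0.
Proof.
move=> hf f0; have := ip_integral hf; rewrite f0 => h.
have mf2 : measurable_fun setT (fun om => (f om ^+ 2)%:E).
  by apply/measurable_EFinP; apply: measurable_funX; exact: hf.1.
have [+ _] := ae_eq_integral_abs P measurableT mf2.
under eq_integral do rewrite gee0_abs ?lee_fin ?sqr_ge0 //.
move=> /(_ h); apply: filterS => om /(_ I) /= [/eqP].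
by rewrite sqrf_eq0 => /eqP.
Qed.

Lemma aeq_refl f : aeq f f.
Proof. exact: aeW. Qed.

Lemma aeqB f f' g g' : aeq f f' -> aeq g g' -> aeq (f - g) (f' - g').
Proof. by apply: filterS2 => om e1 e2; rewrite /GRing.add /GRing.opp /= e1 e2. Qed.

Lemma ip_sub_eq0 f g : sq_int P f -> sq_int P g -> ip (f - g) (f - g) = 0 -> aeq f g.
Proof.
move=> hf hg h; have := ip_eq0 (sq_intB hf hg) h.
by apply: filterS => om /eqP; rewrite subr_eq0 => /eqP.
Qed.

(* Only [g] is assumed measurable: the output process of a realization is
   constrained almost everywhere, so it may fail to be measurable. *)
Lemma Ex_aeq f g : measurable_fun setT g -> aeq f g -> Ex P f = Ex P g.
Proof.
move=> mg fg; rewrite /Ex; congr fine.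
have [N [mN N0 sN]] := fg.
(* [f1] may fail to be measurable, so its integral is handled as the supremum over simple functions
   below it. For the reverse inequality [g1] is replaced by 0 on the null set [N], where a simple
   function below it is then below [f1]. *)
have main (f1 g1 : Omega -> \bar R) : (forall om, 0 <= f1 om)%E -> (forall om, 0 <= g1 om)%E ->
    measurable_fun setT g1 -> (forall om, ~ N om -> f1 om = g1 om) ->
    (\int[P]_om f1 om = \int[P]_om g1 om)%E.
  move=> f0 g0 mg1 fg1; apply/eqP; rewrite eq_le; apply/andP; split.
    rewrite [leLHS]ge0_integralTE //; apply: ub_ereal_sup => _ [h hf <-].
    rewrite -integralT_nnsfun; apply: ae_ge0_le_integral => //.
    - by move=> om _; rewrite lee_fin; exact: fun_ge0.
    - exact/measurable_EFinP.
    - exists N; split => // om; apply: contra_notP => nN _.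
      by rewrite -fg1.
  have mgN : measurable_fun setT (g1 \_ (~` N)).
    by apply/(measurable_restrictT _ (measurableC mN)); exact: measurable_funS mg1.
  rewrite (@ge0_ae_eq_integral _ _ _ P setT g1 (g1 \_ (~` N))) //; first last.
  - exists N; split => // om; apply: contra_notP => nN _.
    by rewrite patchE mem_set.
  - by move=> om _; rewrite patchE; case: ifP.
  rewrite [leLHS]ge0_integralTE; last by move=> om; rewrite patchE; case: ifP.
  rewrite [leRHS]ge0_integralTE //.
  apply: ub_ereal_sup => _ [h hf <-]; apply: ereal_sup_ubound; exists h => // om.
  apply: (le_trans (hf om)); rewrite patchE; case: ifP => // /set_mem nN.
  by rewrite fg1.
have fgN om : ~ N om -> f om = g om by apply: contra_notP => h; apply: sN.
rewrite [LHS]integralE [RHS]integralE; congr (_ - _)%E; apply: main => //.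
- by apply: measurable_funepos; exact/measurable_EFinP.
- by move=> om nN; rewrite !funeposE fgN.
- by apply: measurable_funeneg; exact/measurable_EFinP.
- by move=> om nN; rewrite !funenegE fgN.
Qed.

Lemma ip_aeq f f' g g' : measurable_fun setT f' -> measurable_fun setT g' ->
  aeq f f' -> aeq g g' -> ip f g = ip f' g'.
Proof.
move=> mf mg ff gg; apply: Ex_aeq; first exact: measurable_funM.
by move: ff gg; apply: filterS2 => om -> ->.
Qed.

Lemma ip_aeql f f' g : sq_int P f' -> sq_int P g -> aeq f f' -> ip f g = ip f' g.
Proof. by move=> hf hg ff; apply: ip_aeq => //; [exact: hf.1|exact: hg.1|exact: aeq_refl]. Qed.

Lemma ip_aeqr f g g' : sq_int P f -> sq_int P g' -> aeq g g' -> ip f g = ip f g'.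
Proof. by move=> hf hg ff; rewrite ![ip f _]ipC; apply: ip_aeql. Qed.

Lemma ipD_le f g : sq_int P f -> sq_int P g ->
  ip (f + g) (f + g) <= 2 * ip f f + 2 * ip g g.
Proof.
move=> hf hg; have := ip_ge0 (f - g).
have hD := sq_intD hf hg; have hB := sq_intB hf hg.
rewrite ipBl ?ipBr // ipDl ?ipDr // ?[ip g f]ipC //; lra.
Qed.

Lemma ipB_le f g h : sq_int P f -> sq_int P g -> sq_int P h ->
  ip (f - h) (f - h) <= 2 * ip (f - g) (f - g) + 2 * ip (g - h) (g - h).
Proof.
move=> hf hg hh; have -> : f - h = (f - g) + (g - h) by rewrite addrA subrK.
by apply: ipD_le; exact: sq_intB.
Qed.

Lemma small_sqr_eq0 (a K : R) : (forall eps, 0 < eps -> a ^+ 2 <= K * eps) -> a = 0.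
Proof.
move=> h; apply/eqP; rewrite -sqrf_eq0; apply/negPn/negP => a0.
have ap : 0 < a ^+ 2 by rewrite lt_neqAle eq_sym a0 sqr_ge0.
have K1 : 0 < `|K| + 1 by rewrite ltr_wpDl.
have := h (a ^+ 2 / (2 * (`|K| + 1))) (divr_gt0 ap (mulr_gt0 (ltr0n _ 2) K1)).
rewrite mulrA ler_pdivlMr ?mulr_gt0 //.
have := ler_norm K; nra.
Qed.

Lemma half_pow_small (eps : R) : 0 < eps -> exists N, (2^-1 ^+ N : R) ^+ 2 < eps.
Proof.
move=> e0.
have [N hN] : exists N, eps^-1 < N%:R by exists (Num.bound eps^-1); rewrite archi_boundP // invr_ge0 ltW.
exists N; have N0 : (0 < N%:R :> R) by apply: lt_trans hN; rewrite invr_gt0.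
apply: (@le_lt_trans _ _ (N%:R^-1)); last by rewrite invf_plt ?posrE.
have h : (N%:R : R) <= 2 ^+ N by rewrite -natrX ler_nat ltnW // ltn_expl.
have h1 : (1 : R) <= 2 ^+ N by rewrite exprn_ege1 // ler1n.
rewrite exprVn; set a := (2 ^+ N : R) in h h1 *.
have a0 : 0 < a by apply: lt_le_trans h1.
have h2 : a^-1 <= N%:R^-1 by rewrite lef_pV2 ?posrE.
have h3 : a^-1 <= 1 by rewrite invf_le1.
have h4 : 0 <= a^-1 by rewrite invr_ge0 ltW.
nra.
Qed.

Lemma ip_parallelogram f g : sq_int P f -> sq_int P g ->
  ip (f + g) (f + g) + ip (f - g) (f - g) = 2 * ip f f + 2 * ip g g.
Proof.
move=> hf hg; have hD := sq_intD hf hg; have hB := sq_intB hf hg.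
rewrite ipBl ?ipBr // ipDl ?ipDr //; ring.
Qed.

Lemma ip_subZ (a : R) f g : sq_int P f -> sq_int P g ->
  ip (f - a *: g) (f - a *: g) = ip f f - 2 * (a * ip f g) + a * (a * ip g g).
Proof.
move=> hf hg; have hZ := sq_intZ a hg; have hB := sq_intB hf hZ.
rewrite ipBl ?ipBr // !ipZr // !ipZl // [ip g f]ipC; ring.
Qed.

End SquareIntegrable.

(** * Completeness of the space of square-integrable variables *)

Section SquareIntegrableComplete.
Import numFieldTopology.Exports numFieldNormedType.Exports.
Local Open Scope classical_set_scope.
Context {R : realType} {d : measure_display} {Omega : measurableType d}.
Variable P : probability Omega R.

Lemma sq_int_cst (c : R) : sq_int P (fun=> c).
Proof.
split; first exact: measurable_cst.
exact: finite_measure_integrable_cst.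
Qed.

Lemma Ex_cst (c : R) : Ex P (fun=> c) = c.
Proof. by rewrite /Ex integral_cst //= probability_setT mule1. Qed.

Lemma sq_int_integrable (f : Omega -> R) : sq_int P f ->
  P.-integrable setT (EFin \o f).
Proof.
move=> hf; have := sq_int_mul hf (sq_int_cst 1).
by apply: eq_integrable => // om _ /=; rewrite mulr1.
Qed.

(** Cauchy-Schwarz against the constant 1, whose norm is 1 because [P] is a probability. *)
Lemma Ex_norm_le (f : Omega -> R) a : 0 <= a -> sq_int P f -> ip P f f <= a ^+ 2 ->
  (\int[P]_om `|f om|%:E <= a%:E)%E.
Proof.
move=> a0 hf fa.
have hn : sq_int P (fun om => `|f om|).
  split; first by apply: measurableT_comp => //; exact: hf.1.
  by apply: eq_integrable hf.2 => // om _; rewrite real_normK ?num_real.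
have ipn : ip P (fun om => `|f om|) (fun om => `|f om|) = ip P f f.
  by congr Ex; apply/funext => om; rewrite -expr2 real_normK ?num_real.
have := cauchy_schwarz_ip hn (sq_int_cst 1); rewrite ipn.
have -> : ip P (fun=> 1) (fun=> 1) = 1 by rewrite /ip mulr1 Ex_cst.
have -> : ip P (fun om => `|f om|) (fun=> 1) = Ex P (fun om => `|f om|).
  by congr Ex; apply/funext => om; rewrite mulr1.
rewrite mulr1 => h.
have /fineK <- : (\int[P]_om `|f om|%:E)%E \is a fin_num.
  exact: integrable_fin_num (sq_int_integrable hn).
rewrite lee_fin -[fine _]/(Ex P _).
have E0 : 0 <= Ex P (fun om => `|f om|).
  by rewrite ExE; apply: Rintegral_ge0.
by rewrite -(ler_pXn2r (n := 2)) // (le_trans h).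
Qed.

(** Riesz-Fischer at a geometric rate: the increments have summable L1 norms, so the telescoping
    series converges absolutely almost everywhere, and Fatou's lemma carries the rate to the
    limit. *)
Lemma L2_complete (f : nat -> Omega -> R) :
  (forall k, sq_int P (f k)) ->
  (forall i j, (i <= j)%N -> ip P (f i - f j) (f i - f j) <= (2^-1 ^+ i) ^+ 2) ->
  exists2 g, sq_int P g & forall i, ip P (g - f i) (g - f i) <= (2^-1 ^+ i) ^+ 2.
Proof.
move=> hf cf.
pose D n om : R := `|(f n.+1 - f n) om|.
have D0 n om : 0 <= D n om by exact: normr_ge0.
have mD n : measurable_fun setT (EFin \o D n).
  apply/measurable_EFinP/measurableT_comp => //.
  exact: (sq_intB (hf _) (hf _)).1.
have iD n : (\int[P]_om (D n om)%:E <= (2^-1 ^+ n)%:E)%E.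
  apply: Ex_norm_le; [by rewrite exprn_ge0 | exact: sq_intB |].
  by rewrite ip_subC cf.
pose G om : \bar R := (\sum_(0 <= n <oo) (D n om)%:E)%E.
have mG : measurable_fun setT G.
  apply: (@ge0_emeasurable_sum _ _ _ setT (fun n om => (D n om)%:E) predT).
    by move=> n om _ _; rewrite lee_fin.
  by move=> k _; exact: mD.
have IG : (\int[P]_om G om <= 2%:E)%E.
  rewrite integral_nneseries //; last by move=> n om _; rewrite lee_fin.
  apply: lime_le.
    by apply: is_cvg_nneseries => n _ _; apply: integral_ge0 => om _; rewrite lee_fin.
  apply: nearW => n; apply: (@le_trans _ _ (\sum_(0 <= k < n) (2^-1 ^+ k)%:E)%E).
    by apply: lee_sum.
  rewrite sumEFin lee_fin.
  have : \sum_(0 <= k < n) (2^-1 : R) ^+ k = 2 - 2 * 2^-1 ^+ n.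
    elim: n => [|n IH]; first by rewrite big_nil expr0 mulr1 subrr.
    by rewrite big_nat_recr //= IH exprS; field.
  move=> ->; have : 0 <= (2^-1 : R) ^+ n by rewrite exprn_ge0.
  lra.
have G0 om : (0 <= G om)%E by apply: nneseries_ge0 => n _ _; rewrite lee_fin.
have intG : P.-integrable setT G.
  apply/integrableP; split; first exact: mG.
  rewrite (eq_integral G) => [|om _]; first by rewrite (le_lt_trans IG) // ltry.
  by rewrite gee0_abs.
have cv : {ae P, forall om, cvgn (f ^~ om)}.
  have := integrable_ae measurableT intG; apply: filterS => om /(_ I) Gfin.
  have : cvgn (series (telescope (f ^~ om))).
    apply: normed_cvg; apply: nondecreasing_is_cvgn.
      by apply: nondecreasing_series => n _ _; exact: normr_ge0.
    exists (fine (G om)) => _ [n _ <-].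
    rewrite -lee_fin fineK // /series /= -sumEFin.
    by apply: nneseries_lim_ge => k _ _; rewrite lee_fin; exact: D0.
  rewrite telescopeK => h.
  have -> : f ^~ om = (fun n => (f n om - f 0%N om) + f 0%N om).
    by apply/funext => n; rewrite subrK.
  by apply: is_cvgD => //; exact: is_cvg_cst.
(* The upper limit gives a measurable function defined everywhere; it is the limit wherever the
   sequence converges. *)
pose g om := fine (limn_esup (fun k => (f k om)%:E)).
have mg : measurable_fun setT g.
  apply: (measurableT_comp (fine_measurable measurableT)).
  apply: measurable_fun_limn_esup => n; apply/measurable_EFinP; exact: (hf n).1.
have gcv : {ae P, forall om, f k om @[k --> \oo] --> g om}.
  apply: filterS cv => om /cvg_ex[/= l hl].
  have /cvg_limn_einf_sup[_ e] : (f k om)%:E @[k --> \oo] --> l%:E.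
    by apply: cvg_EFin; [exact: nearW | exact: hl].
  by rewrite /g e.
have key i : (\int[P]_om (((g - f i) om) ^+ 2)%:E <= ((2^-1 ^+ i) ^+ 2)%:E)%E.
  pose h k om := (((f k - f i) om) ^+ 2)%:E.
  have mh k : measurable_fun setT (h k).
    by apply/measurable_EFinP; apply: measurable_funX; exact: (sq_intB (hf _) (hf _)).1.
  have h0 k om : setT om -> (0 <= h k om)%E by move=> _; rewrite lee_fin sqr_ge0.
  have := fatou P measurableT mh h0.
  rewrite (@ge0_ae_eq_integral _ _ _ P setT _ (fun om => (((g - f i) om) ^+ 2)%:E)) //; first last.
  - apply: filterS gcv => om hom _.
    have /cvg_limn_einf_sup[-> _] //: h k om @[k --> \oo] --> (((g - f i) om) ^+ 2)%:E.
    apply: cvg_EFin; first by exact: nearW.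
    rewrite exprS expr1; apply: cvgM; apply: cvgB => //; exact: cvg_cst.
  - by move=> om _; rewrite lee_fin sqr_ge0.
  - move=> om _; rewrite limn_einf_lim; apply: lime_ge; first exact: is_cvg_einfs.
    by apply: nearW => n; apply: le_ereal_inf_tmp => _ [m _ <-]; exact: h0.
  - apply/measurable_EFinP; apply: measurable_funX; apply: measurable_funB => //.
    exact: (hf i).1.
  - under eq_fun do rewrite -[limn_einf _]oppeK -limn_esupN.
    apply: measurableT_comp => //; apply: measurable_fun_limn_esup => n.
    exact: measurableT_comp.
  move=> /le_trans; apply.
  rewrite limn_einf_lim; apply: lime_le; first exact: is_cvg_einfs.
  (* The rate bounds [f k - f i] only for [i <= k], hence the index [maxn n i] in the tail starting
     at [n]. *)
  apply: nearW => n; apply: (@le_trans _ _ (\int[P]_om h (maxn n i) om)%E).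
    by apply: ereal_inf_lbound; exists (maxn n i) => //=; exact: leq_maxl.
  rewrite ip_integral; last exact: sq_intB.
  rewrite lee_fin.
  by rewrite ip_subC cf ?leq_maxr.
have hgf i : sq_int P (g - f i).
  split; first by apply: measurable_funB => //; exact: (hf i).1.
  apply/integrableP; split.
    by apply/measurable_EFinP; apply: measurable_funX; apply: measurable_funB => //; exact: (hf i).1.
  under eq_integral do rewrite gee0_abs ?lee_fin ?sqr_ge0 //.
  by rewrite (le_lt_trans (key i)) // ltry.
exists g.
  by rewrite -[g](subrK (f 0%N)); apply: sq_intD.
by move=> i; rewrite -lee_fin -ip_integral.
Qed.
End SquareIntegrableComplete.

(** * Almost-everywhere limits of products *)

Section SquareIntegrableExtra.
Context {R : realType} {d : measure_display} {Omega : measurableType d}.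
Variable P : probability Omega R.
Implicit Types f g h : Omega -> R.

Lemma sq_int_aeq f g : measurable_fun setT f -> aeq P f g -> sq_int P g -> sq_int P f.
Proof.
move=> mf fg [mg Ig]; split => //; apply/integrableP.
have mf2 : measurable_fun setT (fun om => (f om ^+ 2)%:E).
  by apply/measurable_EFinP; exact: measurable_funX.
split => //; have /integrableP[mg2] := Ig; apply: le_lt_trans.
rewrite le_eqVlt; apply/orP; left; apply/eqP.
apply: ge0_ae_eq_integral => //; [exact: measurableT_comp | exact: measurableT_comp |].
by apply: filterS fg => om -> _.
Qed.

Lemma ip_norm f g : ip P (fun om => `|f om|) (fun om => `|g om|)
  = Ex P (fun om => `|f om * g om|).
Proof. by congr Ex; apply/funext => om; rewrite normrM. Qed.

Lemma sq_int_norm f : sq_int P f -> sq_int P (fun om => `|f om|).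
Proof.
move=> hf; split; first by apply: measurableT_comp => //; exact: hf.1.
by apply: eq_integrable hf.2 => // om _; rewrite real_normK ?num_real.
Qed.

Lemma Ex_norm_mul f g : sq_int P f -> sq_int P g ->
  Ex P (fun om => `|f om * g om|) ^+ 2 <= ip P f f * ip P g g.
Proof.
move=> hf hg; rewrite -ip_norm.
apply: le_trans (cauchy_schwarz_ip (sq_int_norm hf) (sq_int_norm hg)) _.
rewrite !ip_norm.
have E h : Ex P (fun om => `|h om * h om|) = ip P h h.
  by congr Ex; apply/funext => om; rewrite ger0_norm // -expr2 sqr_ge0.
by rewrite !E.
Qed.

Lemma Ex_norm_sqr f : sq_int P f -> Ex P (fun om => `|f om|) ^+ 2 <= ip P f f.
Proof.
move=> hf; have := Ex_norm_mul hf (sq_int_cst P 1).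
have -> : ip P (fun=> 1) (fun=> 1) = 1 by rewrite /ip mulr1 Ex_cst.
rewrite mulr1; congr (_ ^+ 2 <= _); congr Ex; apply/funext => om.
by rewrite mulr1.
Qed.

Lemma Ex_norm_eq0 f : P.-integrable setT (EFin \o f) ->
  Ex P (fun om => `|f om|) = 0 -> aeq P f 0.
Proof.
move=> If h.
have mf : measurable_fun setT (EFin \o f) by exact: measurable_int If.
have [+ _] := ae_eq_integral_abs P measurableT mf.
have /fineK <- : (\int[P]_om `|f om|%:E)%E \is a fin_num.
  exact: integrable_fin_num (integrable_norm If).
rewrite -[fine _]/(Ex P _) h => /(_ erefl).
by apply: filterS => om /(_ I) /= [].
Qed.

(* Products of an L2 function with an L2-convergent sequence converge in L1,
   which identifies the L2 limit of the products. *)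
Lemma mul_limit (U f g : Omega -> R) (fk : nat -> Omega -> R) :
  sq_int P U -> sq_int P f -> sq_int P g -> (forall k, sq_int P (fk k)) ->
  (forall k, sq_int P (fun om => U om * fk k om)) ->
  (forall eps, 0 < eps -> exists2 k, ip P (f - fk k) (f - fk k) < eps &
     ip P (g - (fun om => U om * fk k om)) (g - (fun om => U om * fk k om)) < eps) ->
  aeq P (fun om => U om * f om) g.
Proof.
move=> hU hf hg hk hUk H.
pose D om := U om * f om - g om.
have IUf := sq_int_mul hU hf.
have ID : P.-integrable setT (EFin \o D).
  by apply: eq_integrable (integrableB _ IUf (sq_int_integrable hg)).
suff : aeq P D 0.
  by apply: filterS => om /eqP; rewrite subr_eq0 => /eqP.
apply: Ex_norm_eq0 => //.
(* From (b + c)^2 <= 2 b^2 + 2 c^2 with b^2 <= [ip P U U] * eps and c^2 <= eps, where b and c are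
   the L1 norms of the two error terms. *)
apply: (@small_sqr_eq0 _ _ (2 * ip P U U + 2)) => eps e0.
have [k h1 h2] := H _ e0.
have hfk := sq_intB hf (hk k); have hgk := sq_intB hg (hUk k).
have I1 : P.-integrable setT (EFin \o (fun om => `|U om * (f - fk k) om|)).
  exact: integrable_norm (sq_int_mul hU hfk).
have I2 : P.-integrable setT (EFin \o (fun om => `|(g - (fun om => U om * fk k om)) om|)).
  exact: integrable_norm (sq_int_integrable hgk).
have le1 : Ex P (fun om => `|D om|) <= Ex P (fun om => `|U om * (f - fk k) om|)
    + Ex P (fun om => `|(g - (fun om => U om * fk k om)) om|).
  rewrite !ExE -RintegralD //; apply: le_Rintegral => //.
  - exact: integrable_norm ID.
  - by apply: eq_integrable (integrableD _ I1 I2).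
  - move=> om _; rewrite (le_trans _ (ler_normB _ _)) // le_eqVlt; apply/orP; left.
    apply/eqP; congr `|_|; rewrite /D.
    change ((f - fk k) om) with (f om - fk k om).
    change ((g - (fun om => U om * fk k om)) om) with (g om - U om * fk k om).
    ring.
have := Ex_norm_mul hU hfk; have := Ex_norm_sqr hgk.
have : 0 <= Ex P (fun om => `|D om|) by rewrite ExE; apply: Rintegral_ge0.
have := ip_ge0 P U; have := ip_ge0 P (f - fk k).
move: le1 h1 h2.
set a := Ex P _; set b := Ex P _; set c := Ex P _.
set x := ip P (f - _) _; set y := ip P (g - _) _; set w := ip P U U.
move=> abc hx hy x0 w0 a0 cy bx.
have : a ^+ 2 <= (b + c) ^+ 2 by rewrite ler_pXn2r // ?nnegrE // (le_trans a0).
have := sqr_ge0 (b - c); nra.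
Qed.
End SquareIntegrableExtra.

(** * Past of a white noise process *)

Section Shifts.
Context {R : realType} {d : measure_display} {Omega : measurableType d}.
Context {S : finType}.
Variables (p : S -> R) (u : S -> int -> Omega -> R).

(* Turns z_w(t) into z_{ws}(t+1). *)
Definition mulu (s : S) (t : int) (f : Omega -> R) : Omega -> R :=
  fun om => u s t om / Num.sqrt (p s) * f om.

Definition zc {m : nat} (r : int -> Omega -> 'cV[R]_m) (w : seq S) (t : int)
  (i : 'I_m) : Omega -> R := fun om => zw p u r w t om i 0.

Definition comb {m : nat} (r : int -> Omega -> 'cV[R]_m)
    (c : seq (seq S * 'I_m * R)) (t : int) : Omega -> R :=
  \sum_(x <- c) x.2 *: zc r x.1.1 t x.1.2.

Lemma muluD s t f g : mulu s t (f + g) = mulu s t f + mulu s t g.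
Proof. by apply/funext => om; rewrite /mulu mulrDr. Qed.

Lemma muluZ s t a f : mulu s t (a *: f) = a *: mulu s t f.
Proof. by apply/funext => om; rewrite /mulu mulrCA. Qed.

Lemma mulu0 s t : mulu s t 0 = 0.
Proof. by apply/funext => om; rewrite /mulu mulr0. Qed.

Lemma muluB s t f g : mulu s t (f - g) = mulu s t f - mulu s t g.
Proof. by rewrite muluD -scaleN1r muluZ scaleN1r. Qed.

Lemma mulu_sum s t (I : Type) (r : seq I) (q : pred I) (F : I -> Omega -> R) :
  mulu s t (\sum_(i <- r | q i) F i) = \sum_(i <- r | q i) mulu s t (F i).
Proof.
elim: r => [|i r IH]; first by rewrite !big_nil mulu0.
by rewrite !big_cons; case: (q i); rewrite ?muluD IH.
Qed.

Lemma uw_rcons (w : seq S) s t om :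
  uw u (rcons w s) t om = uw u w (t - 1) om * u s t om.
Proof.
rewrite /uw.
have E (w' : seq S) t' : \prod_(i < size w') u (tnth (in_tuple w') i)
    (t' - (size w')%:Z + 1 + (i : nat)%:Z) om =
    \prod_(i < size w') u (nth s w' i) (t' - (size w')%:Z + 1 + (i : nat)%:Z) om.
  by apply: eq_bigr => i _; rewrite (tnth_nth s).
rewrite !E size_rcons big_ord_recr /=; congr (_ * _).
  apply: eq_bigr => i _; rewrite nth_rcons ltn_ord; congr (u _ _ om); lia.
by rewrite nth_rcons ltnn eqxx; congr (u _ _ om); lia.
Qed.

Lemma pw_rcons w s : pw p (rcons w s) = pw p w * p s.
Proof. by rewrite /pw big_rcons. Qed.

Context {m : nat}.
Variable r : int -> Omega -> 'cV[R]_m.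

(** Lets the present value be treated along with the [z_w], although the RC conditions quantify over
    nonempty words. *)
Lemma zw_nil t : zw p u r [::] t = r t.
Proof.
apply/funext => om; rewrite /zw /uw /pw /= big_ord0 big_nil sqrtr1 divr1 scale1r.
by congr (r _ om); rewrite subr0.
Qed.

Hypothesis hp : forall s, 0 < p s.

Lemma pw_gt0 w : 0 < pw p w.
Proof. by apply: prodr_gt0. Qed.

Lemma zw_rcons w s t om :
  zw p u r (rcons w s) (t + 1) om = (u s t om / Num.sqrt (p s)) *: zw p u r w t om.
Proof.
rewrite /zw uw_rcons pw_rcons size_rcons scalerA addrK sqrtrM ?(ltW (pw_gt0 w)) //.
congr (_ *: r _ om); last by lia.
by rewrite invfM mulrACA mulrC.
Qed.

Lemma zc_nil t i : zc r [::] t i = fun om => r t om i 0.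
Proof. by rewrite /zc zw_nil. Qed.

Lemma zc_rcons w s t i : zc r (rcons w s) (t + 1) i = mulu s t (zc r w t i).
Proof. by apply/funext => om; rewrite /zc zw_rcons mxE. Qed.
End Shifts.

(** * Admissible words *)

Section Admissible.
Context {R : realType} {d : measure_display} {Omega : measurableType d}.
Variable P : probability Omega R.
Context {S : finType}.
Variables (p : S -> R) (u : S -> int -> Omega -> R) (L : pred (seq S)).

Lemma EcrossE {a b : nat} (X : Omega -> 'cV[R]_a) (Y : Omega -> 'cV[R]_b) i j :
  Ecross P X Y i j = ip P (fun om => X om i 0) (fun om => Y om j 0).
Proof.
rewrite /Ecross /Emx mxE; congr Ex; apply/funext => om.
by rewrite !mxE big_ord1 mxE.
Qed.

Hypothesis hL : admissible P u L.

Lemma L_letter s : L [:: s]. Proof. exact: hL.1. Qed.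

(** Words of length at least 2 in [L] are the paths of a relation on letters, and every letter is in
    [L]; so appending a letter tests only the last two. *)
Lemma L_rcons2 w s s' : L (rcons (rcons w s) s') = L (rcons w s) && L [:: s; s'].
Proof.
have [_ [_ [Sr hS]]] := hL.
pose chk w := all (fun x : S * S => Sr x.1 x.2) (zip w (behead w)).
have hS' w0 : (1 < size w0)%N -> L w0 = chk w0.
  by move=> h; apply/idP/idP => /(hS _ h).
have chkE w0 a b : chk (rcons (rcons w0 a) b) = chk (rcons w0 a) && Sr a b.
  elim: w0 => [|c w0 IH]; first by rewrite /chk /= andbT.
  case: w0 IH => [|c' w0] IH; first by rewrite /chk /= !andbT.
  move: IH; rewrite /chk /= => ->.
  by rewrite andbA.
rewrite hS' ?size_rcons // chkE (hS' [:: s; s']) // {2}/chk /= andbT.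
case: w => [|c w]; first by rewrite /= L_letter.
by rewrite hS' ?size_rcons.
Qed.

Lemma uw_notin w t : w != [::] -> ~~ L w -> aeq P (uw u w t) 0.
Proof. by move=> w0 Lw; apply: hL.2.1. Qed.

Lemma zc_notin m (r : int -> Omega -> 'cV[R]_m) w t i : w != [::] -> ~~ L w ->
  aeq P (zc p u r w t i) 0.
Proof.
move=> w0 Lw; apply: filterS (uw_notin (t - 1) w0 Lw) => om h.
by rewrite /zc /zw h mul0r scale0r mxE.
Qed.

End Admissible.

(** * Closed linear span of the past of a process *)

Section HilbertSpan.
Context {R : realType} {d : measure_display} {Omega : measurableType d}.
Variable P : probability Omega R.
Context {S : finType}.
Variables (p : S -> R) (u : S -> int -> Omega -> R).
Context {m : nat}.
Variable r : int -> Omega -> 'cV[R]_m.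

Notation z := (zc p u r).
Notation cb := (comb p u r).
Notation inH f t := (in_hilbert P p u f t r).

Definition valid_coefs (c : seq (seq S * 'I_m * R)) : bool :=
  all (fun x => x.1.1 != [::]) c.

Lemma comb_ind (Q : (Omega -> R) -> Prop) c t : valid_coefs c ->
  Q 0 -> (forall a w i f, w != [::] -> Q f -> Q (a *: z w t i + f)) -> Q (cb c t).
Proof.
move=> vc Q0 QS; elim: c vc => [|[[w i] a] c IH] /=; first by rewrite /comb big_nil.
by move=> /andP[w0 /IH]; rewrite /comb big_cons; exact: QS.
Qed.

Lemma comb_cat c1 c2 t : cb (c1 ++ c2) t = cb c1 t + cb c2 t.
Proof. by rewrite /comb big_cat. Qed.

Lemma comb_scale a c t :
  cb [seq (x.1, a * x.2) | x <- c] t = a *: cb c t.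
Proof.
by rewrite /comb big_map scaler_sumr; apply: eq_bigr => x _; rewrite scalerA.
Qed.

Lemma valid_scale a c : valid_coefs c -> valid_coefs [seq (x.1, a * x.2) | x <- c].
Proof. by rewrite /valid_coefs all_map. Qed.

Lemma valid_cat c1 c2 : valid_coefs c1 -> valid_coefs c2 -> valid_coefs (c1 ++ c2).
Proof. by rewrite /valid_coefs all_cat => -> ->. Qed.

Hypothesis hz : forall w t i, w != [::] -> sq_int P (z w t i).

Lemma comb_sq c t : valid_coefs c -> sq_int P (cb c t).
Proof.
move=> vc; apply: comb_ind => //; first exact: sq_int0.
by move=> a w i f w0 hf; apply: sq_intD => //; apply: sq_intZ; exact: hz.
Qed.

Lemma in_hilbertP f t : inH f t <-> sq_int P f /\
  forall eps, 0 < eps -> exists2 c, valid_coefs c & ip P (f - cb c t) (f - cb c t) < eps.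
Proof.
have E c : valid_coefs c -> sq_int P f ->
    (\int[P]_om ((f om - \sum_(x <- c) x.2 * zw p u r x.1.1 t om x.1.2 0) ^+ 2)%:E
     = (ip P (f - cb c t) (f - cb c t))%:E)%E.
  move=> vc hf; rewrite -ip_integral; last by apply: sq_intB => //; exact: comb_sq.
  apply: eq_integral => om _; congr ((_ ^+ 2)%:E).
  transitivity (f om - cb c t om) => //; congr (_ - _).
  by rewrite /comb fct_sumE.
split=> -[hf h]; split => // eps /h.
  by move=> [c [vc]]; rewrite E // lte_fin; exists c.
by move=> [c vc hc]; exists c; rewrite E // lte_fin.
Qed.

Lemma in_hilbert_sq f t : inH f t -> sq_int P f.
Proof. by case. Qed.

Lemma in_hilbert_comb c t : valid_coefs c -> inH (cb c t) t.
Proof.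
move=> vc; apply/in_hilbertP; split; first exact: comb_sq.
by move=> eps e0; exists c; rewrite // subrr ip0l.
Qed.

Lemma in_hilbert0 t : inH 0 t.
Proof.
by have := @in_hilbert_comb [::] t isT; rewrite /comb big_nil.
Qed.

Lemma in_hilbert_zc w t i : w != [::] -> inH (z w t i) t.
Proof.
move=> w0; have := @in_hilbert_comb [:: (w, i, 1)] t.
by rewrite /comb big_seq1 scale1r /valid_coefs /= w0; apply.
Qed.

Lemma in_hilbertD f g t : inH f t -> inH g t -> inH (f + g) t.
Proof.
move=> /in_hilbertP[hf Hf] /in_hilbertP[hg Hg]; apply/in_hilbertP.
split; first exact: sq_intD.
move=> eps e0; have e4 : 0 < eps / 4 by lra.
have [c vc hc] := Hf _ e4; have [c' vc' hc'] := Hg _ e4.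
exists (c ++ c'); first exact: valid_cat.
rewrite comb_cat opprD addrACA.
have hB := sq_intB hf (comb_sq t vc); have hB' := sq_intB hg (comb_sq t vc').
by apply: (le_lt_trans (ipD_le hB hB')); lra.
Qed.

Lemma in_hilbertZ a f t : inH f t -> inH (a *: f) t.
Proof.
move=> /in_hilbertP[hf Hf]; apply/in_hilbertP.
split; first exact: sq_intZ.
move=> eps e0; have e4 : 0 < eps / (a ^+ 2 + 1) by rewrite divr_gt0 // ltr_wpDl ?sqr_ge0.
have [c vc hc] := Hf _ e4.
exists [seq (x.1, a * x.2) | x <- c]; first exact: valid_scale.
have hB := sq_intB hf (comb_sq t vc).
rewrite comb_scale -scalerBr ipZl ?ipZr //; last exact: sq_intZ.
rewrite ltr_pdivlMr ?ltr_wpDl ?sqr_ge0 // in hc.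
have := ip_ge0 P (f - cb c t); have := sqr_ge0 a; nra.
Qed.

Lemma in_hilbertB f g t : inH f t -> inH g t -> inH (f - g) t.
Proof.
by move=> hf hg; apply: in_hilbertD => //; rewrite -scaleN1r; exact: in_hilbertZ.
Qed.

Lemma in_hilbert_sum t (I : Type) (s : seq I) (q : pred I) (F : I -> Omega -> R) :
  (forall i, inH (F i) t) -> inH (\sum_(i <- s | q i) F i) t.
Proof.
by move=> hF; elim/big_ind : _ => //; [exact: in_hilbert0 | move=> *; exact: in_hilbertD].
Qed.

Lemma in_hilbert_close f t : sq_int P f ->
  (forall eps, 0 < eps -> exists2 g, inH g t & ip P (f - g) (f - g) < eps) -> inH f t.
Proof.
move=> hf H; apply/in_hilbertP; split => // eps e0.
have e4 : 0 < eps / 4 by lra.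
have [g hg fg] := H _ e4; have [hg2 /(_ _ e4)[c vc hc]] := (in_hilbertP _ _).1 hg.
exists c => //.
by apply: (le_lt_trans (ipB_le hf hg2 (comb_sq t vc))); lra.
Qed.

Lemma in_hilbert_aeq f g t : sq_int P f -> aeq P f g -> inH g t -> inH f t.
Proof.
move=> hf fg hg; have hg2 := in_hilbert_sq hg; apply: in_hilbert_close => // eps e0.
exists g => //; rewrite (@ip_aeql _ _ _ _ _ 0) ?ip0l //; [exact: sq_int0|exact: sq_intB|].
by rewrite -(subrr g); apply: aeqB => //; exact: aeq_refl.
Qed.

(** Density of the combinations together with boundedness. Linearity and the bound are asked only on
    the closed span, since functionals such as [f |-> ip P (mulu p u s t f) h] are controlled only
    there. *)
Lemma hilbert_functional (l : (Omega -> R) -> R) (K : R) t :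
  (forall a f g, inH f t -> inH g t -> l (a *: f + g) = a * l f + l g) ->
  (forall f, inH f t -> l f ^+ 2 <= K * ip P f f) ->
  (forall w i, w != [::] -> l (z w t i) = 0) ->
  forall f, inH f t -> l f = 0.
Proof.
move=> ladd lbd lz f hf.
have l0 : l 0 = 0.
  have := ladd (-1) 0 0 (in_hilbert0 t) (in_hilbert0 t).
  by rewrite scaler0 addr0 mulN1r addNr.
have lc c : valid_coefs c -> l (cb c t) = 0.
  (* Membership is carried through the induction because linearity of [l] is available only inside
     the span. *)
  move=> vc; suff : inH (cb c t) t /\ l (cb c t) = 0 by case.
  apply: (comb_ind (Q := fun f => inH f t /\ l f = 0)) => //.
    by split => //; exact: in_hilbert0.
  move=> a w i g w0 [Hg lg].
  have Hw := in_hilbert_zc t i w0.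
  split; first by apply: in_hilbertD => //; exact: in_hilbertZ.
  by rewrite ladd // lz // lg mulr0 addr0.
apply: (@small_sqr_eq0 _ _ `|K|) => eps e0.
have [hf2 /(_ _ e0)[c vc hc]] := (in_hilbertP _ _).1 hf.
have Hc := in_hilbert_comb t vc.
have : l (f - cb c t) = l f.
  have -> : f - cb c t = (-1) *: cb c t + f by rewrite scaleN1r addrC.
  by rewrite ladd // lc // mulr0 add0r.
move=> <-; apply: le_trans (lbd _ (in_hilbertB hf Hc)) _.
have := ip_ge0 P (f - cb c t); have := ler_norm K; have := normr_ge0 K; nra.
Qed.

Lemma hilbert_orth h t : sq_int P h ->
  (forall w i, w != [::] -> ip P (z w t i) h = 0) ->
  forall f, inH f t -> ip P f h = 0.
Proof.
move=> hh; apply: (@hilbert_functional _ (ip P h h)).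
  move=> a f g /in_hilbert_sq hf /in_hilbert_sq hg.
  by rewrite ipDl ?ipZl //; exact: sq_intZ.
by move=> f /in_hilbert_sq hf; rewrite [leRHS]mulrC cauchy_schwarz_ip.
Qed.
End HilbertSpan.

(** Conditions (A1) and (A2) bundled with the standing hypotheses on the inputs. *)
Definition white_noise {R : realType} {d : measure_display} {Omega : measurableType d}
    (P : probability Omega R) {S : finType} (p : S -> R) (u : S -> int -> Omega -> R)
    (L : pred (seq S)) {m : nat} (v : int -> Omega -> 'cV[R]_m) : Prop :=
  [/\ forall s, 0 < p s, input_hyp P u, admissible P u L, RC P p u L v &
      forall t w w', w != [::] -> w' != [::] -> w != w' ->
        Ecross P (zw p u v w t) (zw p u v w' t) = 0].

(** * Multiplication by an input on the past of a white noise *)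

Section WhiteNoise.
Context {R : realType} {d : measure_display} {Omega : measurableType d}.
Variable P : probability Omega R.
Context {S : finType}.
Variables (p : S -> R) (u : S -> int -> Omega -> R) (L : pred (seq S)).
Context {m : nat}.
Variable v : int -> Omega -> 'cV[R]_m.
Hypothesis wn : white_noise P p u L v.

Let hp : forall s, 0 < p s. Proof. by case: wn. Qed.
Let hu : input_hyp P u. Proof. by case: wn. Qed.
Let hL : admissible P u L. Proof. by case: wn. Qed.
Let rcv : RC P p u L v. Proof. by case: wn. Qed.
Let wv : forall t w w', w != [::] -> w' != [::] -> w != w' ->
  Ecross P (zw p u v w t) (zw p u v w' t) = 0.
Proof. by case: wn. Qed.

Notation z := (zc p u v).
Notation cb := (comb p u v).
Notation inH f t := (in_hilbert P p u f t v).
Notation mu := (mulu p u).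

Lemma zv_sq_ne w t i : w != [::] -> sq_int P (z w t i).
Proof.
case: rcv => [_ [h2 [_ [h4 _]]]] w0; split.
  have [/(_ i) h _] := h2 t w w0.
  by have /integrableP[/measurable_EFinP] := h.
by apply: eq_integrable (h4 t w w w0 w0 i i) => // om _; rewrite expr2.
Qed.

Lemma noise_measurable t i : measurable_fun setT (z [::] t i).
Proof.
case: rcv => [/(_ t) [/(_ i) h _] _].
by rewrite zc_nil; by have /integrableP[/measurable_EFinP] := h.
Qed.

(** The RC conditions bound the second moments of [z_w] for nonempty [w]. For [v(t)] itself, the
    relation sum_s alpha_s u_s(t) = 1 writes it almost everywhere as sum_s alpha_s sqrt(p_s)
    z_s(t+1). *)
Lemma zv_sq w t i : sq_int P (z w t i).
Proof.
have [->|] := eqVneq w [::]; last exact: zv_sq_ne.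
have [alpha /(_ t) ha] := hu.1.
apply: (@sq_int_aeq _ _ _ _ _ (\sum_(s : S) (alpha s * Num.sqrt (p s)) *: z [:: s] (t + 1) i)).
- exact: noise_measurable.
- apply: filterS ha => om ha.
  rewrite fct_sumE -[LHS]mul1r -ha mulr_suml; apply: eq_bigr => s _.
  rewrite -[[:: s]]/(rcons [::] s) zc_rcons // /mulu.
  have s0 : Num.sqrt (p s) != 0 by rewrite sqrtr_eq0 -ltNge.
  transitivity (alpha s * Num.sqrt (p s) * (u s t om / Num.sqrt (p s) * z [::] t i om)) => //.
  by field.
- by apply: sq_int_sum => s; apply: sq_intZ; exact: zv_sq_ne.
Qed.

Lemma gram_st w t t' i j : w != [::] ->
  ip P (z w t i) (z w t j) = ip P (z w t' i) (z w t' j).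
Proof.
case: rcv => [_ [_ [_ [_ [_ [h6 _]]]]]] w0.
by have /matrixP/(_ i j) := h6 t t' w w w0 w0; rewrite !EcrossE.
Qed.

Lemma gram_ne w w' t i j : w != w' -> ip P (z w t i) (z w' t j) = 0.
Proof.
(* With one word empty the inner product is an entry of Lambda_w. It vanishes by the RC identity
   T_{ws,s} = Lambda_w^T and whiteness, [ws] being longer than [s]; the first letter of the word
   serves as [s]. *)
have V1 w1 i1 j1 : w1 != [::] -> ip P (z [::] t i1) (z w1 t j1) = 0.
  move=> w0; case: rcv => [_ [_ [_ [_ [h5 [_ [_ [_ [_ [_ [h11 _]]]]]]]]]]].
  case: w1 w0 => // s w1 w0.
  have /matrixP/(_ j1 i1) := h11 (s :: w1) s w0.
  rewrite /Tr wv // => [|]; last first.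
    by apply/eqP => /(congr1 size); rewrite size_rcons.
  rewrite [LHS]mxE [RHS]mxE /Lam (h5 0 t) // EcrossE => ->.
  by congr ip; apply/funext => om; rewrite zc_nil.
have [->|w0] := eqVneq w [::]; first by rewrite eq_sym; exact: V1.
have [->|w0' ww] := eqVneq w' [::]; first by rewrite ipC; exact: V1.
by have /matrixP/(_ i j) := wv t w0 w0' ww; rewrite EcrossE mxE.
Qed.

(** For distinct words both sides vanish by whiteness. For equal words this is T_{ws,ws} = T_{w,w}
    when [ws] is in [L], and u_{ws} = 0 otherwise. *)
Lemma gram_mulu s t w w' i j : w != [::] -> w' != [::] ->
  ip P (mu s t (z w t i)) (mu s t (z w' t j)) =
  if L (rcons w s) then ip P (z w t i) (z w' t j) else 0.
Proof.
move=> w0 w0'; rewrite -!zc_rcons //.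
have [<-|ww] := eqVneq w w'; last first.
  rewrite !gram_ne ?if_same //; apply: contraNneq ww => /rcons_inj[->].
  by rewrite eqxx.
case: ifPn => Lw.
  case: rcv => [_ [_ [_ [_ [_ [h6 [_ [_ [h9 _]]]]]]]]].
  have := h9 w w s w0 w0; rewrite Lw => /(_ isT)/matrixP/(_ i j).
  rewrite /Tr !EcrossE => e.
  by rewrite (gram_st _ 0) ?(gram_st t 0) // -size_eq0 size_rcons.
rewrite (@ip_aeql _ _ _ _ _ 0) ?ip0l //; [exact: sq_int0 | exact: zv_sq |].
by apply: (zc_notin _ hL) => //; rewrite -size_eq0 size_rcons.
Qed.

Lemma ip_comb c1 c2 t : ip P (cb c1 t) (cb c2 t) =
  \sum_(x <- c1) \sum_(y <- c2) x.2 * (y.2 * ip P (z x.1.1 t x.1.2) (z y.1.1 t y.1.2)).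
Proof.
have hz (x : seq S * 'I_m * R) : sq_int P (x.2 *: z x.1.1 t x.1.2).
  by apply: sq_intZ; exact: zv_sq.
rewrite /comb ip_suml //; last exact: sq_int_sum.
apply: eq_bigr => x _; rewrite ip_sumr //; apply: eq_bigr => y _.
by rewrite ipZl ?ipZr //; do ?exact: sq_intZ; exact: zv_sq.
Qed.

Lemma mulu_comb s t c :
  mu s t (cb c t) = cb [seq (rcons x.1.1 s, x.1.2, x.2) | x <- c] (t + 1).
Proof.
rewrite /comb mulu_sum big_map; apply: eq_bigr => x _.
by rewrite muluZ zc_rcons.
Qed.

Lemma valid_rcons s c : valid_coefs c ->
  valid_coefs [seq (rcons x.1.1 s, x.1.2, x.2) | x : seq S * 'I_m * R <- c].
Proof.
move=> vc; rewrite /valid_coefs all_map; apply/allP => x _ /=.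
by rewrite -size_eq0 size_rcons.
Qed.

(* Multiplication by u_s annihilates the words w with ws not in L and is
   isometric on the others, which are orthogonal to the former. *)
Lemma mulu_comb_le s t c : valid_coefs c ->
  ip P (mu s t (cb c t)) (mu s t (cb c t)) <= ip P (cb c t) (cb c t).
Proof.
move=> vc; pose c' := [seq x <- c | L (rcons x.1.1 s)].
have vc' : valid_coefs c' by rewrite /valid_coefs all_filter; apply: sub_all vc => x x0; apply/implyP.
have hz := zv_sq_ne.
have hc := comb_sq hz t vc; have hc' := comb_sq hz t vc'.
have E1 : ip P (mu s t (cb c t)) (mu s t (cb c t)) = ip P (cb c' t) (cb c t).
  rewrite mulu_comb !ip_comb big_map big_filter [RHS]big_mkcond.
  rewrite !big_seq; apply: eq_bigr => x /(allP vc) x0.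
  rewrite big_map; case: ifPn => Lx; last first.
    rewrite big_seq big1 // => y /(allP vc) y0 /=.
    by rewrite !zc_rcons // gram_mulu // (negbTE Lx) !mulr0.
  rewrite !big_seq; apply: eq_bigr => y /(allP vc) y0 /=.
  by rewrite !zc_rcons // gram_mulu // Lx.
have E2 : ip P (cb c' t) (cb c t) = ip P (cb c' t) (cb c' t).
  rewrite !ip_comb !big_filter; apply: eq_bigr => x Lx.
  rewrite big_filter [RHS]big_mkcond; apply: eq_bigr => y _.
  case: ifPn => // Ly; rewrite gram_ne ?mulr0 //.
  by apply: contraNneq Ly => <-.
have := ip_ge0 P (cb c t - cb c' t).
rewrite ipBl ?ipBr // ?[ip P (cb c t) (cb c' t)]ipC; do ?exact: sq_intB.
rewrite E1 E2; lra.
Qed.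

Lemma usq s t : sq_int P (fun om => u s t om / Num.sqrt (p s)).
Proof.
have -> : (fun om => u s t om / Num.sqrt (p s)) = (Num.sqrt (p s))^-1 *: uw u [:: s] t.
  apply/funext => om; rewrite -[[:: s]]/(rcons [::] s).
  transitivity ((Num.sqrt (p s))^-1 * uw u (rcons [::] s) t om) => //.
  by rewrite uw_rcons /uw big_ord0 mul1r mulrC.
by apply: sq_intZ; exact: hu.2.
Qed.

Lemma mulu_measurable s t f : measurable_fun setT f -> measurable_fun setT (mu s t f).
Proof. by move=> mf; apply: measurable_funM => //; exact: (usq s t).1. Qed.

Lemma mulu_noise_sq s t i : sq_int P (mu s t (z [::] t i)).
Proof. by rewrite -zc_rcons //; exact: zv_sq. Qed.

(** Combinations approximating [f] have images that are Cauchy by [mulu_comb_le], and [mul_limit]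
    identifies their L2 limit with the pointwise product by u_s. The constant 4 comes from two uses
    of [ipD_le]. *)
Lemma mulu_hilbert_bound s t f : inH f t ->
  sq_int P (mu s t f) /\ ip P (mu s t f) (mu s t f) <= 4 * ip P f f.
Proof.
have hz := zv_sq_ne.
move=> /(in_hilbertP hz)[hf Hf].
(* A quarter of the target rate, since [ipB_le] doubles each of two errors. *)
have pos k : 0 < (2^-1 ^+ k : R) ^+ 2 / 4 by rewrite divr_gt0 // exprn_gt0 // exprn_gt0.
have /choice[c hc] : forall k, exists c, valid_coefs c /\
    ip P (f - cb c t) (f - cb c t) < (2^-1 ^+ k : R) ^+ 2 / 4.
  by move=> k; have [c vc h] := Hf _ (pos k); exists c.
have hck k : sq_int P (cb (c k) t) by exact: comb_sq (hc k).1.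
have hmk k : sq_int P (mu s t (cb (c k) t)).
  by rewrite mulu_comb; apply: comb_sq => //; apply: valid_rcons; exact: (hc k).1.
have [|g hg Hg] := L2_complete hmk.
  move=> i j ij; rewrite -muluB.
  have -> : cb (c i) t - cb (c j) t = cb (c i ++ [seq (x.1, -1 * x.2) | x <- c j]) t.
    by rewrite comb_cat comb_scale scaleN1r.
  apply: le_trans (mulu_comb_le _ _ _) _.
    by apply: valid_cat; [exact: (hc i).1 | apply: valid_scale; exact: (hc j).1].
  rewrite comb_cat comb_scale scaleN1r.
  apply: le_trans (ipB_le (hck i) hf (hck j)) _.
  have h1 := (hc i).2; have h2 := (hc j).2; rewrite ip_subC in h1.
  have : (2^-1 ^+ j : R) ^+ 2 <= (2^-1 ^+ i) ^+ 2.
    rewrite ler_pXn2r ?nnegrE ?exprn_ge0 //.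
    by apply: ler_wiXn2l => //; rewrite ?invr_le1 ?ler1n // ?unitfE.
  lra.
have fg : aeq P (mu s t f) g.
  apply: (@mul_limit _ _ _ _ _ _ _ (fun k => cb (c k) t) (usq s t) hf hg hck hmk) => eps e0.
  have [N hN] := half_pow_small e0; exists N.
    by apply: lt_le_trans (hc N).2 _; have := sqr_ge0 (2^-1 ^+ N : R); lra.
  exact: le_lt_trans (Hg N) hN.
have hmf : sq_int P (mu s t f).
  by apply: sq_int_aeq fg hg; apply: mulu_measurable; exact: hf.1.
split=> //.
rewrite (ip_aeql hg hmf fg) (ip_aeqr hg hg fg).
apply/ler_addgt0Pr => eps e0.
have e4 : 0 < eps / 4 by lra.
have [N hN] := half_pow_small e4.
have h1 := ipD_le (sq_intB hg (hmk N)) (hmk N); rewrite subrK in h1.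
have h2 := mulu_comb_le s t (hc N).1.
have h3 := ipD_le (sq_intB (hck N) hf) hf; rewrite subrK in h3.
have h4 := (hc N).2; rewrite ip_subC in h4.
have h5 := Hg N; lra.
Qed.

Lemma mulu_hilbert s t f : inH f t -> inH (mu s t f) (t + 1).
Proof.
have hz := zv_sq_ne.
move=> hf; have [hm _] := mulu_hilbert_bound s hf.
apply: in_hilbert_close => // eps e0.
have [hf2 Hf] := (in_hilbertP hz _ _).1 hf.
have e4 : 0 < eps / 4 by lra.
have [c vc hc] := Hf _ e4.
exists (mu s t (cb c t)).
  by rewrite mulu_comb; apply: in_hilbert_comb => //; exact: valid_rcons.
rewrite -muluB; have := (mulu_hilbert_bound s (in_hilbertB hz hf (in_hilbert_comb hz t vc))).2.
lra.
Qed.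

Lemma mulu_hilbert_sq s t f : inH f t -> sq_int P (mu s t f).
Proof. by move=> /(mulu_hilbert_bound s)[]. Qed.

Lemma hilbert_op_ext t (T1 T2 : (Omega -> R) -> Omega -> R) (B k : R) h1 h2 :
  (forall a f g, T1 (a *: f + g) = a *: T1 f + T1 g) ->
  (forall a f g, T2 (a *: f + g) = a *: T2 f + T2 g) ->
  (forall f, inH f t -> sq_int P (T1 f) /\ ip P (T1 f) (T1 f) <= B * ip P f f) ->
  (forall f, inH f t -> sq_int P (T2 f) /\ ip P (T2 f) (T2 f) <= B * ip P f f) ->
  sq_int P h1 -> sq_int P h2 ->
  (forall w i, w != [::] -> ip P (T1 (z w t i)) h1 = k * ip P (T2 (z w t i)) h2) ->
  forall f, inH f t -> ip P (T1 f) h1 = k * ip P (T2 f) h2.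
Proof.
move=> lin1 lin2 bd1 bd2 hh1 hh2 H f hf; apply/eqP; rewrite -subr_eq0; apply/eqP.
move: f hf.
(* The bound comes from (a - k b)^2 <= 2 a^2 + 2 k^2 b^2 and Cauchy-Schwarz on each term. *)
apply: (hilbert_functional zv_sq_ne (K := 2 * B * ip P h1 h1 + 2 * k ^+ 2 * B * ip P h2 h2)).
- move=> a f g /[dup] /bd1[f1 _] /bd2[f2 _] /[dup] /bd1[g1 _] /bd2[g2 _].
  rewrite lin1 lin2 !ipDl ?ipZl //; do ?exact: sq_intZ.
  ring.
- move=> f /[dup] /bd1[f1 b1] /bd2[f2 b2].
  have := cauchy_schwarz_ip f1 hh1; have := cauchy_schwarz_ip f2 hh2.
  have := ip_ge0 P h1; have := ip_ge0 P h2.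
  move: b1 b2; set a := ip P (T1 f) h1; set b := ip P (T2 f) h2.
  set F1 := ip P (T1 f) _; set F2 := ip P (T2 f) _.
  set F := ip P f f; set H1 := ip P h1 h1; set H2 := ip P h2 h2.
  move=> b1 b2 H20 H10 cs2 cs1.
  have : F1 * H1 <= B * F * H1 by rewrite ler_wpM2r.
  have : k ^+ 2 * b ^+ 2 <= k ^+ 2 * (B * F * H2).
    by rewrite ler_wpM2l ?sqr_ge0 // (le_trans cs2) // ler_wpM2r.
  have := sqr_ge0 (a + k * b).
  lra.
- by move=> w i w0; rewrite H // subrr.
Qed.

Lemma mulu_lin s t a f g : mu s t (a *: f + g) = a *: mu s t f + mu s t g.
Proof. by rewrite muluD muluZ. Qed.

Lemma hilbert_mulu_orth s t h : sq_int P h ->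
  (forall w i, w != [::] -> ip P (mu s t (z w t i)) h = 0) ->
  forall f, inH f t -> ip P (mu s t f) h = 0.
Proof.
move=> hh H f hf; rewrite -[RHS](mul0r (ip P (mu s t f) h)).
apply: (@hilbert_op_ext t (mu s t) (mu s t) 4) hf => //; try exact: mulu_lin; try exact: mulu_hilbert_bound.
by move=> w i w0; rewrite H // mulr0.
Qed.

(** Words ending in different letters differ, and a word of length at least 2 differs from a single
    letter; whiteness applies in both cases. *)
Lemma mulu_orth_words s s' t f w j : inH f t -> (s != s') || (w == [::]) ->
  ip P (mu s t f) (mu s' t (z w t j)) = 0.
Proof.
move=> hf hw; apply: hilbert_mulu_orth hf; first by rewrite -zc_rcons //; exact: zv_sq.
move=> w1 i w10; rewrite -!zc_rcons // gram_ne //.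
apply/eqP => /rcons_inj[e1 e2]; move: hw; rewrite e2 eqxx -e1 /=.
exact/negP.
Qed.

Lemma mulu_orth s s' t f g : inH f t -> inH g t -> s != s' ->
  ip P (mu s t f) (mu s' t g) = 0.
Proof.
move=> hf hg ss; rewrite ipC; apply: hilbert_mulu_orth hg; first exact: mulu_hilbert_sq.
by move=> w i w0; rewrite ipC mulu_orth_words ?ss.
Qed.

Lemma mulu_noise_orth s s' t i j : s != s' ->
  ip P (mu s t (z [::] t i)) (mu s' t (z [::] t j)) = 0.
Proof.
by move=> ss; rewrite -!zc_rcons // gram_ne //; apply: contraNneq ss => -[->].
Qed.

Lemma noise_orth t f j : inH f t -> ip P f (z [::] t j) = 0.
Proof.
apply: (hilbert_orth zv_sq_ne); first exact: zv_sq.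
by move=> w i w0; rewrite gram_ne.
Qed.

(** On generators, [w s2 s] lies in [L] exactly when [w s2] and [s2 s] do; if [w s2] is not in [L],
    both sides vanish since its input product is zero. This shift identity drives the recursions on
    words below. *)
Lemma mulu2_words s s2 t f w j : inH f (t + 1) ->
  ip P (mu s (t + 1) f) (mu s (t + 1) (mu s2 t (z w t j))) =
  (L [:: s2; s])%:R * ip P f (mu s2 t (z w t j)).
Proof.
move=> hf; rewrite -!zc_rcons //.
apply: (@hilbert_op_ext (t + 1) (mu s (t + 1)) id 4) hf => //; first exact: mulu_lin.
- exact: mulu_hilbert_bound.
- by move=> f1 hf1; split; [exact: in_hilbert_sq hf1 | have := ip_ge0 P f1; lra].
- exact: zv_sq.
- exact: zv_sq.
move=> w1 i w10; rewrite [z (rcons (rcons _ _) _) _ _]zc_rcons // gram_mulu //; last first.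
  by rewrite -size_eq0 size_rcons.
have [->|ne] := eqVneq w1 (rcons w s2); last by rewrite gram_ne // mulr0 if_same.
rewrite (L_rcons2 hL).
case Lw : (L (rcons w s2)) => /=; first by case: ifP; rewrite ?mul1r ?mul0r.
rewrite (@ip_aeql _ _ _ _ _ 0) ?ip0l ?mulr0 //; [exact: sq_int0 | exact: zv_sq |].
by apply: (zc_notin _ hL); rewrite ?Lw // -size_eq0 size_rcons.
Qed.

Lemma mulu2_hilbert s s2 t f g : inH f (t + 1) -> inH g t ->
  ip P (mu s (t + 1) f) (mu s (t + 1) (mu s2 t g)) =
  (L [:: s2; s])%:R * ip P f (mu s2 t g).
Proof.
move=> hf hg; rewrite ipC [ip P f _]ipC.
(* Two multiplications by inputs, each with squared-norm bound 4. *)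
apply: (@hilbert_op_ext t (mu s (t + 1) \o mu s2 t) (mu s2 t) 16) hg.
- by move=> a f1 g1 /=; rewrite !mulu_lin.
- exact: mulu_lin.
- move=> f1 hf1 /=; have [h1 b1] := mulu_hilbert_bound s2 hf1.
  by have [h2 b2] := mulu_hilbert_bound s (mulu_hilbert s2 hf1); split => //; lra.
- move=> f1 hf1; have [h1 b1] := mulu_hilbert_bound s2 hf1; split => //.
  by have := ip_ge0 P f1; lra.
- exact: mulu_hilbert_sq.
- exact: in_hilbert_sq hf.
- by move=> w i w0 /=; rewrite ipC mulu2_words // ipC.
Qed.

(* The coefficients of the approximation are shared by all times, so this is a
   Hilbert space for the inner product at any fixed time. *)
Definition stat_space (X : int -> Omega -> R) : Prop :=
  (forall t, sq_int P (X t)) /\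
  forall eps, 0 < eps -> exists2 c, valid_coefs c &
    forall t, ip P (X t - cb c t) (X t - cb c t) < eps.

Lemma stat_sq X t : stat_space X -> sq_int P (X t).
Proof. by case. Qed.

Lemma stat_hilbert X t : stat_space X -> inH (X t) t.
Proof.
move=> [h H]; apply/(in_hilbertP zv_sq_ne); split => // eps e0.
by have [c vc hc] := H _ e0; exists c.
Qed.

Lemma stat_comb c : valid_coefs c -> stat_space (cb c).
Proof.
move=> vc; split; first by move=> t; exact: (comb_sq zv_sq_ne).
by move=> eps e0; exists c => // t; rewrite subrr ip0l.
Qed.

Lemma stat_space_close X : (forall t, sq_int P (X t)) ->
  (forall eps, 0 < eps -> exists2 Y, stat_space Y &
    forall t, ip P (X t - Y t) (X t - Y t) < eps) -> stat_space X.
Proof.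
move=> hX H; split => // eps e0; have e4 : 0 < eps / 4 by lra.
have [Y [hY HY] XY] := H _ e4; have [c vc hc] := HY _ e4.
exists c => // t.
apply: (le_lt_trans (ipB_le (hX t) (hY t) (comb_sq zv_sq_ne t vc))).
by have := XY t; have := hc t; lra.
Qed.

Lemma stat_lin a X Y : stat_space X -> stat_space Y ->
  stat_space (fun t => a *: X t + Y t).
Proof.
move=> [hX HX] [hY HY]; split; first by move=> t; apply: sq_intD => //; exact: sq_intZ.
move=> eps e0.
have e4 : 0 < eps / 4 by lra.
have e5 : 0 < eps / (4 * (a ^+ 2 + 1)).
  by rewrite divr_gt0 // mulr_gt0 // ltr_wpDl ?sqr_ge0.
have [c vc hc] := HX _ e5; have [c' vc' hc'] := HY _ e4.
exists ([seq (x.1, a * x.2) | x <- c] ++ c').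
  by apply: valid_cat => //; exact: valid_scale.
move=> t; rewrite comb_cat comb_scale opprD addrACA -scalerBr.
have hcX := sq_intB (hX t) (comb_sq zv_sq_ne t vc).
have hcY := sq_intB (hY t) (comb_sq zv_sq_ne t vc').
apply: (le_lt_trans (ipD_le (sq_intZ a hcX) hcY)).
rewrite ipZl ?ipZr //; last exact: sq_intZ.
have := hc t; rewrite ltr_pdivlMr ?mulr_gt0 ?ltr_wpDl ?sqr_ge0 //.
have := hc' t; have := ip_ge0 P (X t - cb c t); have := sqr_ge0 a; nra.
Qed.

Lemma stat0 : stat_space (fun=> 0).
Proof.
have := @stat_comb [::] isT; congr stat_space; apply/funext => t.
by rewrite /comb big_nil.
Qed.

Lemma stat_zc w i : w != [::] -> stat_space (fun t => z w t i).
Proof.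
move=> w0; have := @stat_comb [:: (w, i, 1)]; rewrite /valid_coefs /= w0 => /(_ isT).
by congr stat_space; apply/funext => t; rewrite /comb big_seq1 scale1r.
Qed.

Lemma stat_sum (I : Type) (s : seq I) (q : pred I) (F : I -> int -> Omega -> R) :
  (forall i, stat_space (F i)) -> stat_space (fun t => \sum_(i <- s | q i) F i t).
Proof.
move=> hF; elim: s => [|i s IH].
  by have := stat0; congr stat_space; apply/funext => t; rewrite big_nil.
case qi : (q i); last first.
  by move: IH; congr stat_space; apply/funext => t; rewrite big_cons qi.
have := stat_lin 1 (hF i) IH; congr stat_space; apply/funext => t.
by rewrite big_cons qi scale1r.
Qed.

Lemma stat_mulu s X : stat_space X -> stat_space (fun t => mu s (t - 1) (X (t - 1))).
Proof.
move=> hX; have [hX2 HX] := hX; split.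
  by move=> t; apply: mulu_hilbert_sq; exact: stat_hilbert.
move=> eps e0; have e4 : 0 < eps / 4 by lra.
have [c vc hc] := HX _ e4.
exists [seq (rcons x.1.1 s, x.1.2, x.2) | x <- c]; first exact: valid_rcons.
move=> t; rewrite -[X in cb _ X](subrK 1 t) -mulu_comb -muluB.
have h := in_hilbertB zv_sq_ne (stat_hilbert (t - 1) hX) (in_hilbert_comb zv_sq_ne (t - 1) vc).
by apply: le_lt_trans (mulu_hilbert_bound s h).2 _; have := hc (t - 1); lra.
Qed.

Lemma stat_mulu_noise s i : stat_space (fun t => mu s (t - 1) (z [::] (t - 1) i)).
Proof.
have := @stat_zc [:: s] i isT; congr stat_space; apply/funext => t.
by rewrite -zc_rcons // subrK.
Qed.

Lemma stat_aeq X Y : (forall t, sq_int P (X t)) -> (forall t, aeq P (X t) (Y t)) ->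
  stat_space Y -> stat_space X.
Proof.
move=> hX XY hY; apply: stat_space_close => // eps e0; exists Y => // t.
have hYt := stat_sq t hY.
rewrite (@ip_aeql _ _ _ _ _ 0) ?ip0l //; [exact: sq_int0|exact: sq_intB|].
by rewrite -(subrr (Y t)); apply: aeqB => //; exact: aeq_refl.
Qed.

Lemma ip_comb_st c1 c2 t t' : valid_coefs c1 -> valid_coefs c2 ->
  ip P (cb c1 t) (cb c2 t) = ip P (cb c1 t') (cb c2 t').
Proof.
move=> vc1 vc2; rewrite !ip_comb !big_seq; apply: eq_bigr => x /(allP vc1) x0.
rewrite !big_seq; apply: eq_bigr => y /(allP vc2) y0.
have [e|ne] := eqVneq x.1.1 y.1.1; last by rewrite !gram_ne.
by rewrite e (gram_st t t').
Qed.

(** Both arguments are replaced in turn by time-uniform approximations; for combinations the claim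
    is the stationarity of the Gram matrices of the [z_w]. *)
Lemma stat_ip X Y t t' : stat_space X -> stat_space Y ->
  ip P (X t) (Y t) = ip P (X t') (Y t').
Proof.
have half Z c : stat_space Z -> valid_coefs c ->
    ip P (Z t) (cb c t) = ip P (Z t') (cb c t').
  move=> [hZ HZ] vc; apply/eqP; rewrite -subr_eq0; apply/eqP.
  have hc t0 := comb_sq zv_sq_ne t0 vc.
  apply: (@small_sqr_eq0 _ _ (2 * ip P (cb c t) (cb c t) + 2 * ip P (cb c t') (cb c t'))) => eps e0.
  have [c1 vc1 hc1] := HZ _ e0; have hcc t0 := comb_sq zv_sq_ne t0 vc1.
  have := cauchy_schwarz_ip (sq_intB (hZ t) (hcc t)) (hc t).
  have := cauchy_schwarz_ip (sq_intB (hZ t') (hcc t')) (hc t').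
  rewrite [ip P _ (cb c t)]ipBl // [ip P _ (cb c t')]ipBl // (ip_comb_st t t' vc1 vc).
  have := hc1 t; have := hc1 t'; have := ip_ge0 P (cb c t); have := ip_ge0 P (cb c t').
  set a := ip P (Z t) (cb c t); set a' := ip P (Z t') (cb c t').
  set b := ip P (cb c1 t') _; set n := ip P (cb c t) _; set n' := ip P (cb c t') _.
  set q := ip P _ _; set q' := ip P _ _.
  move=> n'0 n0 hq hq' h1 h2.
  have := sqr_ge0 ((a - b) + (a' - b)); nra.
move=> hX hY; apply/eqP; rewrite -subr_eq0; apply/eqP.
have [hX2 _] := hX; have [hY2 HY] := hY.
apply: (@small_sqr_eq0 _ _ (2 * ip P (X t) (X t) + 2 * ip P (X t') (X t'))) => eps e0.
have [c1 vc1 hc1] := HY _ e0; have hcc t0 := comb_sq zv_sq_ne t0 vc1.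
have := cauchy_schwarz_ip (hX2 t) (sq_intB (hY2 t) (hcc t)).
have := cauchy_schwarz_ip (hX2 t') (sq_intB (hY2 t') (hcc t')).
rewrite [ip P (X t) (_ - _)]ipBr // [ip P (X t') (_ - _)]ipBr // (half _ _ hX vc1).
have := hc1 t; have := hc1 t'; have := ip_ge0 P (X t); have := ip_ge0 P (X t').
set a := ip P (X t) (Y t); set a' := ip P (X t') (Y t').
set b := ip P (X t') (cb _ _); set n := ip P (X t) _; set n' := ip P (X t') _.
set q := ip P _ _; set q' := ip P _ _.
move=> n'0 n0 hq hq' h1 h2.
have := sqr_ge0 ((a - b) + (a' - b)); nra.
Qed.

Lemma stat_lin2 X Y : stat_space X -> stat_space Y -> stat_space (fun t => X t - Y t).
Proof.
move=> hX hY; have := stat_lin (-1) hY hX; congr stat_space; apply/funext => t.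
by rewrite scaleN1r addrC.
Qed.

(** By [stat_ip] the Cauchy bound at time 0 holds at every time, so the limits taken separately at
    each time are approached at one common rate. *)
Lemma stat_complete (X : nat -> int -> Omega -> R) :
  (forall k, stat_space (X k)) ->
  (forall i j, (i <= j)%N -> ip P (X i 0 - X j 0) (X i 0 - X j 0) <= (2^-1 ^+ i) ^+ 2) ->
  exists2 Y, stat_space Y &
    forall t i, ip P (Y t - X i t) (Y t - X i t) <= (2^-1 ^+ i) ^+ 2.
Proof.
move=> hX HX.
have /choice[Y hY] : forall t, exists Y, sq_int P Y /\
    forall i, ip P (Y - X i t) (Y - X i t) <= (2^-1 ^+ i) ^+ 2.
  move=> t; have [||g hg Hg] := @L2_complete _ _ _ P (X ^~ t); last by exists g.
  - by move=> k; exact: stat_sq.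
  - by move=> i j ij; rewrite (stat_ip t 0 (stat_lin2 (hX i) (hX j)) (stat_lin2 (hX i) (hX j))) HX.
exists Y; last by move=> t i; exact: (hY t).2.
apply: stat_space_close; first by move=> t; exact: (hY t).1.
move=> eps e0; have [N hN] := half_pow_small e0.
exists (X N) => // t; exact: le_lt_trans ((hY t).2 N) hN.
Qed.

(* Membership in the past of the noise at every time, together with stationary
   correlations with it, yields approximations uniform in time. *)
Lemma stat_space_of_hilbert (X : int -> Omega -> R) :
  (forall t, inH (X t) t) ->
  (forall t t' w i, w != [::] -> ip P (X t) (z w t i) = ip P (X t') (z w t' i)) ->
  stat_space X.
Proof.
move=> hX HX.
have hX2 t := in_hilbert_sq (hX t).
have pos k : 0 < (2^-1 ^+ k : R) ^+ 2 / 4 by rewrite divr_gt0 // exprn_gt0 // exprn_gt0.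
have /choice[c hc] : forall k, exists c, valid_coefs c /\
    ip P (X 0 - cb c 0) (X 0 - cb c 0) < (2^-1 ^+ k : R) ^+ 2 / 4.
  move=> k; have [_ /(_ _ (pos k))[c vc h]] := (in_hilbertP zv_sq_ne _ _).1 (hX 0).
  by exists c.
have sc k : stat_space (cb (c k)) by exact: stat_comb (hc k).1.
have [|Y sY HY] := stat_complete sc.
  move=> i j ij.
  apply: le_trans (ipB_le (stat_sq 0 (sc i)) (hX2 0) (stat_sq 0 (sc j))) _.
  have h1 := (hc i).2; have h2 := (hc j).2; rewrite ip_subC in h1.
  have : (2^-1 ^+ j : R) ^+ 2 <= (2^-1 ^+ i) ^+ 2.
    rewrite ler_pXn2r ?nnegrE ?exprn_ge0 //.
    by apply: ler_wiXn2l => //; rewrite ?invr_le1 ?ler1n // ?unitfE.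
  lra.
have Y0 : ip P (Y 0 - X 0) (Y 0 - X 0) = 0.
  apply/eqP; rewrite eq_le ip_ge0 andbT; apply/ler_addgt0Pr => eps e0.
  have e4 : 0 < eps / 4 by lra.
  have [N hN] := half_pow_small e4.
  apply: le_trans (ipB_le (stat_sq 0 sY) (stat_sq 0 (sc N)) (hX2 0)) _.
  have := HY 0 N; have := (hc N).2; rewrite ip_subC; have := sqr_ge0 (2^-1 ^+ N : R); lra.
(* [Y] agrees with [X] at time 0. At time [t] both lie in the past and have the correlations with
   the [z_w] that they have at time 0, hence they agree again. *)
apply: (stat_aeq hX2 _ sY) => t.
apply: ip_sub_eq0; [exact: hX2 | exact: stat_sq |].
have hB := sq_intB (hX2 t) (stat_sq t sY).
apply: (hilbert_orth zv_sq_ne (t := t)) => //; last first.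
  by apply: in_hilbertB; [exact: zv_sq_ne | exact: hX | exact: stat_hilbert].
move=> w i w0; rewrite ipC ipBl //; [|exact: stat_sq|exact: zv_sq].
rewrite (HX t 0) // (stat_ip t 0 sY (stat_zc i w0)) -ipBl //; first last.
- exact: zv_sq.
- exact: stat_sq.
have Y0' : aeq P (Y 0) (X 0) by apply: ip_sub_eq0 => //; exact: stat_sq.
rewrite (@ip_aeql _ _ _ _ _ 0) ?ip0l //; [exact: sq_int0 | exact: zv_sq |].
rewrite -(subrr (X 0)); apply: aeqB => //; exact: aeq_refl.
Qed.
End WhiteNoise.

(** * Stationary projection on the past of a process *)

Section StationaryProjection.
Context {R : realType} {d : measure_display} {Omega : measurableType d}.
Variable P : probability Omega R.
Context {S : finType}.
Variables (p : S -> R) (u : S -> int -> Omega -> R) (L : pred (seq S)).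
Context {m : nat}.
Variable v : int -> Omega -> 'cV[R]_m.
Hypothesis wn : white_noise P p u L v.
Context {k : nat}.
Variable r : int -> Omega -> 'cV[R]_k.
Notation SS := (stat_space P p u v).
Hypothesis hr : forall w i, w != [::] -> SS (fun t => zc p u r w t i).

Notation z := (zc p u r).
Notation cb := (comb p u r).

Lemma stat_zr_sq w t i : w != [::] -> sq_int P (z w t i).
Proof. by move=> w0; exact: stat_sq t (hr i w0). Qed.

Lemma stat_combr c : valid_coefs c -> SS (cb c).
Proof.
move=> vc; elim: c vc => [_|[[w i] a] c IH] /=.
  have := stat0 wn; congr stat_space.
  by apply/funext => t; rewrite /comb big_nil.
move=> /andP[w0 /IH hc].
have := stat_lin wn a (hr i w0) hc; congr stat_space.
by apply/funext => t; rewrite [in RHS]/comb big_cons.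
Qed.

(** The distance to the combinations is minimized at time 0 only. A minimizing sequence is Cauchy by
    the parallelogram law, and stationarity of inner products gives convergence and orthogonality at
    all times. *)
Lemma stat_projection X : SS X -> exists Y,
  [/\ SS Y, forall t, in_hilbert P p u (Y t) t r &
      forall t w i, w != [::] -> ip P (X t - Y t) (z w t i) = 0].
Proof.
move=> hX; have hX0 := stat_sq 0 hX.
have hc0 c : valid_coefs c -> sq_int P (cb c 0) by move=> vc; exact: stat_sq 0 (stat_combr vc).
pose D c := ip P (X 0 - cb c 0) (X 0 - cb c 0).
pose E := [set a | exists2 c, valid_coefs c & D c = a]%classic.
have hE : has_inf E.
  split; first by exists (D [::]); exists [::].
  by exists 0 => _ [c _ <-]; exact: ip_ge0.
have infD c : valid_coefs c -> inf E <= D c.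
  by move=> vc; apply: ge_inf; [exact: hE.2 | exists c].
have pos j : 0 < (2^-1 ^+ j : R) ^+ 2 / 4 by rewrite divr_gt0 // exprn_gt0 // exprn_gt0.
have /choice[c hc] : forall j, exists c, valid_coefs c /\ D c < inf E + (2^-1 ^+ j) ^+ 2 / 4.
  by move=> j; have [_ [c vc <-] h] := inf_adherent (pos j) hE; exists c.
have [|i j ij|Y sY HY] := @stat_complete _ _ _ _ _ _ _ _ _ _ wn (fun j => cb (c j)).
- by move=> j; exact: stat_combr (hc j).1.
- set f := cb (c i) 0; set g := cb (c j) 0.
  have hf : sq_int P f by exact: hc0 (hc i).1.
  have hg : sq_int P g by exact: hc0 (hc j).1.
  (* The midpoint of two near-minimizers cannot be closer than the infimum. *)
  pose c' := [seq (x.1, 2^-1 * x.2) | x <- c i ++ c j].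
  have vc' : valid_coefs c'.
    by apply: valid_scale; apply: valid_cat; [exact: (hc i).1 | exact: (hc j).1].
  have cE : X 0 - cb c' 0 = 2^-1 *: ((X 0 - f) + (X 0 - g)).
    rewrite comb_scale comb_cat -/f -/g; apply/funext => om.
    transitivity (X 0 om - 2^-1 * (f om + g om)) => //.
    transitivity (2^-1 * ((X 0 om - f om) + (X 0 om - g om))) => //.
    by field.
  have h0 := infD _ vc'; rewrite /D cE in h0.
  have hXf := sq_intB hX0 hf; have hXg := sq_intB hX0 hg.
  have hs := sq_intD hXf hXg.
  rewrite ipZl ?ipZr // in h0; last exact: sq_intZ.
  have fgE : f - g = (X 0 - g) - (X 0 - f) by rewrite opprB [RHS]addrC addrA subrK.
  have h1 := (hc i).2; have h2 := (hc j).2.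
  rewrite /D -/f in h1; rewrite /D -/g in h2.
  have : (2^-1 ^+ j : R) ^+ 2 <= (2^-1 ^+ i) ^+ 2.
    rewrite ler_pXn2r ?nnegrE ?exprn_ge0 //.
    by apply: ler_wiXn2l => //; rewrite ?invr_le1 ?ler1n // ?unitfE.
  have := ip_parallelogram hXg hXf; rewrite fgE [X 0 - g + _]addrC; lra.
exists Y; split => //.
  move=> t; apply/(in_hilbertP stat_zr_sq); split; first exact: stat_sq t sY.
  move=> eps e0; have [N hN] := half_pow_small e0.
  exists (c N); first exact: (hc N).1.
  exact: le_lt_trans (HY t N) hN.
move=> t w i w0.
have hXY := stat_lin2 wn hX sY.
rewrite (stat_ip wn t 0 hXY (hr i w0)).
set Z := z w 0 i; have hZ : sq_int P Z by exact: stat_zr_sq.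
set n := ip P Z Z; have n0 : 0 <= n by exact: ip_ge0.
apply: (@small_sqr_eq0 _ _ (4 * n + 2)) => eps e0.
have [N hN] := half_pow_small e0.
have hcN := hc0 _ (hc N).1; have hYN := sq_intB (stat_sq 0 sY) hcN.
have heN := sq_intB hX0 hcN.
set b := ip P (X 0 - cb (c N) 0) Z.
have hb : b ^+ 2 <= (n + 1) * ((2^-1 ^+ N) ^+ 2 / 4).
  have n1 : 0 < n + 1 by rewrite ltr_wpDl.
  (* Perturbing a near-minimizer in the direction [Z] bounds [b]; the step is [b / (n + 1)] rather
     than the optimal [b / n] because [n] may be 0. *)
  pose a := b / (n + 1).
  pose c' := [:: (w, i, a)] ++ c N.
  have vc' : valid_coefs c'.
    by apply: valid_cat; [rewrite /valid_coefs /= w0 | exact: (hc N).1].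
  have h0 := infD _ vc'; have h1 := (hc N).2; rewrite /D in h0 h1.
  have cE : X 0 - cb c' 0 = (X 0 - cb (c N) 0) - a *: Z.
    by rewrite comb_cat {1}/comb big_seq1 /= opprD addrCA addrC.
  rewrite cE ip_subZ // -/b -/n in h0.
  have ab : a * (n + 1) = b by rewrite /a divfK // gt_eqF.
  have a2 : 2 * (a * b) - a * (a * n) <= (2^-1 ^+ N) ^+ 2 / 4 by lra.
  have -> : b ^+ 2 = (n + 1) * (a * b) by rewrite expr2 -{1}ab; ring.
  apply: ler_wpM2l; first exact: ltW.
  have : a * (a * n) <= a * b.
    by rewrite -ab; have := sqr_ge0 a; nra.
  lra.
have -> : X 0 - Y 0 = (X 0 - cb (c N) 0) - (Y 0 - cb (c N) 0).
  by rewrite opprB addrA subrK.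
rewrite ipBl // -/b.
have := cauchy_schwarz_ip hYN hZ; rewrite -/n; set e := ip P (Y 0 - _) Z.
have := HY 0 N; set q := ip P (Y 0 - _) _; move=> hq he.
have := sqr_ge0 (b + e); have := ip_ge0 P (Y 0 - cb (c N) 0); rewrite -/q => q0.
have : q * n <= (2^-1 ^+ N) ^+ 2 * n by rewrite ler_wpM2r.
move: hN hb; set eN := (2^-1 ^+ N : R) ^+ 2.
have : eN * n <= eps * n \/ eN > eps by case: (leP eN eps) => h; [left; rewrite ler_wpM2r | right].
move=> [h|h] hN hb; last by lra.
nra.
Qed.
End StationaryProjection.

(** * Vector processes and state equations *)

Section VectorProcesses.
Context {R : realType} {d : measure_display} {Omega : measurableType d}.
Variable P : probability Omega R.

Definition vaeq {n : nat} (X Y : Omega -> 'cV[R]_n) : Prop :=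
  {ae P, forall om, X om = Y om}.

Definition vsq {n : nat} (X : Omega -> 'cV[R]_n) : Prop :=
  forall i, sq_int P (fun om => X om i 0).

Definition lmx {a b : nat} (A : 'M[R]_(a, b)) (X : Omega -> 'cV[R]_b) :
  Omega -> 'cV[R]_a := fun om => A *m X om.

Lemma lmxD {a b : nat} (A : 'M[R]_(a, b)) X Y : lmx A (X + Y) = lmx A X + lmx A Y.
Proof. by apply/funext => om; rewrite /lmx mulmxDr. Qed.

Lemma lmxN {a b : nat} (A : 'M[R]_(a, b)) X : lmx A (- X) = - lmx A X.
Proof. by apply/funext => om; rewrite /lmx mulmxN. Qed.

Lemma lmxB {a b : nat} (A : 'M[R]_(a, b)) X Y : lmx A (X - Y) = lmx A X - lmx A Y.
Proof. by rewrite lmxD lmxN. Qed.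

Lemma lmxA {a b c : nat} (A : 'M[R]_(a, b)) (B : 'M[R]_(b, c)) X :
  lmx A (lmx B X) = lmx (A *m B) X.
Proof. by apply/funext => om; rewrite /lmx mulmxA. Qed.

Lemma lmx1 {a : nat} (X : Omega -> 'cV[R]_a) : lmx 1%:M X = X.
Proof. by apply/funext => om; rewrite /lmx mul1mx. Qed.

Lemma lmx0 {a b : nat} (X : Omega -> 'cV[R]_b) : lmx (0 : 'M[R]_(a, b)) X = 0.
Proof. by apply/funext => om; rewrite /lmx mul0mx. Qed.

Lemma lmxZ {a b : nat} (A : 'M[R]_(a, b)) c X : lmx A (c *: X) = c *: lmx A X.
Proof. by apply/funext => om; rewrite /lmx -scalemxAr. Qed.

Section Component.
Context {n : nat}.
Implicit Types X Y : Omega -> 'cV[R]_n.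
Notation "X .[: i ]" := (fun om => X om i 0) (at level 2, format "X .[: i ]").

Lemma compD X Y i : (X + Y).[: i] = X.[: i] + Y.[: i].
Proof. by apply/funext => om; rewrite mxE. Qed.

Lemma compN X i : (- X).[: i] = - (X.[: i]).
Proof. by apply/funext => om; rewrite mxE. Qed.

Lemma compZ a X i : (a *: X).[: i] = a *: (X.[: i]).
Proof. by apply/funext => om; rewrite mxE. Qed.

Lemma comp_sum (I : Type) (r : seq I) (q : pred I) (F : I -> Omega -> 'cV[R]_n) i :
  (\sum_(j <- r | q j) F j).[: i] = \sum_(j <- r | q j) ((F j).[: i]).
Proof. by apply/funext => om; rewrite !fct_sumE summxE. Qed.

Lemma comp_lmx {b : nat} (A : 'M[R]_(n, b)) (X : Omega -> 'cV[R]_b) i :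
  (lmx A X).[: i] = \sum_(j < b) A i j *: (fun om => X om j 0).
Proof. by apply/funext => om; rewrite /lmx mxE fct_sumE. Qed.

Lemma vaeqP X Y : (forall i, aeq P (X.[: i]) (Y.[: i])) -> vaeq X Y.
Proof.
move=> h; have : {ae P, forall om, forall i : 'I_n, X om i 0 = Y om i 0}.
  by apply: filter_forall => i; exact: h.
by apply: filterS => om H; apply/matrixP => i j; rewrite ord1.
Qed.

Lemma vaeq_comp X Y i : vaeq X Y -> aeq P (X.[: i]) (Y.[: i]).
Proof. by apply: filterS => om ->. Qed.

Lemma vaeq_refl X : vaeq X X.
Proof. exact: aeW. Qed.

Lemma vaeq_trans X Y Z : vaeq X Y -> vaeq Y Z -> vaeq X Z.
Proof. by apply: filterS2 => om -> ->. Qed.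

Lemma vaeqB X X' Y Y' : vaeq X X' -> vaeq Y Y' -> vaeq (X - Y) (X' - Y').
Proof. by apply: filterS2 => om e1 e2; rewrite /GRing.add /GRing.opp /= e1 e2. Qed.

Lemma vsqD X Y : vsq X -> vsq Y -> vsq (X + Y).
Proof. by move=> hX hY i; rewrite compD; exact: sq_intD. Qed.

Lemma vsqN X : vsq X -> vsq (- X).
Proof. by move=> hX i; rewrite compN; exact: sq_intN. Qed.

Lemma vsqB X Y : vsq X -> vsq Y -> vsq (X - Y).
Proof. by move=> hX hY; apply: vsqD => //; exact: vsqN. Qed.

Lemma vsqZ a X : vsq X -> vsq (a *: X).
Proof. by move=> hX i; rewrite compZ; exact: sq_intZ. Qed.

Lemma vsq_sum (I : Type) (r : seq I) (q : pred I) (F : I -> Omega -> 'cV[R]_n) :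
  (forall i, vsq (F i)) -> vsq (\sum_(i <- r | q i) F i).
Proof. by move=> hF i; rewrite comp_sum; apply: sq_int_sum => j; exact: hF. Qed.

End Component.

Lemma vsq_lmx {a b : nat} (A : 'M[R]_(a, b)) X : vsq X -> vsq (lmx A X).
Proof.
by move=> hX i; rewrite comp_lmx; apply: sq_int_sum => j; apply: sq_intZ; exact: hX.
Qed.

Lemma Ecross_tr {a b : nat} (X : Omega -> 'cV[R]_a) (Y : Omega -> 'cV[R]_b) :
  (Ecross P X Y)^T = Ecross P Y X.
Proof. by apply/matrixP => i j; rewrite [LHS]mxE !EcrossE ipC. Qed.

Lemma EcrossDl {a b : nat} (X Y : Omega -> 'cV[R]_a) (Z : Omega -> 'cV[R]_b) :
  vsq X -> vsq Y -> vsq Z -> Ecross P (X + Y) Z = Ecross P X Z + Ecross P Y Z.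
Proof.
by move=> hX hY hZ; apply/matrixP => i j; rewrite [RHS]mxE !EcrossE compD ipDl.
Qed.

Lemma EcrossZl {a b : nat} c (X : Omega -> 'cV[R]_a) (Z : Omega -> 'cV[R]_b) :
  vsq X -> vsq Z -> Ecross P (c *: X) Z = c *: Ecross P X Z.
Proof.
by move=> hX hZ; apply/matrixP => i j; rewrite [RHS]mxE !EcrossE compZ ipZl.
Qed.

Lemma EcrossNl {a b : nat} (X : Omega -> 'cV[R]_a) (Z : Omega -> 'cV[R]_b) :
  vsq X -> vsq Z -> Ecross P (- X) Z = - Ecross P X Z.
Proof. by move=> hX hZ; rewrite -scaleN1r EcrossZl // scaleN1r. Qed.

Lemma EcrossBl {a b : nat} (X Y : Omega -> 'cV[R]_a) (Z : Omega -> 'cV[R]_b) :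
  vsq X -> vsq Y -> vsq Z -> Ecross P (X - Y) Z = Ecross P X Z - Ecross P Y Z.
Proof. by move=> hX hY hZ; rewrite EcrossDl ?EcrossNl //; exact: vsqN. Qed.

Lemma Ecross0l {a b : nat} (Z : Omega -> 'cV[R]_b) :
  Ecross P (0 : Omega -> 'cV[R]_a) Z = 0.
Proof.
apply/matrixP => i j; rewrite [RHS]mxE EcrossE.
have -> : (fun om => (0 : Omega -> 'cV[R]_a) om i 0) = 0 by apply/funext => om; rewrite mxE.
exact: ip0l.
Qed.

Lemma Ecross_mull {a a' b : nat} (A : 'M[R]_(a', a)) (X : Omega -> 'cV[R]_a)
    (Z : Omega -> 'cV[R]_b) :
  vsq X -> vsq Z -> Ecross P (lmx A X) Z = A *m Ecross P X Z.
Proof.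
move=> hX hZ; apply/matrixP => i j; rewrite [RHS]mxE EcrossE comp_lmx ip_suml //.
  by apply: eq_bigr => k _; rewrite EcrossE ipZl.
by move=> k; apply: sq_intZ; exact: hX.
Qed.

Lemma Ecross_suml {a b : nat} (I : Type) (r : seq I) (q : pred I)
    (F : I -> Omega -> 'cV[R]_a) (Z : Omega -> 'cV[R]_b) :
  (forall i, vsq (F i)) -> vsq Z ->
  Ecross P (\sum_(i <- r | q i) F i) Z = \sum_(i <- r | q i) Ecross P (F i) Z.
Proof.
move=> hF hZ; elim: r => [|i r IH]; first by rewrite !big_nil Ecross0l.
rewrite !big_cons; case: (q i) => //; rewrite EcrossDl ?IH //; exact: vsq_sum.
Qed.

Lemma Ecross_aeql {a b : nat} (X X' : Omega -> 'cV[R]_a) (Z : Omega -> 'cV[R]_b) :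
  vsq X' -> vsq Z -> vaeq X X' -> Ecross P X Z = Ecross P X' Z.
Proof.
move=> hX hZ XX; apply/matrixP => i j; rewrite !EcrossE.
by apply: ip_aeql => //; exact: vaeq_comp.
Qed.

Lemma EcrossDr {a b : nat} (X Y : Omega -> 'cV[R]_a) (Z : Omega -> 'cV[R]_b) :
  vsq X -> vsq Y -> vsq Z -> Ecross P Z (X + Y) = Ecross P Z X + Ecross P Z Y.
Proof.
by move=> hX hY hZ; rewrite -Ecross_tr EcrossDl // linearD /= !Ecross_tr.
Qed.

Lemma EcrossZr {a b : nat} c (X : Omega -> 'cV[R]_a) (Z : Omega -> 'cV[R]_b) :
  vsq X -> vsq Z -> Ecross P Z (c *: X) = c *: Ecross P Z X.
Proof.
by move=> hX hZ; rewrite -Ecross_tr EcrossZl // linearZ /= Ecross_tr.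
Qed.

Lemma Ecross_mulr {a a' b : nat} (A : 'M[R]_(a', a)) (X : Omega -> 'cV[R]_a)
    (Z : Omega -> 'cV[R]_b) :
  vsq X -> vsq Z -> Ecross P Z (lmx A X) = Ecross P Z X *m A^T.
Proof.
by move=> hX hZ; rewrite -Ecross_tr Ecross_mull // trmx_mul Ecross_tr.
Qed.

Lemma Ecross_sumr {a b : nat} (I : Type) (r : seq I) (q : pred I)
    (F : I -> Omega -> 'cV[R]_a) (Z : Omega -> 'cV[R]_b) :
  (forall i, vsq (F i)) -> vsq Z ->
  Ecross P Z (\sum_(i <- r | q i) F i) = \sum_(i <- r | q i) Ecross P Z (F i).
Proof.
move=> hF hZ; rewrite -Ecross_tr Ecross_suml // linear_sum /=.
by apply: eq_bigr => i _; rewrite Ecross_tr.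
Qed.

Lemma Ecross_aeqr {a b : nat} (X X' : Omega -> 'cV[R]_a) (Z : Omega -> 'cV[R]_b) :
  vsq X' -> vsq Z -> vaeq X X' -> Ecross P Z X = Ecross P Z X'.
Proof. by move=> hX hZ XX; rewrite -Ecross_tr (Ecross_aeql hX hZ XX) Ecross_tr. Qed.

Lemma Ecross_self_eq0 {a : nat} (X : Omega -> 'cV[R]_a) :
  vsq X -> Ecross P X X = 0 -> vaeq X 0.
Proof.
move=> hX h; apply: vaeqP => i.
have -> : (fun om => (0 : Omega -> 'cV[R]_a) om i 0) = 0 by apply/funext => om; rewrite mxE.
by apply: ip_eq0 => //; have /matrixP/(_ i i) := h; rewrite [RHS]mxE EcrossE.
Qed.

Lemma Ecross_sub_eq0 {a : nat} (X Y : Omega -> 'cV[R]_a) :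
  vsq X -> vsq Y -> Ecross P (X - Y) (X - Y) = 0 -> vaeq X Y.
Proof.
move=> hX hY h; have := Ecross_self_eq0 (vsqB hX hY) h.
by apply: filterS => om /eqP; rewrite subr_eq0 => /eqP.
Qed.
End VectorProcesses.

(** * Past and present of the noise for vector variables *)

Section VectorNoise.
Context {R : realType} {d : measure_display} {Omega : measurableType d}.
Variable P : probability Omega R.
Context {S : finType}.
Variables (p : S -> R) (u : S -> int -> Omega -> R) (L : pred (seq S)).
Context {m : nat}.
Variable v : int -> Omega -> 'cV[R]_m.
Hypothesis wn : white_noise P p u L v.

Let hp : forall s, 0 < p s. Proof. by case: wn. Qed.

Notation inH f t := (in_hilbert P p u f t v).
Notation vs := (vsq P).
Notation E := (Ecross P).

Definition Mv {n : nat} (s : S) (t : int) (X : Omega -> 'cV[R]_n) : Omega -> 'cV[R]_n :=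
  fun om => (u s t om / Num.sqrt (p s)) *: X om.

Lemma comp_Mv {n : nat} s t (X : Omega -> 'cV[R]_n) i :
  (fun om => Mv s t X om i 0) = mulu p u s t (fun om => X om i 0).
Proof. by apply/funext => om; rewrite mxE. Qed.

Lemma MvD {n : nat} s t (X Y : Omega -> 'cV[R]_n) : Mv s t (X + Y) = Mv s t X + Mv s t Y.
Proof. by apply/funext => om; rewrite /Mv scalerDr. Qed.

Lemma MvB {n : nat} s t (X Y : Omega -> 'cV[R]_n) : Mv s t (X - Y) = Mv s t X - Mv s t Y.
Proof. by apply/funext => om; rewrite /Mv scalerBr. Qed.

Lemma Mv_lmx {a b : nat} s t (A : 'M[R]_(a, b)) X : Mv s t (lmx A X) = lmx A (Mv s t X).
Proof. by apply/funext => om; rewrite /Mv /lmx scalemxAr. Qed.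

Lemma MvZ {n : nat} s t c (X : Omega -> 'cV[R]_n) : Mv s t (c *: X) = c *: Mv s t X.
Proof. by apply/funext => om; rewrite /Mv; change ((c *: X) om) with (c *: X om); rewrite scalerA mulrC -scalerA. Qed.

Lemma Mv_sum {n : nat} s t (I : Type) (r : seq I) (q : pred I) (F : I -> Omega -> 'cV[R]_n) :
  Mv s t (\sum_(i <- r | q i) F i) = \sum_(i <- r | q i) Mv s t (F i).
Proof.
elim: r => [|i r IH].
  by rewrite !big_nil; apply/funext => om; rewrite /Mv scaler0.
by rewrite !big_cons; case: (q i); rewrite ?MvD IH.
Qed.

Lemma zw_Mv {n : nat} (r : int -> Omega -> 'cV[R]_n) w s t :
  zw p u r (rcons w s) (t + 1) = Mv s t (zw p u r w t).
Proof. by apply/funext => om; rewrite zw_rcons. Qed.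

Lemma vaeq_Mv {n : nat} s t (X Y : Omega -> 'cV[R]_n) :
  vaeq P X Y -> vaeq P (Mv s t X) (Mv s t Y).
Proof. by apply: filterS => om; rewrite /Mv => ->. Qed.

Definition vH {n : nat} (t : int) (X : Omega -> 'cV[R]_n) : Prop :=
  forall i, inH (fun om => X om i 0) t.

(* The past of the noise together with its present value. *)
Definition vHp {n : nat} (t : int) (X : Omega -> 'cV[R]_n) : Prop :=
  exists (D : 'M[R]_(n, m)) Y, vH t Y /\ X = Y + lmx D (v t).

Lemma vH_sq {n : nat} t (X : Omega -> 'cV[R]_n) : vH t X -> vs X.
Proof. by move=> h i; exact: in_hilbert_sq (h i). Qed.

Lemma v_sq t : vs (v t).
Proof. by move=> i; have := zv_sq wn [::] t i; rewrite zc_nil. Qed.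

Lemma Mv_v_sq s t : vs (Mv s t (v t)).
Proof. by move=> i; rewrite comp_Mv -(zc_nil p u); exact: (mulu_noise_sq wn). Qed.

Lemma Mv_vH {n : nat} s t (X : Omega -> 'cV[R]_n) : vH t X -> vH (t + 1) (Mv s t X).
Proof. by move=> h i; rewrite comp_Mv; exact: (mulu_hilbert wn). Qed.

Lemma zw_vH w t : w != [::] -> vH t (zw p u v w t).
Proof. by move=> w0 i; apply: in_hilbert_zc w0; exact: zv_sq_ne wn. Qed.

Lemma Mv_v_vH s t : vH (t + 1) (Mv s t (v t)).
Proof. by rewrite -(zw_nil p u v t) -zw_Mv; exact: zw_vH. Qed.

Lemma vHD {n : nat} t (X Y : Omega -> 'cV[R]_n) : vH t X -> vH t Y -> vH t (X + Y).
Proof.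
by move=> hX hY i; rewrite compD; apply: in_hilbertD => //; exact: zv_sq_ne wn.
Qed.

Lemma vH_lmx {a b : nat} t (A : 'M[R]_(a, b)) X : vH t X -> vH t (lmx A X).
Proof.
move=> hX i; rewrite comp_lmx; apply: in_hilbert_sum => [|j]; first exact: zv_sq_ne wn.
by apply: in_hilbertZ => //; exact: zv_sq_ne wn.
Qed.

Lemma vHZ {n : nat} t c (X : Omega -> 'cV[R]_n) : vH t X -> vH t (c *: X).
Proof. by move=> hX i; rewrite compZ; apply: in_hilbertZ => //; exact: zv_sq_ne wn. Qed.

Lemma vHB {n : nat} t (X Y : Omega -> 'cV[R]_n) : vH t X -> vH t Y -> vH t (X - Y).
Proof. by move=> hX hY; apply: vHD => //; rewrite -scaleN1r; exact: vHZ. Qed.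

Lemma vHp_vH {n : nat} t (X : Omega -> 'cV[R]_n) : vH t X -> vHp t X.
Proof. by move=> h; exists 0, X; rewrite lmx0 addr0. Qed.

Lemma vHp_v t : vHp t (v t).
Proof.
exists 1%:M, 0; rewrite lmx1 add0r; split => // i.
have -> : (fun om => (0 : Omega -> 'cV[R]_m) om i 0) = 0 by apply/funext => om; rewrite mxE.
by apply: in_hilbert0; exact: zv_sq_ne wn.
Qed.

Lemma vHp_lmx {a b : nat} t (A : 'M[R]_(a, b)) X : vHp t X -> vHp t (lmx A X).
Proof.
move=> [D [Y [hY ->]]]; exists (A *m D), (lmx A Y); split; first exact: vH_lmx.
by rewrite lmxD lmxA.
Qed.

Lemma vHpD {n : nat} t (X Y : Omega -> 'cV[R]_n) : vHp t X -> vHp t Y -> vHp t (X + Y).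
Proof.
move=> [D [X' [hX ->]]] [D' [Y' [hY ->]]]; exists (D + D'), (X' + Y').
split; first exact: vHD.
have -> : lmx (D + D') (v t) = lmx D (v t) + lmx D' (v t).
  by apply/funext => om; rewrite /lmx mulmxDl.
by rewrite addrACA.
Qed.

Lemma vHpN {n : nat} t (X : Omega -> 'cV[R]_n) : vHp t X -> vHp t (- X).
Proof.
move=> /(vHp_lmx (- 1%:M)); congr (vHp t _).
by apply/funext => om; rewrite /lmx mulNmx mul1mx.
Qed.

Lemma vHpB {n : nat} t (X Y : Omega -> 'cV[R]_n) : vHp t X -> vHp t Y -> vHp t (X - Y).
Proof. by move=> hX hY; apply: vHpD => //; exact: vHpN. Qed.

Lemma vHp_sq {n : nat} t (X : Omega -> 'cV[R]_n) : vHp t X -> vs X.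
Proof.
move=> [D [Y [hY ->]]]; apply: vsqD; first exact: vH_sq hY.
exact/vsq_lmx/v_sq.
Qed.

(** Multiplication by an input turns the present noise into [z_s] one time step later, so present
    and past both land in the past. *)
Lemma Mv_vHp {n : nat} s t (X : Omega -> 'cV[R]_n) : vHp t X -> vH (t + 1) (Mv s t X).
Proof.
move=> [D [Y [hY ->]]]; rewrite MvD Mv_lmx; apply: vHD; first exact: Mv_vH.
exact/vH_lmx/Mv_v_vH.
Qed.

Lemma Mv_sq {n : nat} s t (X : Omega -> 'cV[R]_n) : vHp t X -> vs (Mv s t X).
Proof. by move=> /(Mv_vHp s)/vH_sq. Qed.

Lemma Mv_noise_orth {n : nat} s s' t (X : Omega -> 'cV[R]_n) : vH t X ->
  E (Mv s t X) (Mv s' t (v t)) = 0.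
Proof.
move=> hX; apply/matrixP => i j; rewrite [RHS]mxE EcrossE !comp_Mv -(zc_nil p u).
by apply: (mulu_orth_words wn) => //; rewrite eqxx orbT.
Qed.

Lemma noise_Mv_orth {n : nat} s s' t (X : Omega -> 'cV[R]_n) : vH t X ->
  E (Mv s' t (v t)) (Mv s t X) = 0.
Proof. by move=> hX; rewrite -Ecross_tr Mv_noise_orth // trmx0. Qed.

Lemma noise_past_orth {n : nat} t (X : Omega -> 'cV[R]_n) : vH t X -> E X (v t) = 0.
Proof.
move=> hX; apply/matrixP => i j; rewrite [RHS]mxE EcrossE -(zc_nil p u).
exact: (noise_orth wn).
Qed.

Lemma past_noise_orth {n : nat} t (X : Omega -> 'cV[R]_n) : vH t X -> E (v t) X = 0.
Proof. by move=> hX; rewrite -Ecross_tr noise_past_orth // trmx0. Qed.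

Lemma Mv_letter_orth {a b : nat} s s' t (X : Omega -> 'cV[R]_a) (Y : Omega -> 'cV[R]_b) :
  vHp t X -> vHp t Y -> s != s' -> E (Mv s t X) (Mv s' t Y) = 0.
Proof.
move=> [D [X' [hX ->]]] [D' [Y' [hY ->]]] ss.
have hX2 := vH_sq (Mv_vH s hX); have hY2 := vH_sq (Mv_vH s' hY).
have hv s0 k (D0 : 'M[R]_(k, m)) : vs (lmx D0 (Mv s0 t (v t))) by exact/vsq_lmx/Mv_v_sq.
rewrite !MvD !Mv_lmx EcrossDl // ?EcrossDr //; try exact: vsqD.
rewrite (Ecross_mulr _ (Mv_v_sq s' t) hX2) Mv_noise_orth //.
rewrite (Ecross_mull _ (Mv_v_sq s t) hY2) noise_Mv_orth //.
rewrite (Ecross_mull _ (Mv_v_sq s t) (hv s' _ D')) (Ecross_mulr _ (Mv_v_sq s' t) (Mv_v_sq s t)).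
have -> : E (Mv s t (v t)) (Mv s' t (v t)) = 0.
  apply/matrixP => i j; rewrite [RHS]mxE EcrossE !comp_Mv -!(zc_nil p u).
  exact: (mulu_noise_orth wn).
have -> : E (Mv s t X') (Mv s' t Y') = 0.
  apply/matrixP => i j; rewrite [RHS]mxE EcrossE !comp_Mv.
  exact: (mulu_orth wn).
by rewrite !(mul0mx, mulmx0) !addr0.
Qed.

Lemma Mv2_shift {a b : nat} s s2 t (X : Omega -> 'cV[R]_a) (Y : Omega -> 'cV[R]_b) :
  vH (t + 1) X -> vHp t Y ->
  E (Mv s (t + 1) X) (Mv s (t + 1) (Mv s2 t Y)) =
  (L [:: s2; s])%:R *: E X (Mv s2 t Y).
Proof.
move=> hX [D [Y' [hY ->]]].
have h1 : E (Mv s (t + 1) X) (Mv s (t + 1) (Mv s2 t Y')) =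
  (L [:: s2; s])%:R *: E X (Mv s2 t Y').
  apply/matrixP => i j; rewrite [RHS]mxE !EcrossE !comp_Mv.
  exact: (mulu2_hilbert wn).
have h2 : E (Mv s (t + 1) X) (Mv s (t + 1) (Mv s2 t (v t))) =
  (L [:: s2; s])%:R *: E X (Mv s2 t (v t)).
  apply/matrixP => i j; rewrite [RHS]mxE !EcrossE !comp_Mv -(zc_nil p u).
  exact: (mulu2_words wn).
have hX1 := vH_sq hX; have hX2 := vH_sq (Mv_vH s hX).
have hY1 := Mv_vH s2 hY; have hY2 := vH_sq (Mv_vH s hY1).
have hv1 := Mv_v_vH s2 t; have hv2 := vH_sq (Mv_vH s hv1).
have hY3 := vH_sq hY1; have hv3 := vH_sq hv1.
rewrite !(MvD, Mv_lmx) !EcrossDr //; try exact: vsq_lmx.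
by rewrite h1 !Ecross_mulr // h2 scalerDr scalemxAl.
Qed.
End VectorNoise.

(** * Second-order analysis of the state equation *)

Section Systems.
Local Opaque Mv zw Ecross.
Context {R : realType} {d : measure_display} {Omega : measurableType d}.
Variable P : probability Omega R.
Context {S : finType}.
Variables (p : S -> R) (u : S -> int -> Omega -> R) (L : pred (seq S)).
Context {m : nat}.
Variable v : int -> Omega -> 'cV[R]_m.
Hypothesis wn : white_noise P p u L v.

Let hp : forall s, 0 < p s. Proof. by case: wn. Qed.

Notation vs := (vsq P).
Notation E := (Ecross P).
Notation M := (Mv p u).
Notation vH := (vH P p u v).
Notation vHp := (vHp P p u v).
Notation sp s := (Num.sqrt (p s)).

Definition vstat {n : nat} (X : int -> Omega -> 'cV[R]_n) : Prop :=
  forall i, stat_space P p u v (fun t om => X t om i 0).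

Lemma vstat_vH {n : nat} (X : int -> Omega -> 'cV[R]_n) t : vstat X -> vH t (X t).
Proof. by move=> hX i; exact: (stat_hilbert wn t (hX i)). Qed.

Lemma vstat_Ecross {a b : nat} (X : int -> Omega -> 'cV[R]_a)
    (Y : int -> Omega -> 'cV[R]_b) t t' :
  vstat X -> vstat Y -> E (X t) (Y t) = E (X t') (Y t').
Proof.
move=> hX hY; apply/matrixP => i j; rewrite !EcrossE.
exact: (stat_ip wn t t' (hX i) (hY j)).
Qed.

Lemma vstatD {n : nat} (X Y : int -> Omega -> 'cV[R]_n) :
  vstat X -> vstat Y -> vstat (fun t => X t + Y t).
Proof.
move=> hX hY i; have := stat_lin wn 1 (hX i) (hY i); congr stat_space.
by apply/funext => t; apply/funext => om; rewrite mxE scale1r.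
Qed.

Lemma vstat_lmx {a b : nat} (A : 'M[R]_(a, b)) (X : int -> Omega -> 'cV[R]_b) :
  vstat X -> vstat (fun t => lmx A (X t)).
Proof.
move=> hX i.
have h j : stat_space P p u v (fun t => A i j *: (fun om => X t om j 0)).
  have := stat_lin wn (A i j) (hX j) (stat0 wn); congr stat_space.
  by apply/funext => t; rewrite addr0.
have := stat_sum wn (index_enum 'I_b) predT h; congr stat_space.
by apply/funext => t; rewrite comp_lmx.
Qed.

Lemma vstatB {n : nat} (X Y : int -> Omega -> 'cV[R]_n) :
  vstat X -> vstat Y -> vstat (fun t => X t - Y t).
Proof.
move=> hX hY; have := vstatD hX (vstat_lmx (- 1%:M) hY); congr vstat.
by apply/funext => t; congr (_ + _); apply/funext => om; rewrite /lmx mulNmx mul1mx.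
Qed.

Lemma vstat_Mv {n : nat} s (X : int -> Omega -> 'cV[R]_n) :
  vstat X -> vstat (fun t => M s (t - 1) (X (t - 1))).
Proof.
move=> hX i; have := stat_mulu wn s (hX i); congr stat_space.
by apply/funext => t; rewrite comp_Mv.
Qed.

Lemma vstat_Mv_noise s : vstat (fun t => M s (t - 1) (v (t - 1))).
Proof.
move=> i; have := stat_mulu_noise wn s i; congr stat_space.
by apply/funext => t; rewrite comp_Mv zc_nil.
Qed.

Lemma Mv_Ecross_st {a b : nat} s (X : int -> Omega -> 'cV[R]_a)
    (Y : int -> Omega -> 'cV[R]_b) t t' :
  vstat X -> vstat Y ->
  E (M s t (X t)) (M s t (Y t)) = E (M s t' (X t')) (M s t' (Y t')).
Proof.
move=> hX hY; have := vstat_Ecross (t + 1) (t' + 1) (vstat_Mv s hX) (vstat_Mv s hY).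
by rewrite !addrK.
Qed.

Lemma Mv_noise_Ecross_st s t t' :
  E (M s t (v t)) (M s t (v t)) = E (M s t' (v t')) (M s t' (v t')).
Proof.
have := vstat_Ecross (t + 1) (t' + 1) (vstat_Mv_noise s) (vstat_Mv_noise s).
by rewrite !addrK.
Qed.

Section Words.
Context {k : nat}.
Variable r : int -> Omega -> 'cV[R]_k.
Hypothesis hr : forall t, vHp t (r t).

Lemma zw_vHp w t : vHp t (zw p u r w t).
Proof.
elim/last_ind: w t => [|w s IH] t; first by rewrite zw_nil.
rewrite -[t](subrK 1) (zw_Mv wn).
exact/vHp_vH/(Mv_vHp wn).
Qed.

Lemma zw_vH_of_vHp w t : w != [::] -> vH t (zw p u r w t).
Proof.
case/lastP: w => // w s _; rewrite -[t](subrK 1) (zw_Mv wn).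
exact/(Mv_vHp wn)/zw_vHp.
Qed.
End Words.

Lemma zw_letter {k : nat} (r : int -> Omega -> 'cV[R]_k) s t :
  zw p u r [:: s] (t + 1) = M s t (r t).
Proof. by rewrite -[[:: s]]/(rcons [::] s) (zw_Mv wn) zw_nil. Qed.

Context {n : nat}.
Variables (A : S -> 'M[R]_n) (K : S -> 'M[R]_(n, m)) (x : int -> Omega -> 'cV[R]_n).

(** Right-hand side of the state equation; the factor sqrt(p_s) undoes the normalization inside
    [Mv]. *)
Definition step t : Omega -> 'cV[R]_n :=
  \sum_s sp s *: M s t (lmx (A s) (x t) + lmx (K s) (v t)).

Hypothesis hx : forall t, vH t (x t).
Hypothesis hrec : forall t, vaeq P (x (t + 1)) (step t).

Let AxKv s t : vHp t (lmx (A s) (x t) + lmx (K s) (v t)).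
Proof.
apply: (vHpD wn); first exact/vHp_vH/(vH_lmx wn).
exact/(vHp_lmx wn)/(vHp_v wn).
Qed.

Lemma step_sq t : vs (step t).
Proof. by apply: vsq_sum => s; apply: vsqZ; apply: (Mv_sq wn). Qed.

(** Terms of the sum carrying another letter are orthogonal to [M s t Y]. *)
Lemma step_Ecross {k : nat} s t (Y : Omega -> 'cV[R]_k) : vHp t Y ->
  E (step t) (M s t Y) =
  sp s *: (A s *m E (M s t (x t)) (M s t Y) + K s *m E (M s t (v t)) (M s t Y)).
Proof.
move=> hY; have hMY := Mv_sq wn s hY.
have hA s' := Mv_sq wn s' (AxKv s' t).
rewrite Ecross_suml //; last by move=> s'; exact: vsqZ.
rewrite (bigD1 s) //= big1 => [|s' ss]; last first.
  by rewrite EcrossZl // (Mv_letter_orth wn) // scaler0.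
rewrite addr0 EcrossZl //; congr (_ *: _).
have h1 : vs (M s t (x t)) by apply/vH_sq/(Mv_vH wn).
have h2 := Mv_v_sq wn s t.
by rewrite MvD !Mv_lmx EcrossDl ?Ecross_mull //; exact: vsq_lmx.
Qed.

Lemma state_Ecross {k : nat} s t (Y : Omega -> 'cV[R]_k) : vHp t Y ->
  E (x (t + 1)) (M s t Y) =
  sp s *: (A s *m E (M s t (x t)) (M s t Y) + K s *m E (M s t (v t)) (M s t Y)).
Proof.
move=> hY; rewrite -step_Ecross //; apply: Ecross_aeql => //; first exact: step_sq.
exact: (Mv_sq wn).
Qed.

Lemma state_Ecross_past {k : nat} s t (Y : Omega -> 'cV[R]_k) : vH t Y ->
  E (x (t + 1)) (M s t Y) = sp s *: (A s *m E (M s t (x t)) (M s t Y)).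
Proof.
move=> hY; rewrite (state_Ecross s (vHp_vH hY)); have e := noise_Mv_orth wn s s hY.
by rewrite e mulmx0 addr0.
Qed.

Lemma state_Ecross_noise s t :
  E (x (t + 1)) (M s t (v t)) = sp s *: (K s *m E (M s t (v t)) (M s t (v t))).
Proof.
rewrite (state_Ecross s (vHp_v wn t)); have e := Mv_noise_orth wn s s (hx t).
by rewrite e mulmx0 add0r.
Qed.

(** Membership in the past at each time leaves open how the approximations depend on time.
    Correlations with [z_w] are shown time-independent by induction on [w], peeling the last letter
    with the state equation and the shift identity. *)
Lemma state_vstat : vstat x.
Proof.
have key w : w != [::] -> forall t t', E (x t) (zw p u v w t) = E (x t') (zw p u v w t').
  elim/last_ind: w => [|w s IH _ t t']; first by rewrite eqxx.
  rewrite -[t](subrK 1) -[t'](subrK 1); move: (t - 1) (t' - 1) => {}t {}t'.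
  rewrite !(zw_Mv wn).
  case/lastP: w IH => [|w s2] IH.
    by rewrite !zw_nil (state_Ecross_noise s t) (state_Ecross_noise s t') (Mv_noise_Ecross_st s t t').
  have w0 : rcons w s2 != [::] by rewrite -size_eq0 size_rcons.
  have hw t0 : vH t0 (zw p u v (rcons w s2) t0) by exact: (zw_vH wn).
  rewrite (state_Ecross_past s (hw t)) (state_Ecross_past s (hw t')).
  have hs t0 : E (M s t0 (x t0)) (M s t0 (zw p u v (rcons w s2) t0)) =
      (L [:: s2; s])%:R *: E (x t0) (zw p u v (rcons w s2) t0).
    rewrite -[t0](subrK 1) (zw_Mv wn); apply: (Mv2_shift wn); first exact: hx.
    by apply: zw_vHp => t1; exact: (vHp_v wn).
  by rewrite !hs (IH w0 t t').
move=> i; apply: (stat_space_of_hilbert wn) => [t|t t' w j w0]; first exact: hx.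
have /matrixP/(_ i j) := key w w0 t t'; rewrite EcrossE => ->; exact: EcrossE.
Qed.

Hypothesis A5a : forall s1 s2, ~~ L [:: s1; s2] -> A s2 *m A s1 = 0.
Hypothesis A5b : forall s1 s2, ~~ L [:: s1; s2] ->
  A s2 *m K s1 *m E (zw p u v [:: s1] 0) (zw p u v [:: s1] 0) = 0.

(** The noise half of (A5) concerns second moments; a vector with zero second moments vanishes
    almost everywhere. *)
Lemma forbidden_noise s1 s2 t : ~~ L [:: s1; s2] ->
  vaeq P (lmx (A s2 *m K s1) (M s1 t (v t))) 0.
Proof.
move=> Ls; have h := Mv_v_sq wn s1 t.
apply: Ecross_self_eq0; first exact: vsq_lmx.
rewrite Ecross_mull // ?Ecross_mulr //; last exact: vsq_lmx.
(* [z_{s1}] at time 0 is built from the noise at time -1, hence the move to -1. *)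
by rewrite (Mv_noise_Ecross_st s1 t (-1)) -zw_letter addNr mulmxA A5b // mul0mx.
Qed.

Lemma forbidden_noise_Ecross {k : nat} s1 s2 t (Y : Omega -> 'cV[R]_k) :
  ~~ L [:: s1; s2] -> vs Y -> A s2 *m (K s1 *m E (M s1 t (v t)) Y) = 0.
Proof.
move=> Ls hY; rewrite mulmxA -Ecross_mull //; last exact: (Mv_v_sq wn).
rewrite (Ecross_aeql _ hY (forbidden_noise t Ls)) ?Ecross0l //.
by move=> i; have := sq_int0 P; congr sq_int; apply/funext => om; rewrite mxE.
Qed.

(** For [s2 s] in [L] this is the shift identity. Otherwise the left side vanishes and so does the
    right: expanding [x (t + 1)] leaves the products A_s A_{s2} and A_s K_{s2}, excluded by (A5). *)
Lemma state_Ecross_shift {k : nat} s s2 t (Y : Omega -> 'cV[R]_k) : vHp t Y ->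
  E (x (t + 1 + 1)) (M s (t + 1) (M s2 t Y)) = (sp s *: A s) *m E (x (t + 1)) (M s2 t Y).
Proof.
move=> hY; have hMY := Mv_vHp wn s2 hY.
rewrite state_Ecross_past // (Mv2_shift wn) // -scalemxAl; congr (_ *: _).
case Ls: (L _); first by rewrite scale1r.
rewrite scale0r mulmx0 state_Ecross // -scalemxAr mulmxDr mulmxA A5a ?Ls // mul0mx add0r.
by rewrite forbidden_noise_Ecross ?Ls ?scaler0 //; exact: vH_sq hMY.
Qed.

(** This is E[x x^T u_s^2], the matrix P_s: the factor [p s] cancels the normalization of [Mv].
    Likewise [noise_cov] is Q_s. *)
Definition state_cov s t : 'M[R]_n := p s *: E (M s t (x t)) (M s t (x t)).
Definition noise_cov s t : 'M[R]_m := p s *: E (M s t (v t)) (M s t (v t)).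

Lemma state_cov_st s t t' : state_cov s t = state_cov s t'.
Proof. by rewrite /state_cov (Mv_Ecross_st s t t' state_vstat state_vstat). Qed.

(** The state equation is inserted in one argument, the shift identity keeps the letters with [s1 s]
    in [L], and [state_Ecross] expands the other argument. The cross terms between state and noise
    vanish. *)
Lemma state_cov_lyapunov s t : state_cov s t =
  p s *: \sum_(s1 : S | L [:: s1; s]) (A s1 *m state_cov s1 t *m (A s1)^T
     + K s1 *m noise_cov s1 t *m (K s1)^T).
Proof.
rewrite (state_cov_st s t (t + 1)) {1}/state_cov; congr (_ *: _).
have hMx : vs (M s (t + 1) (x (t + 1))) by apply/vH_sq/(Mv_vH wn).
have hM2 s1 : vs (M s (t + 1) (M s1 t (lmx (A s1) (x t) + lmx (K s1) (v t)))).
  by apply/vH_sq/(Mv_vH wn)/(Mv_vHp wn).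
rewrite (@Ecross_aeqr _ _ _ _ _ _ _ (M s (t + 1) (step t))) //; first last.
- exact/vaeq_Mv.
- by rewrite Mv_sum; apply: vsq_sum => s1; rewrite MvZ; exact: vsqZ.
rewrite Mv_sum Ecross_sumr //; last by move=> s1; rewrite MvZ; exact: vsqZ.
rewrite [RHS]big_mkcond; apply: eq_bigr => s1 _.
rewrite MvZ EcrossZr // (Mv2_shift wn) //.
case: ifP => _; last by rewrite scale0r scaler0.
rewrite scale1r state_Ecross // scalerA -expr2 sqr_sqrtr ?ltW //.
have hx1 : vs (M s1 t (x t)) by apply/vH_sq/(Mv_vH wn).
have hv1 := Mv_v_sq wn s1 t.
have e1 := Mv_noise_orth wn s1 s1 (hx t).
have e2 := noise_Mv_orth wn s1 s1 (hx t).
rewrite MvD !Mv_lmx !EcrossDr //; try exact: vsq_lmx.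
rewrite !Ecross_mulr // e1 e2 !mul0mx addr0 add0r.
by rewrite scalerDr /state_cov /noise_cov !mulmxA -!scalemxAr -!scalemxAl.
Qed.

Context {q : nat}.
Variables (C : 'M[R]_(q, n)) (D : 'M[R]_(q, m)).
Definition output t : Omega -> 'cV[R]_q := lmx C (x t) + lmx D (v t).

Lemma output_vHp t : vHp t (output t).
Proof.
apply: (vHpD wn); first exact/vHp_vH/(vH_lmx wn).
exact/(vHp_lmx wn)/(vHp_v wn).
Qed.

(** The matrix B_s with P_s and Q_s given as actual second moments; its agreement with [Bm] rests on
    uniqueness of the Lyapunov solution. *)
Definition input_gain s : 'M[R]_(n, q) :=
  (sp s)^-1 *: (A s *m state_cov s 0 *m C^T + K s *m noise_cov s 0 *m D^T).

Lemma state_output_Ecross w s t :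
  E (x t) (zw p u output (s :: w) t) = mxw (fun s => sp s *: A s) w *m input_gain s.
Proof.
elim/last_ind: w t => [|w s' IH] t; rewrite -[t](subrK 1); move: (t - 1) => {}t.
  rewrite zw_letter /mxw /= mul1mx state_Ecross; last exact: output_vHp.
  have hx1 : vs (M s t (x t)) by apply/vH_sq/(Mv_vH wn).
  have hv1 := Mv_v_sq wn s t.
  have e1 := Mv_noise_orth wn s s (hx t).
  have e2 := noise_Mv_orth wn s s (hx t).
  rewrite MvD !Mv_lmx !EcrossDr //; try exact: vsq_lmx.
  rewrite !Ecross_mulr // e1 e2 !mul0mx addr0 add0r.
  rewrite /input_gain (state_cov_st s 0 t) /noise_cov (Mv_noise_Ecross_st s 0 t).
  rewrite /state_cov -!scalemxAr -!scalemxAl -scalerDr scalerA !mulmxA; congr (_ *: _).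
  have s0 : sp s != 0 by rewrite sqrtr_eq0 -ltNge.
  by rewrite -[X in _ = _ * X](sqr_sqrtr (ltW (hp s))) expr2 mulKf.
rewrite mxw_rcons -mulmxA -(IH t) -rcons_cons (zw_Mv wn).
(* [s :: w] is nonempty, so a second letter can be peeled off, as the two-step shift requires. *)
case/lastP E1 : (s :: w) => [//|w1 s1].
rewrite -[t](subrK 1) (zw_Mv wn _ w1) state_Ecross_shift //.
by apply: zw_vHp => t0; exact: output_vHp.
Qed.

Lemma output_Ecross w s t : E (output t) (zw p u output (s :: w) t) =
  C *m mxw (fun s => sp s *: A s) w *m input_gain s.
Proof.
have hz := zw_vH_of_vHp output_vHp t (isT : s :: w != [::]).
have hz2 := vH_sq hz.
have hx1 := vH_sq (hx t); have hv1 := v_sq wn t.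
rewrite EcrossDl //; try exact: vsq_lmx.
have e := past_noise_orth wn hz.
rewrite !Ecross_mull // e mulmx0 addr0.
by rewrite state_output_Ecross mulmxA.
Qed.
End Systems.

Lemma zw_vaeq {R : realType} {d : measure_display} {Omega : measurableType d}
    (P : probability Omega R) {S : finType} (p : S -> R) (u : S -> int -> Omega -> R)
    (k : nat) (r r' : int -> Omega -> 'cV[R]_k) w t :
  (forall t, vaeq P (r t) (r' t)) -> vaeq P (zw p u r w t) (zw p u r' w t).
Proof. by move=> h; apply: filterS (h (t - (size w)%:Z)) => om; rewrite /zw => ->. Qed.

(** * Uniqueness for the coupled Lyapunov equations *)

Section Lyapunov.
Context {R : realType} {S : finType} {n : nat}.
Variables (p : S -> R) (L : pred (seq S)) (A : S -> 'M[R]_n).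
Hypothesis hp : forall s, 0 < p s.
Hypothesis stA : stableA p A.
Hypothesis A5a : forall s1 s2, ~~ L [:: s1; s2] -> A s2 *m A s1 = 0.

(** Let D be the difference of two solutions and G_s = A_s D_s A_s^T. After multiplication by A_s
    the restriction to [s1 s] in [L] disappears, because A_s A_{s1} = 0 otherwise. So sum_s G_s is a
    fixed point of the stable map and vanishes; then every G_s and every D_s vanish. *)
Lemma lyapunov_unique (Pm Pm' W : S -> 'M[R]_n) :
  (forall s, Pm s = p s *: \sum_(s1 | L [:: s1; s]) (A s1 *m Pm s1 *m (A s1)^T + W s1)) ->
  (forall s, Pm' s = p s *: \sum_(s1 | L [:: s1; s]) (A s1 *m Pm' s1 *m (A s1)^T + W s1)) ->
  forall s, Pm s = Pm' s.
Proof.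
move=> h h'.
pose D s := Pm s - Pm' s.
have hD s : D s = p s *: \sum_(s1 | L [:: s1; s]) (A s1 *m D s1 *m (A s1)^T).
  rewrite /D {1}h {1}h' -scalerBr -sumrB; congr (_ *: _); apply: eq_bigr => s1 _.
  by rewrite [in RHS]mulmxBr [in RHS]mulmxBl opprD addrACA subrr addr0.
pose G s := A s *m D s *m (A s)^T.
have hG s : G s = p s *: (A s *m (\sum_s1 G s1) *m (A s)^T).
  rewrite {1}/G hD -scalemxAr -scalemxAl; congr (_ *: (_ *m _)).
  rewrite [in RHS](bigID (fun s1 => L [:: s1; s])) /= mulmxDr [X in _ = _ + X](_ : _ = 0) ?addr0 //.
  rewrite mulmx_sumr big1 // => s1 Ls; by rewrite /G !mulmxA A5a // !mul0mx.
have G0 : \sum_s1 G s1 = 0.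
  by apply: (stableA_fixpoint stA); rewrite {1}(eq_bigr _ (fun s _ => hG s)).
move=> s; apply/eqP; rewrite -subr_eq0 -/(D s) hD.
rewrite big1 ?scaler0 // => s1 _; rewrite -/(G s1) hG G0 mulmx0 mul0mx.
exact: scaler0.
Qed.
End Lyapunov.

(** * The past of a process built from the noise *)

Section Closure.
Local Opaque Mv zw Ecross.
Context {R : realType} {d : measure_display} {Omega : measurableType d}.
Variable P : probability Omega R.
Context {S : finType}.
Variables (p : S -> R) (u : S -> int -> Omega -> R) (L : pred (seq S)).
Context {m : nat}.
Variable v : int -> Omega -> 'cV[R]_m.
Hypothesis wn : white_noise P p u L v.

Let hp : forall s, 0 < p s. Proof. by case: wn. Qed.

Notation vs := (vsq P).
Notation E := (Ecross P).
Notation M := (Mv p u).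
Notation vH := (vH P p u v).
Notation vHp := (vHp P p u v).
Notation vstat := (vstat P p u v).

Section OneProcess.
Context {k : nat}.
Variable r : int -> Omega -> 'cV[R]_k.
Hypothesis hr : forall t, vHp t (r t).
Notation inR f t := (in_hilbert P p u f t r).

Lemma zr_hilbert w t i : w != [::] -> in_hilbert P p u (zc p u r w t i) t v.
Proof. by move=> w0; have h := zw_vH_of_vHp wn hr t w0; exact: h i. Qed.

Lemma zr_sq w t i : w != [::] -> sq_int P (zc p u r w t i).
Proof. by move=> w0; exact: in_hilbert_sq (zr_hilbert t i w0). Qed.

Lemma combr_hilbert c t : valid_coefs c -> in_hilbert P p u (comb p u r c t) t v.
Proof.
move=> vc; apply: (comb_ind (Q := fun f => in_hilbert P p u f t v)) => //.
  by apply: in_hilbert0; exact: zv_sq_ne wn.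
move=> a w i f w0 hf; have hz := zv_sq_ne wn; apply: in_hilbertD => //.
by apply: in_hilbertZ => //; exact: zr_hilbert.
Qed.

Lemma in_hilbert_sub f t : inR f t -> in_hilbert P p u f t v.
Proof.
move=> /(in_hilbertP zr_sq)[hf Hf]; apply: in_hilbert_close => //; first exact: zv_sq_ne wn.
move=> eps /Hf[c vc hc]; exists (comb p u r c t) => //; exact: combr_hilbert.
Qed.

Lemma mulu_combr s t c : mulu p u s t (comb p u r c t) =
  comb p u r [seq (rcons x.1.1 s, x.1.2, x.2) | x <- c] (t + 1).
Proof.
rewrite /comb mulu_sum big_map; apply: eq_bigr => x _.
by rewrite muluZ zc_rcons.
Qed.

(** [r] need not be white, so the norm bound is that of [v], whose past contains the past of [r]. *)
Lemma mulu_inR s t f : inR f t -> inR (mulu p u s t f) (t + 1).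
Proof.
move=> hf; have hfv := in_hilbert_sub hf.
have [hf2 Hf] := (in_hilbertP zr_sq _ _).1 hf.
apply/(in_hilbertP zr_sq); split; first exact: (mulu_hilbert_bound wn s hfv).1.
move=> eps e0; have e4 : 0 < eps / 4 by lra.
have [c vc hc] := Hf _ e4.
exists [seq (rcons x.1.1 s, x.1.2, x.2) | x <- c]; first exact: valid_rcons.
rewrite -mulu_combr -muluB.
have hz := zv_sq_ne wn.
have := (mulu_hilbert_bound wn s (in_hilbertB hz hfv (combr_hilbert t vc))).2.
lra.
Qed.

Lemma inR_mulu_orth s t h : sq_int P h ->
  (forall w i, w != [::] -> ip P (mulu p u s t (zc p u r w t i)) h = 0) ->
  forall f, inR f t -> ip P (mulu p u s t f) h = 0.
Proof.
move=> hh H.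
apply: (hilbert_functional zr_sq (K := 4 * ip P h h)) => //.
- move=> a f g hf hg.
  have hf1 := (mulu_hilbert_bound wn s (in_hilbert_sub hf)).1.
  have hg1 := (mulu_hilbert_bound wn s (in_hilbert_sub hg)).1.
  by rewrite mulu_lin ipDl ?ipZl //; exact: sq_intZ.
- move=> f hf; have [hf1 b1] := mulu_hilbert_bound wn s (in_hilbert_sub hf).
  apply: le_trans (cauchy_schwarz_ip hf1 hh) _.
  have : ip P (mulu p u s t f) (mulu p u s t f) * ip P h h <= 4 * ip P f f * ip P h h.
    by rewrite ler_wpM2r // ip_ge0.
  lra.
Qed.

Definition vcl {n : nat} (t : int) (X : Omega -> 'cV[R]_n) : Prop :=
  forall i, inR (fun om => X om i 0) t.

Lemma vcl_vH {n : nat} t (X : Omega -> 'cV[R]_n) : vcl t X -> vH t X.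
Proof. by move=> h i; exact: in_hilbert_sub (h i). Qed.

Lemma vcl_zw w t : w != [::] -> vcl t (zw p u r w t).
Proof. by move=> w0 i; exact: (in_hilbert_zc zr_sq t i w0). Qed.

Lemma vclD {n : nat} t (X Y : Omega -> 'cV[R]_n) : vcl t X -> vcl t Y -> vcl t (X + Y).
Proof. by move=> hX hY i; rewrite compD; apply: (in_hilbertD zr_sq). Qed.

Lemma vclZ {n : nat} t c (X : Omega -> 'cV[R]_n) : vcl t X -> vcl t (c *: X).
Proof. by move=> hX i; rewrite compZ; apply: (in_hilbertZ zr_sq). Qed.

Lemma vclB {n : nat} t (X Y : Omega -> 'cV[R]_n) : vcl t X -> vcl t Y -> vcl t (X - Y).
Proof. by move=> hX hY; apply: vclD => //; rewrite -scaleN1r; exact: vclZ. Qed.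

Lemma vcl_lmx {a b : nat} t (A : 'M[R]_(a, b)) X : vcl t X -> vcl t (lmx A X).
Proof.
move=> hX i; rewrite comp_lmx; apply: (in_hilbert_sum zr_sq) => j.
exact: (in_hilbertZ zr_sq).
Qed.

Lemma vcl_sum {n : nat} t (I : Type) (s : seq I) (q : pred I) (F : I -> Omega -> 'cV[R]_n) :
  (forall i, vcl t (F i)) -> vcl t (\sum_(i <- s | q i) F i).
Proof.
by move=> hF i; rewrite comp_sum; apply: (in_hilbert_sum zr_sq) => j; exact: hF.
Qed.

Lemma vcl_Mv {n : nat} s t (X : Omega -> 'cV[R]_n) : vcl t X -> vcl (t + 1) (M s t X).
Proof. by move=> h i; rewrite comp_Mv; exact: (mulu_inR s (h i)). Qed.

Lemma vcl_orth {a b : nat} t (X : Omega -> 'cV[R]_a) (Y : Omega -> 'cV[R]_b) : vs X ->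
  (forall w, w != [::] -> E X (zw p u r w t) = 0) -> vcl t Y -> E X Y = 0.
Proof.
move=> hX H hY; apply/matrixP => i j; rewrite [RHS]mxE EcrossE ipC.
apply: (hilbert_orth zr_sq (t := t)); [exact: hX | | exact: hY].
move=> w j' w0; have /matrixP/(_ i j') := H w w0; rewrite EcrossE [in RHS]mxE => h.
by rewrite ipC.
Qed.

Lemma vcl_Mv_orth {a b : nat} s t (X : Omega -> 'cV[R]_a) (Y : Omega -> 'cV[R]_b) : vs X ->
  (forall w, w != [::] -> E X (M s t (zw p u r w t)) = 0) -> vcl t Y -> E X (M s t Y) = 0.
Proof.
move=> hX H hY; apply/matrixP => i j; rewrite [RHS]mxE EcrossE ipC comp_Mv.
apply: inR_mulu_orth; [exact: hX | | exact: hY].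
move=> w j' w0; have /matrixP/(_ i j') := H w w0; rewrite EcrossE [in RHS]mxE => h.
by rewrite ipC -comp_Mv.
Qed.

(** The difference lies in the closed span and is orthogonal to its generators, hence to itself. *)
Lemma vcl_unique {n : nat} t (X Y : Omega -> 'cV[R]_n) : vcl t X -> vcl t Y ->
  (forall w, w != [::] -> E X (zw p u r w t) = E Y (zw p u r w t)) -> vaeq P X Y.
Proof.
move=> hX hY H; have hX2 := vH_sq (vcl_vH hX); have hY2 := vH_sq (vcl_vH hY).
have hXY := vsqB hX2 hY2.
apply: Ecross_sub_eq0 => //.
apply: (vcl_orth (t := t)) => //; last exact: vclB.
by move=> w w0; rewrite EcrossBl ?H ?subrr //; exact: vH_sq (vcl_vH (vcl_zw t w0)).
Qed.

End OneProcess.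
End Closure.

(** * Innovations *)

Section Kalman.
Local Opaque Mv zw Ecross.
Context {R : realType} {d : measure_display} {Omega : measurableType d}.
Variable P : probability Omega R.
Context {S : finType}.
Variables (p : S -> R) (u : S -> int -> Omega -> R) (L : pred (seq S)).
Context {m : nat}.
Variable v : int -> Omega -> 'cV[R]_m.
Hypothesis wn : white_noise P p u L v.

Let hp : forall s, 0 < p s. Proof. by case: wn. Qed.
Let hL : admissible P u L. Proof. by case: wn. Qed.

Notation vs := (vsq P).
Notation E := (Ecross P).
Notation M := (Mv p u).
Notation vH := (vH P p u v).
Notation vHp := (vHp P p u v).
Notation vstat := (vstat P p u v).
Notation sp s := (Num.sqrt (p s)).

Lemma vstat_projection {n k : nat} (r : int -> Omega -> 'cV[R]_k)
    (X : int -> Omega -> 'cV[R]_n) :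
  (forall w, w != [::] -> vstat (zw p u r w)) -> vstat X ->
  exists Y : int -> Omega -> 'cV[R]_n,
    [/\ vstat Y, forall t, vcl P p u r t (Y t) &
        forall t w, w != [::] -> E (X t - Y t) (zw p u r w t) = 0].
Proof.
move=> hr hX.
have hr' w i : w != [::] -> stat_space P p u v (fun t => zc p u r w t i).
  by move=> w0; exact: hr w w0 i.
have /fin_all_exists[F hF] i := stat_projection wn hr' (hX i).
exists (fun t om => \col_i F i t om).
have e t i : (fun om => (\col_i F i t om) i 0) = F i t.
  by apply/funext => om; rewrite mxE.
split.
- move=> i; have [h _ _] := hF i; move: h; congr stat_space.
  by apply/funext => t; rewrite e.
- by move=> t i; have [_ h _] := hF i; rewrite e.
- move=> t w w0; apply/matrixP => i j; rewrite [RHS]mxE EcrossE.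
  have [_ _ /(_ t w j w0)] := hF i; congr (ip _ _ _ = _).
  by apply/funext => om; rewrite !mxE.
Qed.

Lemma sum_Mv_Ecross {a b : nat} s t (G : S -> Omega -> 'cV[R]_a) (Y : Omega -> 'cV[R]_b) :
  (forall s, vHp t (G s)) -> vHp t Y ->
  E (\sum_s sp s *: M s t (G s)) (M s t Y) = sp s *: E (M s t (G s)) (M s t Y).
Proof.
move=> hG hY; have hMY := Mv_sq wn s hY.
have hA s' := Mv_sq wn s' (hG s').
rewrite Ecross_suml //; last by move=> s'; exact: vsqZ.
rewrite (bigD1 s) //= big1 => [|s' ss]; last first.
  have e := Mv_letter_orth wn (hG s') hY ss.
  by rewrite EcrossZl // e scaler0.
by rewrite addr0 EcrossZl.
Qed.

Lemma past_noise_Mv_orth {a b : nat} s t (X : Omega -> 'cV[R]_a) (K : 'M[R]_(b, m)) :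
  vH t X -> E (M s t (lmx K (v t))) (M s t X) = 0.
Proof.
move=> hX; have hMX := vH_sq (Mv_vH wn s hX).
have e := noise_Mv_orth wn s s hX.
by rewrite Mv_lmx Ecross_mull //; [rewrite e mulmx0 | exact: Mv_v_sq wn s t].
Qed.

Lemma noise_lmx_orth {a b : nat} t (X : Omega -> 'cV[R]_a) (K : 'M[R]_(b, m)) :
  vH t X -> E (lmx K (v t)) X = 0.
Proof.
move=> hX; have e := past_noise_orth wn hX.
by rewrite Ecross_mull //; [rewrite e mulmx0 | exact: v_sq wn t | exact: vH_sq hX].
Qed.

Lemma zw_shift {k a : nat} (r : int -> Omega -> 'cV[R]_k) w s2 s t (X : Omega -> 'cV[R]_a) :
  (forall t, vHp t (r t)) -> vH t X ->
  E (M s t X) (M s t (zw p u r (rcons w s2) t)) =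
  (L [:: s2; s])%:R *: E X (zw p u r (rcons w s2) t).
Proof.
move=> hr; rewrite -[t](subrK 1) (zw_Mv wn) => hX.
exact: (Mv2_shift wn s s2 hX (zw_vHp wn hr w (t - 1))).
Qed.

Lemma zw_vstat {k : nat} (r : int -> Omega -> 'cV[R]_k) w :
  (forall s, vstat (fun t => M s (t - 1) (r (t - 1)))) ->
  w != [::] -> vstat (zw p u r w).
Proof.
move=> hr; elim/last_ind: w => [|w s IH _]; first by case/eqP.
have e : zw p u r (rcons w s) = fun t => M s (t - 1) (zw p u r w (t - 1)).
  by apply/funext => t; rewrite -(zw_Mv wn) subrK.
rewrite e; case/lastP: w IH {e} => [|w s'] IH; last first.
  by apply: (vstat_Mv wn); apply: IH; rewrite -size_eq0 size_rcons.
have e : (fun t => M s (t - 1) (zw p u r [::] (t - 1))) = (fun t => M s (t - 1) (r (t - 1))).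
  by apply/funext => t; rewrite zw_nil.
by rewrite e.
Qed.

Lemma Mv_affine_vstat {k n : nat} s (C : 'M[R]_(k, n)) (D : 'M[R]_(k, m))
    (X : int -> Omega -> 'cV[R]_n) : vstat X ->
  vstat (fun t => M s (t - 1) (output v X C D (t - 1))).
Proof.
move=> hX.
have := vstatD wn (vstat_lmx wn C (vstat_Mv wn s hX)) (vstat_lmx wn D (vstat_Mv_noise wn s)).
have -> // : (fun t => lmx C (M s (t - 1) (X (t - 1))) + lmx D (M s (t - 1) (v (t - 1))))
  = (fun t => M s (t - 1) (output v X C D (t - 1))).
by apply/funext => t; rewrite /output MvD !Mv_lmx.
Qed.

Context {n q : nat}.
Variables (A : S -> 'M[R]_n) (K : S -> 'M[R]_(n, m)) (x : int -> Omega -> 'cV[R]_n).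
Variables (C : 'M[R]_(q, n)) (D : 'M[R]_(q, m)).
Hypothesis hx : forall t, vH t (x t).
Hypothesis hrec : forall t, vaeq P (x (t + 1)) (step p u v A K x t).

Notation y := (output v x C D).

Let hy : forall t, vHp t (y t). Proof. exact: (output_vHp wn hx C D). Qed.
Let sx : vstat x. Proof. exact: (state_vstat wn hx hrec). Qed.

Lemma output_zw_vstat w : w != [::] -> vstat (zw p u y w).
Proof. by move=> w0; apply: zw_vstat => // s; exact: Mv_affine_vstat. Qed.

Variable xh : int -> Omega -> 'cV[R]_n.
Hypothesis sxh : vstat xh.
Hypothesis clxh : forall t, vcl P p u y t (xh t).
Hypothesis oxh : forall t w, w != [::] -> E (x t - xh t) (zw p u y w t) = 0.

Definition filter_error t : Omega -> 'cV[R]_n := x t - xh t.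
Notation xt := filter_error.
(** This is y - C xh, written as an output of the error state so that results on outputs apply. *)
Definition innovation t : Omega -> 'cV[R]_q := output v xt C D t.
Notation e := innovation.

Lemma filter_error_vstat : vstat xt.
Proof. exact: (vstatB wn). Qed.

Lemma filter_error_vH t : vH t (xt t).
Proof. exact: (vstat_vH wn t filter_error_vstat). Qed.

Lemma innovation_vHp t : vHp t (e t).
Proof. exact: (output_vHp wn filter_error_vH C D). Qed.

Lemma output_innovation t : y t = e t + lmx C (xh t).
Proof. by rewrite /innovation /output /xt lmxB addrAC subrK. Qed.

Lemma filter_error_orth {k : nat} t (Z : Omega -> 'cV[R]_k) :
  vcl P p u y t Z -> E (xt t) Z = 0.
Proof.
apply: (vcl_orth wn hy); first exact: vH_sq (filter_error_vH t).
by move=> w w0; exact: oxh.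
Qed.

(** Multiplying both sides by u_s rescales the correlation with each generator by 0 or 1, so
    orthogonality persists. *)
Lemma filter_error_Mv_orth {k : nat} s t (Z : Omega -> 'cV[R]_k) :
  vcl P p u y t Z -> E (M s t (xt t)) (M s t Z) = 0.
Proof.
have hxt := filter_error_vH t.
apply: (vcl_Mv_orth wn hy); first exact: vH_sq (Mv_vH wn s hxt).
move=> w; case/lastP: w => [|w s2 w0]; first by case/eqP.
have o := oxh t w0; have e1 := zw_shift w s2 s hy hxt.
by rewrite e1 o scaler0.
Qed.

Lemma innovation_orth {k : nat} t (Z : Omega -> 'cV[R]_k) :
  vcl P p u y t Z -> E (e t) Z = 0.
Proof.
move=> hZ; have hZv := vcl_vH wn hy hZ.
have h1 := vH_sq (filter_error_vH t); have h2 := v_sq wn t; have h3 := vH_sq hZv.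
have e1 := filter_error_orth hZ; have e2 := noise_lmx_orth D hZv.
rewrite EcrossDl //; [|exact: vsq_lmx|exact: vsq_lmx].
by rewrite e2 Ecross_mull // e1 mulmx0 addr0.
Qed.

Lemma innovation_Mv_orth {k : nat} s t (Z : Omega -> 'cV[R]_k) :
  vcl P p u y t Z -> E (M s t (e t)) (M s t Z) = 0.
Proof.
move=> hZ; have hZv := vcl_vH wn hy hZ.
have h1 := vH_sq (Mv_vH wn s (filter_error_vH t)); have h2 := Mv_v_sq wn s t.
have h3 := vH_sq (Mv_vH wn s hZv).
have e1 := filter_error_Mv_orth s hZ; have e2 := past_noise_Mv_orth s D hZv.
rewrite MvD EcrossDl //; [|by rewrite Mv_lmx; exact: vsq_lmx|by rewrite Mv_lmx; exact: vsq_lmx].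
by rewrite e2 Mv_lmx Ecross_mull // e1 mulmx0 addr0.
Qed.

Lemma Mv_innovation_orth {k : nat} s t (Z : Omega -> 'cV[R]_k) :
  vcl P p u y t Z -> E (M s t Z) (M s t (e t)) = 0.
Proof. by move=> hZ; rewrite -Ecross_tr innovation_Mv_orth // trmx0. Qed.

Lemma Mv_innovation_vcl s t : vcl P p u y (t + 1) (M s t (e t)).
Proof.
have -> : e t = y t - lmx C (xh t) by rewrite output_innovation addrK.
rewrite MvB; apply: (vclB wn hy).
  by rewrite -(zw_letter wn); exact: (vcl_zw wn hy).
by rewrite Mv_lmx; apply: (vcl_lmx wn hy); exact: (vcl_Mv wn hy).
Qed.

Lemma innovation_zw_vcl w t : w != [::] -> vcl P p u y t (zw p u e w t).
Proof.
elim/last_ind: w t => [t|w s IH t _]; first by case/eqP.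
rewrite -[t](subrK 1) (zw_Mv wn); case/lastP: w IH => [|w s'] IH.
  by rewrite zw_nil; exact: Mv_innovation_vcl.
by apply: (vcl_Mv wn hy); apply: IH; rewrite -size_eq0 size_rcons.
Qed.

Lemma innovation_zw_vstat w : w != [::] -> vstat (zw p u e w).
Proof.
by move=> w0; apply: zw_vstat => // s; apply: Mv_affine_vstat; exact: filter_error_vstat.
Qed.

Lemma innovation_zw_vHp w t : vHp t (zw p u e w t).
Proof. by apply: (zw_vHp wn) => t0; exact: innovation_vHp. Qed.

(** Different last letters are orthogonal at once, and a common last letter is removed. If one word
    is then exhausted, [e] is orthogonal to the past of [y]; otherwise the shift identity reduces to
    shorter words. *)
Lemma innovation_white w w' t : w != [::] -> w' != [::] -> w != w' ->
  E (zw p u e w t) (zw p u e w' t) = 0.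
Proof.
elim/last_ind: w w' t => [|w s IH] w' t; first by case/eqP.
case/lastP: w' => [_|w' s' _ _]; first by case/eqP.
rewrite -[t](subrK 1) !(zw_Mv wn); move: (t - 1) => {}t ww.
have [ss|ss] := eqVneq s s'; last first.
  exact: (Mv_letter_orth wn (innovation_zw_vHp w t) (innovation_zw_vHp w' t) ss).
subst s'; have {}ww : w != w' by apply: contraNneq ww => ->.
have [w0|w0] := eqVneq w [::].
  rewrite w0 zw_nil; apply: innovation_Mv_orth; apply: innovation_zw_vcl.
  by rewrite -w0 eq_sym.
have [w0'|w0'] := eqVneq w' [::].
  by rewrite w0' zw_nil; apply: Mv_innovation_orth; exact: innovation_zw_vcl.
have hw : vH t (zw p u e w t) by exact: (vcl_vH wn hy (innovation_zw_vcl t w0)).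
have e0 := IH _ t w0 w0' ww.
case/lastP: w' w0' {ww} e0 => [|w' s2 _ e0]; first by case/eqP.
by have e1 := zw_shift w' s2 s innovation_vHp hw; rewrite e1 e0 scaler0.
Qed.

Definition innovation_cov s : 'M[R]_q := E (M s 0 (e 0)) (M s 0 (e 0)).

Lemma innovation_cov_st s t : E (M s t (e t)) (M s t (e t)) = innovation_cov s.
Proof.
have h := Mv_affine_vstat s C D filter_error_vstat.
by have := vstat_Ecross wn (t + 1) (0 + 1) h h; rewrite !addrK.
Qed.

Definition cross_gain s : 'M[R]_(n, q) :=
  E (M s 0 (lmx (A s) (x 0) + lmx (K s) (v 0))) (M s 0 (e 0)).

Lemma cross_gain_st s t :
  E (M s t (lmx (A s) (x t) + lmx (K s) (v t))) (M s t (e t)) = cross_gain s.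
Proof.
have h1 := Mv_affine_vstat s (A s) (K s) sx.
have h2 := Mv_affine_vstat s C D filter_error_vstat.
by have := vstat_Ecross wn (t + 1) (0 + 1) h1 h2; rewrite !addrK.
Qed.

Let hAK s t : vHp t (lmx (A s) (x t) + lmx (K s) (v t)).
Proof. exact: (output_vHp wn hx (A s) (K s) t). Qed.

(* The innovation covariance may be singular, hence the partial inverse. *)
Definition kalman_gain s : 'M[R]_(n, q) := cross_gain s *m pinvmx (innovation_cov s).
Notation Kh := kalman_gain.

(** A combination of innovation coordinates with zero second moment vanishes almost everywhere and
    so correlates with nothing. Hence the kernel of the innovation covariance annihilates the cross
    gain, and the partial inverse acts as an inverse. *)
Lemma kalman_gainE s : Kh s *m innovation_cov s = cross_gain s.
Proof.
rewrite /kalman_gain mulmxKpV // submxE.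
set N := cokermx _; have hMe := Mv_sq wn s (innovation_vHp 0).
have hMA := Mv_sq wn s (hAK s 0).
have hN := vsq_lmx N^T hMe.
have z : vaeq P (lmx N^T (M s 0 (e 0))) 0.
  apply: Ecross_self_eq0 => //.
  rewrite Ecross_mull // Ecross_mulr // -/(innovation_cov s) trmxK.
  by rewrite mulmx_coker mulmx0.
have <- : E (M s 0 (lmx (A s) (x 0) + lmx (K s) (v 0))) (lmx N^T (M s 0 (e 0)))
    = cross_gain s *m N by rewrite Ecross_mulr // trmxK.
rewrite (Ecross_aeqr _ hMA z); last first.
  by move=> i; have := sq_int0 P; congr sq_int; apply/funext => om; rewrite mxE.
by rewrite -Ecross_tr Ecross0l trmx0.
Qed.

Definition kalman_step t : Omega -> 'cV[R]_n := step p u e A Kh xh t.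

Let hG s t : vHp t (lmx (A s) (xh t) + lmx (Kh s) (e t)).
Proof.
apply: (vHpD wn); last by apply: (vHp_lmx wn); exact: innovation_vHp.
by apply: vHp_vH; apply: (vH_lmx wn); exact: (vcl_vH wn hy).
Qed.

(** Both sides lie in the past of [y], so equal correlations with the words of [y] suffice. Once the
    last letter is removed, the residual [G] must be orthogonal to the past, by the filter property,
    and to [y] itself, by the choice of the gain. *)
Lemma kalman_rec t : vaeq P (xh (t + 1)) (kalman_step t).
Proof.
apply: (vcl_unique wn hy (t := t + 1)) => //.
  apply: (vcl_sum wn hy) => s; apply: (vclZ wn hy); rewrite MvD !Mv_lmx.
  apply: (vclD wn hy); apply: (vcl_lmx wn hy); first exact: (vcl_Mv wn hy).
  exact: Mv_innovation_vcl.
move=> w w0; have hz := vcl_zw wn hy (t + 1) w0.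
have hz2 := vH_sq (vcl_vH wn hy hz).
have hx1 := vH_sq (hx (t + 1)); have hxh1 := vH_sq (vcl_vH wn hy (clxh (t + 1))).
have o := oxh (t + 1) w0; rewrite EcrossBl // in o.
move/eqP: o; rewrite subr_eq0 => /eqP <-.
have -> : E (x (t + 1)) (zw p u y w (t + 1)) = E (step p u v A K x t) (zw p u y w (t + 1)).
  apply: Ecross_aeql => //; have := step_sq wn A K hx t; exact.
case/lastP: w w0 {hz hz2} => [|w s _]; first by case/eqP.
rewrite (zw_Mv wn); set Z := zw p u y w t.
have hZ : vHp t Z by exact: (zw_vHp wn hy).
have e1 := sum_Mv_Ecross s (fun s => hAK s t) hZ.
have e2 := sum_Mv_Ecross s (fun s => hG s t) hZ.
rewrite /kalman_step /step e1 e2; congr (_ *: _).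
pose G := lmx (A s) (xt t) + lmx (K s) (v t) - lmx (Kh s) (e t).
have GE : lmx (A s) (x t) + lmx (K s) (v t) = (lmx (A s) (xh t) + lmx (Kh s) (e t)) + G.
  rewrite /G /xt lmxB; set a := lmx (A s) (x t); set b := lmx (K s) _.
  set c := lmx (A s) (xh t); set f := lmx (Kh s) _.
  by rewrite [RHS]addrC [c + f]addrC addrA subrK addrAC subrK.
have hGG : vHp t G.
  apply: (vHpB wn); last by apply: (vHp_lmx wn); exact: innovation_vHp.
  exact: (output_vHp wn filter_error_vH (A s) (K s) t).
suff G0 : E (M s t G) (M s t Z) = 0.
  have h1 := Mv_sq wn s (hG s t); have h2 := Mv_sq wn s hGG; have h3 := Mv_sq wn s hZ.
  by rewrite GE MvD (EcrossDl h1 h2 h3) G0; exact: addr0.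
have hMxt := vH_sq (Mv_vH wn s (filter_error_vH t)).
have hMv := Mv_v_sq wn s t; have hMe := Mv_sq wn s (innovation_vHp t).
have past k (Z' : Omega -> 'cV[R]_k) : vcl P p u y t Z' -> E (M s t G) (M s t Z') = 0.
  move=> hZ'; have hZv := vcl_vH wn hy hZ'.
  have hMZ := vH_sq (Mv_vH wn s hZv).
  have e3 := filter_error_Mv_orth s hZ'; have e4 := noise_Mv_orth wn s s hZv.
  have e5 := innovation_Mv_orth s hZ'.
  rewrite /G MvB MvD !Mv_lmx EcrossBl //; try exact: vsq_lmx; last first.
    by apply: vsqD; exact: vsq_lmx.
  rewrite EcrossDl //; try exact: vsq_lmx.
  by rewrite !Ecross_mull // e3 e4 e5 !mulmx0 subr0 addr0.
(* For the empty word the test vector is y = e + C xh: the [xh] part is in the past, and the [e]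
   part is the equation defining the gain. *)
rewrite /Z; have [w0|w0] := eqVneq w [::]; last exact/past/(vcl_zw wn hy).
have hxh := clxh t; have hMxh := vH_sq (Mv_vH wn s (vcl_vH wn hy hxh)).
have hMG := Mv_sq wn s hGG.
rewrite w0 zw_nil output_innovation MvD Mv_lmx EcrossDr //; last exact: vsq_lmx.
have e4 := past _ _ hxh.
rewrite Ecross_mulr // e4 mul0mx addr0.
have GE' : G = (lmx (A s) (x t) + lmx (K s) (v t)) - (lmx (A s) (xh t) + lmx (Kh s) (e t)).
  by rewrite GE addrAC subrr add0r.
have h1 := Mv_sq wn s (hAK s t); have h2 := Mv_sq wn s (hG s t).
rewrite GE' MvB EcrossBl // cross_gain_st MvD !Mv_lmx EcrossDl //; try exact: vsq_lmx.
have e3 := Mv_innovation_orth s hxh.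
by rewrite !Ecross_mull // e3 innovation_cov_st kalman_gainE mulmx0 add0r subrr.
Qed.

(** The mean is the inner product with the constant 1, a bounded functional vanishing on the
    [z_w]. *)
Lemma hilbert_mean0 f t : in_hilbert P p u f t v -> Ex P f = 0.
Proof.
move=> hf; have <- : ip P f (fun=> 1) = Ex P f.
  by congr Ex; apply/funext => om; rewrite mulr1.
apply: (hilbert_orth (zv_sq_ne wn)) hf; first exact: sq_int_cst.
have [_ _ _ [_ [h _]] _] := wn.
move=> w i w0; have [_ /matrixP/(_ i 0)] := h t w w0.
rewrite !mxE => <-; congr Ex; apply/funext => om; exact: mulr1.
Qed.

Lemma vHp_mean0 {k : nat} t (X : Omega -> 'cV[R]_k) : vHp t X -> Emx P X = 0.
Proof.
move=> hX; have hX2 := vHp_sq wn hX; case: hX hX2 => [N [Y [hY ->]]] hX2.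
apply/matrixP => i j; rewrite !mxE ord1.
have h1 := sq_int_cst P 1.
have one f : ip P f (fun=> 1) = Ex P f.
  by congr Ex; apply/funext => om; rewrite mulr1.
have hv j' : Ex P (fun om => v t om j' 0) = 0.
  have [_ _ _ [h _] _] := wn.
  by have [_ /matrixP/(_ j' 0)] := h t; rewrite !mxE.
have hvs := v_sq wn t.
rewrite -one compD comp_lmx ipDl //; last first.
- by apply: sq_int_sum => j'; apply: sq_intZ; exact: hvs.
- exact: in_hilbert_sq (hY i).
rewrite one (hilbert_mean0 (hY i)) add0r ip_suml //; last first.
  by move=> j'; apply: sq_intZ; exact: hvs.
by rewrite big1 // => j' _; rewrite ipZl // one hv mulr0.
Qed.

Lemma vs_fin_mean {k : nat} (X : Omega -> 'cV[R]_k) : vs X -> fin_mean P X.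
Proof. by move=> h i; exact: sq_int_integrable (h i). Qed.

Lemma vs_fin_cross {a b : nat} (X : Omega -> 'cV[R]_a) (Y : Omega -> 'cV[R]_b) :
  vs X -> vs Y -> fin_cross P X Y.
Proof. by move=> hX hY i j; exact: sq_int_mul (hX i) (hY j). Qed.

Lemma zw_notin0 {k : nat} (r : int -> Omega -> 'cV[R]_k) w t :
  w != [::] -> ~~ L w -> vaeq P (zw p u r w t) 0.
Proof.
move=> w0 Lw; apply: vaeqP => i.
have -> : (fun om => (0 : Omega -> 'cV[R]_k) om i 0) = 0 by apply/funext => om; rewrite mxE.
exact: (zc_notin p hL r t i w0 Lw).
Qed.

Lemma innovation_zw_orth w t : w != [::] -> E (e t) (zw p u e w t) = 0.
Proof. by move=> w0; apply: innovation_orth; exact: innovation_zw_vcl. Qed.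

(** Conditions on distinct words follow from whiteness, those outside [L] from the vanishing of u_w;
    moments and time-independence are inherited from the noise [v]. What remains is T_{ws,ws} =
    T_{w,w} for [ws] in [L], an instance of the shift identity. *)
Lemma innovation_RC : RC P p u L e.
Proof.
have hes t := vHp_sq wn (innovation_vHp t).
have hzs w t := vHp_sq wn (innovation_zw_vHp w t).
have rc0 (w : seq S) s : rcons w s != [::] by rewrite -size_eq0 size_rcons.
have cs (s : S) : [:: s] != [::] by [].
have rcl (w : seq S) (s s' : S) : w != [::] -> rcons w s != [:: s'].
  by case: w => // a w _; apply/eqP => /(congr1 size); rewrite /= size_rcons.
split; [|split; [|split; [|split; [|split; [|split; [|split; [|split; [|split; [|split; [|split; [|split]]]]]]]]]]].
- by move=> t; split; [exact: vs_fin_mean | exact: vHp_mean0 (innovation_vHp t)].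
- move=> t w w0; split; [exact: vs_fin_mean | exact: vHp_mean0 (innovation_zw_vHp w t)].
- by move=> t w w0; exact: vs_fin_cross.
- by move=> t w w' w0 w0'; exact: vs_fin_cross.
- by move=> t t' w w0; rewrite !innovation_zw_orth.
- move=> t t' w w' w0 w0'.
  exact: (vstat_Ecross wn t t' (innovation_zw_vstat w0) (innovation_zw_vstat w0')).
- by move=> s s' ss; apply: innovation_white => //; apply: contraNneq ss => -[->].
- move=> w w' s s' w0 w0' ss; apply: innovation_white => //.
  by apply: contraNneq ss => /rcons_inj[_ ->].
- move=> w w' s w0 w0' hLL.
  have [ww|ww] := eqVneq w w'; last first.
    rewrite /Tr !innovation_white //; apply: contraNneq ww => h.
    by have [->] := rcons_inj h.
  subst w'; rewrite orbb in hLL; rewrite /Tr.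
  rewrite -{1 2}[0](addNr (1 : int)) !(zw_Mv wn).
  have hw : vH (-1) (zw p u e w (-1)) by exact: (vcl_vH wn hy (innovation_zw_vcl _ w0)).
  rewrite (vstat_Ecross wn 0 (-1) (innovation_zw_vstat w0) (innovation_zw_vstat w0)).
  case/lastP: w w0 hLL hw {w0'} => [|w s2] w0; first by case/eqP: w0.
  rewrite (L_rcons2 hL) => /andP[_ L2] hw.
  have e1 := zw_shift w s2 s innovation_vHp hw.
  by rewrite e1 L2 scale1r.
- by move=> w s s' w0 ss; apply: innovation_white => //; exact: rcl.
- move=> w s w0; rewrite /Lam innovation_zw_orth // trmx0.
  by apply: innovation_white => //; exact: rcl.
- move=> w w' w0 w0' /orP[Lw|Lw]; rewrite /Tr.
    rewrite (Ecross_aeql _ (hzs w' 0) (zw_notin0 e 0 w0 Lw)) ?Ecross0l //.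
    by move=> i; have := sq_int0 P; congr sq_int; apply/funext => om; rewrite mxE.
  rewrite (Ecross_aeqr _ (hzs w 0) (zw_notin0 e 0 w0' Lw)).
    by rewrite -Ecross_tr Ecross0l trmx0.
  by move=> i; have := sq_int0 P; congr sq_int; apply/funext => om; rewrite mxE.
- move=> w w' s w0 w0' L1 L2.
  have ww : w != w' by apply: contraNneq L2 => <-.
  by rewrite /Tr !innovation_white // eq_sym.
Qed.

Hypothesis stA : stableA p A.
Hypothesis A5a : forall s1 s2, ~~ L [:: s1; s2] -> A s2 *m A s1 = 0.

(** [X] is a state process with zero noise gain, so the matrices E[X X^T u_s^2] solve the
    homogeneous Lyapunov equations and vanish. Hence each product u_s X is zero, and so is the next
    state. *)
Lemma autonomous_zero (X : int -> Omega -> 'cV[R]_n) :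
  (forall t, vH t (X t)) ->
  (forall t, vaeq P (X (t + 1)) (\sum_s sp s *: M s t (lmx (A s) (X t)))) ->
  forall t, vaeq P (X t) 0.
Proof.
move=> hX hXrec.
pose K0 (s : S) : 'M[R]_(n, m) := 0.
have rec0 t : vaeq P (X (t + 1)) (step p u v A K0 X t).
  apply: vaeq_trans (hXrec t) _; rewrite /step.
  have -> : \sum_s sp s *: M s t (lmx (A s) (X t) + lmx (K0 s) (v t))
    = \sum_s sp s *: M s t (lmx (A s) (X t)).
    by apply: eq_bigr => s _; rewrite lmx0 addr0.
  exact: vaeq_refl.
have cov0 s t : state_cov P p u X s t = 0.
  rewrite (state_cov_st wn hX rec0 s t 0).
  pose W (s : S) : 'M[R]_n := 0.
  have key := @lyapunov_unique _ _ _ p L A stA A5a (fun s => state_cov P p u X s 0) (fun=> 0) W.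
  apply: (key _ _ s) => s1 /=.
    rewrite (state_cov_lyapunov wn hX rec0); congr (_ *: _).
    by apply: eq_bigr => s2 _; rewrite /K0 !mul0mx.
  rewrite big1 ?scaler0 // => s2 _.
  by rewrite mulmx0 mul0mx addr0.
have MX0 s t : vaeq P (M s t (X t)) 0.
  apply: Ecross_self_eq0; first exact: vH_sq (Mv_vH wn s (hX t)).
  apply/eqP; have /eqP := cov0 s t; rewrite /state_cov scaler_eq0 => /orP[|//].
  by rewrite gt_eqF.
move=> t; rewrite -[t](subrK 1); apply: vaeq_trans (hXrec _) _.
have h s : vaeq P (sp s *: M s (t - 1) (lmx (A s) (X (t - 1)))) 0.
  apply: filterS (MX0 s (t - 1)) => om h0.
  rewrite Mv_lmx -lmxZ; transitivity (A s *m (sp s *: M s (t - 1) (X (t - 1)) om)) => //.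
  by rewrite h0 scaler0 mulmx0.
have hall : {ae P, forall om, forall s, (sp s *: M s (t - 1) (lmx (A s) (X (t - 1)))) om = 0}.
  by apply: filter_forall => s; exact: h.
apply: filterS hall => om h0; rewrite fct_sumE big1 // => s _; exact: h0.
Qed.

(** Needed for (A3) once the innovation serves as noise. The projection [x1] obeys the same
    recursion as [xh] with the same innovation term, which cancels in [x2]. *)
Lemma filter_innovation_vcl t : vcl P p u e t (xh t).
Proof.
have [x1 [sx1 cl1 o1]] := vstat_projection innovation_zw_vstat sxh.
pose x2 t := xh t - x1 t.
have hx1 t0 : vH t0 (x1 t0) by exact: (vstat_vH wn t0 sx1).
have hxh t0 : vH t0 (xh t0) by exact: (vstat_vH wn t0 sxh).
have hx2 t0 : vH t0 (x2 t0) by exact: (vHB wn).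
have hE := innovation_vHp.
have cl_y k t0 (Z : Omega -> 'cV[R]_k) : vcl P p u e t0 Z -> vcl P p u y t0 Z.
  move=> hZ i.
  have /(in_hilbertP (zr_sq wn hE))[hf Hf] := hZ i.
  have hzy := zr_sq wn hy.
  apply: (in_hilbert_close hzy) => // eps e0; have [c vc hc] := Hf _ e0.
  exists (comb p u e c t0) => //.
  apply: (comb_ind (Q := fun f => in_hilbert P p u f t0 y)) => //.
    exact: (in_hilbert0 hzy).
  move=> a w j f w0 hf1; apply: (in_hilbertD hzy) => //; apply: (in_hilbertZ hzy).
  exact: innovation_zw_vcl w0 j.
(* Placing [x2] in the past of [y] makes the innovation orthogonal to it, also after multiplication
   by an input. *)
have cl2 t0 : vcl P p u y t0 (x2 t0) by apply: (vclB wn hy) => //; exact: cl_y.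
pose R1 t := step p u e A Kh x1 t.
have hF s t0 : vHp t0 (lmx (A s) (x1 t0) + lmx (Kh s) (e t0)).
  apply: (vHpD wn); last by apply: (vHp_lmx wn); exact: hE.
  by apply: vHp_vH; exact: (vH_lmx wn).
have x1rec t0 : vaeq P (x1 (t0 + 1)) (R1 t0).
  apply: (vcl_unique wn hE (t := t0 + 1)) => //.
    apply: (vcl_sum wn hE) => s; apply: (vclZ wn hE); rewrite MvD !Mv_lmx.
    apply: (vclD wn hE); apply: (vcl_lmx wn hE); first exact: (vcl_Mv wn hE).
    by rewrite -(zw_letter wn); exact: (vcl_zw wn hE).
  move=> w w0; have hz2 := vHp_sq wn (innovation_zw_vHp w (t0 + 1)).
  have o := o1 (t0 + 1) w w0; rewrite EcrossBl // in o; first last.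
  - exact: vH_sq (hx1 _).
  - exact: vH_sq (hxh _).
  move/eqP: o; rewrite subr_eq0 => /eqP <-.
  have hks : vs (kalman_step t0).
    by apply: vsq_sum => s; apply: vsqZ; apply: (Mv_sq wn); exact: hG.
  rewrite (Ecross_aeql hks hz2 (kalman_rec t0)).
  case/lastP: w w0 {hz2} => [|w s _]; first by case/eqP.
  rewrite (zw_Mv wn); set Z := zw p u e w t0.
  have hZ : vHp t0 Z by exact: innovation_zw_vHp.
  have e1 := sum_Mv_Ecross s (fun s => hG s t0) hZ.
  have e2 := sum_Mv_Ecross s (fun s => hF s t0) hZ.
  rewrite /kalman_step /R1 /step e1 e2; congr (_ *: _).
  have GE : lmx (A s) (xh t0) + lmx (Kh s) (e t0) =
      (lmx (A s) (x1 t0) + lmx (Kh s) (e t0)) + lmx (A s) (x2 t0).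
    by rewrite /x2 lmxB [RHS]addrC addrA subrK.
  have hA2 : vHp t0 (lmx (A s) (x2 t0)) by apply: vHp_vH; exact: (vH_lmx wn).
  rewrite GE MvD EcrossDl; try by apply: (Mv_sq wn).
  have h2 := vH_sq (Mv_vH wn s (hx2 t0)); have hMZ := Mv_sq wn s hZ.
  suff e3 : E (M s t0 (x2 t0)) (M s t0 Z) = 0.
    by rewrite Mv_lmx [E (lmx _ _) _]Ecross_mull // e3 mulmx0 addr0.
  rewrite /Z; clear e1 e2 hMZ hZ Z; case/lastP: w => [|w s2].
    by rewrite zw_nil; exact: Mv_innovation_orth.
  have e4 := zw_shift w s2 s hE (hx2 t0).
  have w1 : rcons w s2 != [::] by rewrite -size_eq0 size_rcons.
  by rewrite e4 (o1 t0 _ w1) scaler0.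
have x2rec t0 : vaeq P (x2 (t0 + 1)) (\sum_s sp s *: M s t0 (lmx (A s) (x2 t0))).
  have h := vaeqB (kalman_rec t0) (x1rec t0); apply: vaeq_trans h _.
  rewrite /kalman_step /R1 /step -sumrB.
  have -> : \sum_s (sp s *: M s t0 (lmx (A s) (xh t0) + lmx (Kh s) (e t0)) -
       sp s *: M s t0 (lmx (A s) (x1 t0) + lmx (Kh s) (e t0))) =
     \sum_s sp s *: M s t0 (lmx (A s) (x2 t0)).
    apply: eq_bigr => s _; rewrite -scalerBr -MvB; congr (_ *: M s t0 _).
    by rewrite /x2 lmxB opprD addrACA subrr addr0.
  exact: vaeq_refl.
have x20 := autonomous_zero hx2 x2rec t.
move=> i; apply: (in_hilbert_aeq (zr_sq wn hE) _ _ (cl1 t i)).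
  exact: in_hilbert_sq (hxh t i).
apply: vaeq_comp; apply: filterS x20 => om /eqP.
by rewrite subr_eq0 => /eqP.
Qed.
End Kalman.

(** * The filter stays in the reachable subspace *)

Section KalmanRange.
Local Opaque Mv zw Ecross.
Context {R : realType} {d : measure_display} {Omega : measurableType d}.
Variable P : probability Omega R.
Context {S : finType}.
Variables (p : S -> R) (u : S -> int -> Omega -> R) (L : pred (seq S)).
Context {m : nat}.
Variable v : int -> Omega -> 'cV[R]_m.
Hypothesis wn : white_noise P p u L v.
Context {n q : nat}.
Variables (A : S -> 'M[R]_n) (K : S -> 'M[R]_(n, m)) (x : int -> Omega -> 'cV[R]_n).
Variables (C : 'M[R]_(q, n)) (D : 'M[R]_(q, m)).
Hypothesis hx : forall t, vH P p u v t (x t).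
Hypothesis hrec : forall t, vaeq P (x (t + 1)) (step p u v A K x t).
Hypothesis A5a : forall s1 s2, ~~ L [:: s1; s2] -> A s2 *m A s1 = 0.
Hypothesis A5b : forall s1 s2, ~~ L [:: s1; s2] ->
  A s2 *m K s1 *m Ecross P (zw p u v [:: s1] 0) (zw p u v [:: s1] 0) = 0.
Variable xh : int -> Omega -> 'cV[R]_n.
Notation y := (output v x C D).
Hypothesis sxh : vstat P p u v xh.
Hypothesis clxh : forall t, vcl P p u y t (xh t).
Hypothesis oxh : forall t w, w != [::] -> Ecross P (x t - xh t) (zw p u y w t) = 0.

Let hp : forall s, 0 < p s. Proof. by case: wn. Qed.
Notation E := (Ecross P).
Notation M := (Mv p u).
Notation sp s := (Num.sqrt (p s)).
Notation e := (innovation v x C D xh).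
Notation Kh := (kalman_gain P p u v A K x C D xh).
Notation Gh := (cross_gain P p u v A K x C D xh).

(** Supplies (A5) for the filter: one term of the cross gain is killed by A_{s2} A_{s1} = 0, the
    other by the vanishing of the forbidden noise. *)
Lemma forbidden_cross_gain s1 s2 : ~~ L [:: s1; s2] -> A s2 *m Gh s1 = 0.
Proof.
move=> Ls; have hMe := Mv_sq wn s1 (innovation_vHp wn C D hx hrec sxh 0).
have hMx := vH_sq (Mv_vH wn s1 (hx 0)); have hMv := Mv_v_sq wn s1 0.
rewrite /cross_gain MvD !Mv_lmx EcrossDl //; try exact: vsq_lmx.
have e1 := forbidden_noise_Ecross wn A5b 0 Ls hMe.
by rewrite !Ecross_mull // mulmxDr e1 mulmxA A5a // mul0mx addr0.
Qed.

(** [N] stands for any matrix annihilating the reachable subspace of [R_B]. *)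
Variable N : 'M[R]_n.
Hypothesis hN : forall w s,
  N *m mxw (fun s => sp s *: A s) w *m input_gain P p u v A K x C D s = 0.

Lemma filter_range t : vaeq P (lmx N (xh t)) 0.
Proof.
have hy := output_vHp wn hx C D.
have hxh : vsq P (xh t) := vH_sq (vcl_vH wn hy (clxh t)).
have hNx := vsq_lmx N hxh.
apply: Ecross_self_eq0 => //.
apply: (vcl_orth wn hy (t := t)) => //; last exact: (vcl_lmx wn hy).
case=> [|s w]; first by case/eqP.
move=> w0; have hz := vH_sq (zw_vH_of_vHp wn hy t w0).
have o := oxh t w0; rewrite EcrossBl // in o; last exact: vH_sq (hx t).
move/eqP: o; rewrite subr_eq0 => /eqP o.
rewrite Ecross_mull // -o (state_output_Ecross wn hx hrec A5a A5b).
by rewrite mulmxA hN.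
Qed.

(** Correlating N xh = 0 at time 1 with the product of u_s and the innovation at time 0 isolates the
    cross gain, up to the factor sqrt(p_s). *)
Lemma cross_gain_range s : N *m Gh s = 0.
Proof.
have hy := output_vHp wn hx C D.
have hev := innovation_vHp wn C D hx hrec sxh 0.
have hMe := Mv_sq wn s hev.
have hxh t : vsq P (xh t) := vH_sq (vcl_vH wn hy (clxh t)).
have hG s' : vHp P p u v 0 (lmx (A s') (xh 0) + lmx (Kh s') (e 0)).
  apply: (vHpD wn); last by apply: (vHp_lmx wn).
  by apply: vHp_vH; apply: (vH_lmx wn); exact: (vcl_vH wn hy).
have hks : vsq P (kalman_step P p u v A K x C D xh 0).
  by apply: vsq_sum => s'; apply: vsqZ; apply: (Mv_sq wn); exact: hG.
have e0 := sum_Mv_Ecross wn s hG hev.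
have e1 : E (xh (0 + 1)) (M s 0 (e 0)) = sp s *: Gh s.
  rewrite (Ecross_aeql hks hMe (kalman_rec wn hx hrec sxh clxh oxh 0)).
  rewrite /kalman_step /step e0; congr (_ *: _).
  have hMxh := vH_sq (Mv_vH wn s (vcl_vH wn hy (clxh 0))).
  rewrite MvD !Mv_lmx EcrossDl //; try exact: vsq_lmx.
  have e2 := Mv_innovation_orth wn hx hrec sxh oxh s (clxh 0).
  rewrite !Ecross_mull // e2 (innovation_cov_st wn C D hx hrec sxh).
  by rewrite (kalman_gainE wn C D hx hrec sxh) mulmx0 add0r.
have e3 : E (lmx N (xh (0 + 1))) (M s 0 (e 0)) = 0.
  rewrite (Ecross_aeql _ hMe (filter_range _)) ?Ecross0l //.
  by move=> i; have := sq_int0 P; congr sq_int; apply/funext => om; rewrite mxE.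
have e4 : sp s *: (N *m Gh s) = 0.
  by rewrite scalemxAr -e1 -Ecross_mull //; exact: hxh.
have := e4; move/eqP; rewrite scaler_eq0 => /orP[|/eqP//].
by rewrite sqrtr_eq0 leNgt hp.
Qed.
End KalmanRange.

(** * Realizations *)

Lemma MvE {R : realType} {d : measure_display} {Omega : measurableType d} {S : finType}
    (p : S -> R) (u : S -> int -> Omega -> R) n s t (X : Omega -> 'cV[R]_n) om :
  Mv p u s t X om = (u s t om / Num.sqrt (p s)) *: X om.
Proof. by []. Qed.

Section Realizations.
Local Opaque Mv zw Ecross.
Context {R : realType} {d : measure_display} {Omega : measurableType d}.
Variable P : probability Omega R.
Context {S : finType}.
Variables (p : S -> R) (u : S -> int -> Omega -> R) (L : pred (seq S)).
Hypothesis hp : forall s, 0 < p s.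
Hypothesis hu : input_hyp P u.
Hypothesis hL : admissible P u L.
Context {q : nat}.
Variable y : int -> Omega -> 'cV[R]_q.

Notation sp s := (Num.sqrt (p s)).

Definition gbs_realization {n m : nat} (B : @gbs R d Omega S n m q) : Prop :=
  [/\ is_gbs P u B, assumptionA P p u L B & realizes P B y].

Section OneSystem.
Context {n m : nat}.
Variable B : @gbs R d Omega S n m q.
Hypothesis hB : gbs_realization B.

Notation v := (gv B).
Notation x := (gx B).
Notation A := (gA B).
Notation K := (gK B).
Notation C := (gC B).
Notation D := (gD B).

Lemma gbs_white_noise : white_noise P p u L v.
Proof. by case: hB => _ [h1 [h2 _]] _; split. Qed.

Lemma gbs_state_past t : vH P p u v t (x t).
Proof. by case: hB => _ [_ [_ [h3 _]]] _ i; exact: h3. Qed.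

Lemma gbs_stable : stableA p A.
Proof. by case: hB => _ [_ [_ [_ [h4 _]]]] _; exact: h4. Qed.

Lemma gbs_A5a s1 s2 : ~~ L [:: s1; s2] -> A s2 *m A s1 = 0.
Proof. by case: hB => _ [_ [_ [_ [_ h5]]]] _ /h5[]. Qed.

Lemma gbs_A5b s1 s2 : ~~ L [:: s1; s2] ->
  A s2 *m K s1 *m Ecross P (zw p u v [:: s1] 0) (zw p u v [:: s1] 0) = 0.
Proof. by case: hB => _ [_ [_ [_ [_ h5]]]] _ /h5[]. Qed.

Lemma sp_neq0 s : sp s != 0.
Proof. by rewrite sqrtr_eq0 -ltNge. Qed.

Lemma step_pointwise {k l : nat} (w : int -> Omega -> 'cV[R]_l) (A0 : S -> 'M[R]_k)
    (K0 : S -> 'M[R]_(k, l)) (X : int -> Omega -> 'cV[R]_k) t om :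
  step p u w A0 K0 X t om =
  \sum_s (u s t om *: (A0 s *m X t om + K0 s *m w t om)).
Proof.
rewrite /step fct_sumE; apply: eq_bigr => s _.
transitivity (sp s *: ((u s t om / sp s) *: (A0 s *m X t om + K0 s *m w t om))) => //.
by rewrite scalerA mulrC divfK ?sp_neq0.
Qed.

Lemma gbs_step t : vaeq P (x (t + 1)) (step p u v A K x t).
Proof.
case: hB => /(_ t) h _ _; apply: filterS h => om ->; symmetry.
exact: step_pointwise.
Qed.

Lemma gbs_output t : vaeq P (y t) (output v x C D t).
Proof. by case: hB => _ _ /(_ t). Qed.

Lemma gbs_Qm s : Qm P u B s = noise_cov P p u v s 0.
Proof.
have hMv := Mv_v_sq gbs_white_noise s 0.
rewrite /noise_cov -EcrossZl //; apply/matrixP => i j; rewrite EcrossE mxE.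
congr (Ex P _); apply/funext => om.
transitivity (u s 0 om ^+ 2 * (v 0 om i 0 * v 0 om j 0)).
  by rewrite !mxE big_ord1 !mxE.
transitivity ((p s * (u s 0 om / sp s * v 0 om i 0)) * (u s 0 om / sp s * v 0 om j 0)).
  have := sp_neq0 s; set a := sp s; have <- : a ^+ 2 = p s by rewrite sqr_sqrtr // ltW.
  by move=> a0; field.
transitivity ((p s *: Mv p u s 0 (v 0) om) i 0 * Mv p u s 0 (v 0) om j 0) => //.
by rewrite !MvE !mxE.
Qed.

(** [Psol] is chosen by [xget]; it is a solution because the second moments of the state provide
    one, and uniqueness identifies the two. *)
Lemma gbs_Psol s : Psol P p u L B s = state_cov P p u x s 0.
Proof.
have wn := gbs_white_noise.
have sol : is_Psol P p u L B (fun s => state_cov P p u x s 0).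
  move=> s1; rewrite (state_cov_lyapunov wn gbs_state_past gbs_step).
  by congr (_ *: _); apply: eq_bigr => s2 _; rewrite gbs_Qm.
have solP : is_Psol P p u L B (Psol P p u L B).
  exact: (@xgetPex _ (fun _ : S => 0) (is_Psol P p u L B) (ex_intro _ _ sol)).
exact: (lyapunov_unique gbs_stable gbs_A5a solP sol).
Qed.

Lemma gbs_Bm s : Bm P p u L B s = input_gain P p u v A K x C D s.
Proof. by rewrite /Bm /input_gain gbs_Psol gbs_Qm. Qed.

Lemma gbs_repr : is_repr (Psi_y P p u y) (R_B P p u L B).
Proof.
move=> [j s] w; have wn := gbs_white_noise; rewrite /Psi_y /=.
have hy := output_vHp wn gbs_state_past C D.
have hz := vHp_sq wn (zw_vHp wn hy (s :: w) 0).
have hzy := zw_vaeq p u (s :: w) 0 gbs_output.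
(* [y] agrees with the model output only almost everywhere and need not be measurable, hence the
   comparison through [ip_aeq]. *)
have -> : Ecross P (y 0) (zw p u y (s :: w) 0) =
    Ecross P (output v x C D 0) (zw p u (output v x C D) (s :: w) 0).
  have hy0 := vHp_sq wn (hy 0).
  apply/matrixP => i i'; rewrite !EcrossE; apply: ip_aeq.
  - exact: (hy0 i).1.
  - exact: (hz i').1.
  - exact: vaeq_comp (gbs_output 0).
  - exact: vaeq_comp hzy.
rewrite (output_Ecross wn gbs_state_past gbs_step gbs_A5a gbs_A5b).
by rewrite col_mulmx gbs_Bm.
Qed.
End OneSystem.

Lemma quotient_gbs {n m : nat} (B : @gbs R d Omega S n m q) : gbs_realization B ->
  exists r (B' : @gbs R d Omega S r m q),
    [/\ gbs_realization B', (r <= n)%N & (n <= r)%N -> observable (R_B P p u L B)].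
Proof.
move=> hB; have [r [T [Tm [TTm TA TC rn full]]]] := obs_factor (R_B P p u L B).
have wn := gbs_white_noise hB.
have TA' s : T *m gA B s = (T *m gA B s *m Tm) *m T.
  have := TA s; rewrite /= -!scalemxAr -!scalemxAl => h.
  have := congr1 (fun M => (sp s)^-1 *: M) h.
  by rewrite !scalerA mulVf ?sp_neq0 // !scale1r.
exists r, (GBS (fun s => T *m gA B s *m Tm) (fun s => T *m gK B s) (gC B *m Tm) (gD B)
  (fun t => lmx T (gx B t)) (gv B)).
split; [|exact: rn|exact: full].
case: (hB) => h1 [h2 [h3 [h4 [h5 h6]]]] h7; split.
- move=> t; apply: filterS (h1 t) => om e.
  transitivity (T *m gx B (t + 1) om) => //; rewrite e mulmx_sumr.
  apply: eq_bigr => s _; rewrite -scalemxAr mulmxDr !mulmxA; congr (_ *: (_ + _)).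
  by rewrite [in LHS]TA'.
- split => //; split => //; split; last split.
  + move=> t i; exact: (vH_lmx wn T (gbs_state_past hB t) i).
  + exact: (stableA_quot TTm TA' (gbs_stable hB)).
  + move=> s1 s2 Ls; have [a1 a2] := h6 s1 s2 Ls; rewrite [gA _]/= [gK _]/= [gv _]/=.
    (* Assumption (A5) descends to the quotient because [T *m A *m Tm *m T = T *m A]. *)
    have e1 : T *m gA B s2 *m Tm *m (T *m gA B s1) = 0.
      by rewrite mulmxA -TA' -mulmxA a1 mulmx0.
    split; first by rewrite mulmxA e1 mul0mx.
    by rewrite !mulmxA -TA' -!mulmxA !(mulmxA (gA B s2)) a2 mulmx0.
- move=> t; apply: filterS (h7 t) => om ->; congr (_ + _).
  by rewrite /lmx mulmxA -TC.
Qed.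

Lemma filtered_gbs {n m : nat} (B : @gbs R d Omega S n m q) : gbs_realization B ->
  exists r (B' : @gbs R d Omega S r q q),
    [/\ gbs_realization B', (r <= n)%N & (n <= r)%N -> reachable (R_B P p u L B)].
Proof.
move=> hB; have [r [T [Tm [TmT TA TG rn full]]]] := reach_factor (R_B P p u L B).
have wn := gbs_white_noise hB.
have hx := gbs_state_past hB; have hrec := gbs_step hB.
have A5a := gbs_A5a hB; have A5b := gbs_A5b hB.
have hy := output_vHp wn hx (gC B) (gD B).
have sx := state_vstat wn hx hrec.
have [xh [sxh clxh oxh]] := vstat_projection wn
  (fun w => output_zw_vstat wn (gC B) (gD B) hx hrec (w := w)) sx.
set e := innovation (gv B) (gx B) (gC B) (gD B) xh.
set Kh := kalman_gain P p u (gv B) (gA B) (gK B) (gx B) (gC B) (gD B) xh.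
have TA' s : gA B s *m T = T *m (Tm *m gA B s *m T).
  have := TA s; rewrite /= -!scalemxAr -!scalemxAl -scalemxAr => h.
  have := congr1 (fun M => (sp s)^-1 *: M) h.
  by rewrite !scalerA mulVf ?sp_neq0 // !scale1r.
(* The complementary projection, whose kernel is the range of [T], that is, the reachable
   subspace. *)
pose N : 'M[R]_n := 1%:M - T *m Tm.
have NT : N *m T = 0 by rewrite mulmxBl mul1mx -mulmxA TmT mulmx1 subrr.
have hN w s : N *m mxw (fun s => sp s *: gA B s) w *m
    input_gain P p u (gv B) (gA B) (gK B) (gx B) (gC B) (gD B) s = 0.
  rewrite -(gbs_Bm hB).
  have -> : Bm P p u L B s = T *m (Tm *m Bm P p u L B s).
    apply/matrixP => i j; have /matrixP/(_ i 0) := TG (j, s).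
    by rewrite /= -!col_mulmx !mxE.
  rewrite -mulmxA (mulmxA _ T) (mxw_intertwine TA) !mulmxA NT !mul0mx.
  by [].
have range t := filter_range wn hx hrec A5a A5b clxh oxh hN t.
have xhE t : {ae P, forall om, xh t om = T *m (Tm *m xh t om)}.
  apply: filterS (range t) => om; rewrite /lmx mulmxBl mul1mx => /eqP.
  by rewrite subr_eq0 -mulmxA => /eqP.
have hcov s1 : Tr P p u e [:: s1] [:: s1] =
    innovation_cov P p u (gv B) (gx B) (gC B) (gD B) xh s1.
  rewrite /Tr -[X in zw _ _ _ _ X](addNr (1 : int)) (zw_letter wn).
  exact: (innovation_cov_st wn (gC B) (gD B) hx hrec sxh).
(* Since y = C xh + e, the noise has dimension [q] and feedthrough [1%:M]; [Tm xh] gives the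
   coordinates of the filter in the reachable subspace. *)
exists r, (GBS (fun s => Tm *m gA B s *m T) (fun s => Tm *m Kh s) (gC B *m T) 1%:M
  (fun t => lmx Tm (xh t)) e).
split; [|exact: rn|exact: full].
split.
- move=> t; have h1 := kalman_rec wn hx hrec sxh clxh oxh t.
  apply: filterS2 h1 (xhE t) => om h1 h2.
  transitivity (Tm *m xh (t + 1) om) => //.
  rewrite h1 /kalman_step step_pointwise mulmx_sumr; apply: eq_bigr => s _.
  transitivity (u s t om *: ((Tm *m gA B s *m T) *m (Tm *m xh t om)
    + (Tm *m Kh s) *m e t om)); last by reflexivity.
  have h3 : gA B s *m xh t om = gA B s *m (T *m (Tm *m xh t om)) by rewrite -h2.
  by rewrite -scalemxAr mulmxDr h3 -!mulmxA.
- split; first exact: (innovation_RC wn hx hrec sxh clxh oxh).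
  split; first by move=> t w w'; exact: (innovation_white wn hx hrec sxh clxh oxh).
  split; last split.
  + move=> t i.
    have hcl := filter_innovation_vcl wn hx hrec sxh clxh oxh (gbs_stable hB) A5a t.
    exact: (vcl_lmx wn (innovation_vHp wn (gC B) (gD B) hx hrec sxh) Tm hcl i).
  + exact: (stableA_restr TmT TA' (gbs_stable hB)).
  + move=> s1 s2 Ls; rewrite [gA _]/= [gK _]/= [gv _]/=; split.
      have -> : Tm *m gA B s2 *m T *m (Tm *m gA B s1 *m T) =
          Tm *m gA B s2 *m (T *m (Tm *m gA B s1 *m T)) by rewrite !mulmxA.
      by rewrite -TA' mulmxA -(mulmxA Tm) A5a // mulmx0 mul0mx.
    (* Noise half of (A5): the gain times the innovation covariance is the cross gain, which lies in
       the range of [T] and is killed by A_{s2}. *)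
    have e1 := kalman_gainE wn (gC B) (gD B) hx hrec sxh s1.
    have e2 := cross_gain_range wn hx hrec A5a A5b sxh clxh oxh hN s1.
    have e3 := forbidden_cross_gain wn (gC B) (gD B) hx hrec A5a A5b sxh Ls.
    rewrite hcov; set Q := innovation_cov _ _ _ _ _ _ _ _ _ in e1 *.
    set G := cross_gain _ _ _ _ _ _ _ _ _ _ _ in e1 e2 e3 *.
    have e4 : T *m (Tm *m G) = G.
      by move/eqP: e2; rewrite mulmxBl mul1mx subr_eq0 -mulmxA => /eqP <-.
    have -> : Tm *m gA B s2 *m T *m (Tm *m Kh s1) *m Q =
        Tm *m (gA B s2 *m (T *m (Tm *m (Kh s1 *m Q)))) by rewrite !mulmxA.
    by rewrite e1 e4 e3 mulmx0.
- move=> t; apply: filterS2 (gbs_output hB t) (xhE t) => om h1 h2.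
  rewrite h1 (output_innovation (gv B) (gx B) (gC B) (gD B) xh).
  transitivity (e t om + gC B *m xh t om) => //.
  by rewrite mul1mx addrC {1}h2 /lmx !mulmxA.
Qed.

Lemma minimal_reach_obs {n m : nat} (B : @gbs R d Omega S n m q) :
  minimal_realization P p u L B y ->
  reachable (R_B P p u L B) /\ observable (R_B P p u L B).
Proof.
move=> [h1 [h2 [h3 hmin]]]; have hB : gbs_realization B by [].
have [r [B' [[g1 g2 g3] _ hr]]] := filtered_gbs hB.
have [r' [B'' [[k1 k2 k3] _ hr']]] := quotient_gbs hB.
split; [apply: hr | apply: hr'].
  exact: hmin g1 g2 g3.
exact: hmin k1 k2 k3.
Qed.
End Realizations.

Theorem mainTheorem11 (R : realType) (d : measure_display) (Omega : measurableType d)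
  (P : probability Omega R) (S : finType) (p : S -> R) (hp : forall s, 0 < p s)
  (u : S -> int -> Omega -> R) (hu : input_hyp P u)
  (L : pred (seq S)) (hL : admissible P u L)
  (q : nat) (y : int -> Omega -> 'cV[R]_q) :
  (forall (n m : nat) (B : @gbs R d Omega S n m q),
     is_gbs P u B -> assumptionA P p u L B -> realizes P B y ->
     (minimal_realization P p u L B y <-> minimal_repr (Psi_y P p u y) (R_B P p u L B)))
  /\
  (forall (n1 m1 n2 m2 : nat) (B1 : @gbs R d Omega S n1 m1 q) (B2 : @gbs R d Omega S n2 m2 q),
     minimal_realization P p u L B1 y -> minimal_realization P p u L B2 y ->
     repr_iso (R_B P p u L B1) (R_B P p u L B2)).
Proof.
have rep n m (B : @gbs R d Omega S n m q) : is_gbs P u B -> assumptionA P p u L B ->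
    realizes P B y -> is_repr (Psi_y P p u y) (R_B P p u L B).
  by move=> h1 h2 h3; apply: gbs_repr.
split.
  move=> n m B h1 h2 h3; split.
    move=> hmin; have [hr ho] := minimal_reach_obs hp hu hL hmin.
    exact: repr_minimal_of_reach_obs (rep _ _ _ h1 h2 h3) hr ho.
  move=> [_ hmin]; split => //; split => //; split => // n' m' B' g1 g2 g3.
  exact: hmin (rep _ _ _ g1 g2 g3).
move=> n1 m1 n2 m2 B1 B2 hm1 hm2.
have [r1 o1] := minimal_reach_obs hp hu hL hm1.
have [r2 o2] := minimal_reach_obs hp hu hL hm2.
have [h1 [h2 [h3 _]]] := hm1; have [g1 [g2 [g3 _]]] := hm2.
exact: repr_iso_of_reach_obs (rep _ _ _ h1 h2 h3) (rep _ _ _ g1 g2 g3) r1 o1 r2 o2.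
Qed.
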